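(* Let $\varphi: M^2 \to N^4(\epsilon)$ be a non-CMC biconservative W-surface with flat normal bundle. Assume that $3 f^2 + K - \epsilon \neq 0$, $\nabla^\perp E_3 \neq 0$, $A_4 \neq 0$ and $\nabla_{E_2} E_2 \neq 0$ at any point of $M$. Then, around any point of $M$, there exist local coordinates $(s, t)$ such that the functions $f$, $k_1$, $k_2$, $\alpha$, $a_2$, $b_1$ and $K$ depend only on $s$. Moreover, the tuple $(a_2, f, \alpha, k_2)$ is a solution of the first order ODE system \[ \left\{ \begin{array}{l} \dot a_2 = \epsilon + k_2 (2 f - k_2) - \alpha^2 + a_2^2 \\[3pt] \dot f = - \dfrac{f \alpha b_1}{3 f - k_2} \\[6pt] \dot \alpha = 2 \alpha a_2 + k_2 b_1 \\[3pt] \dot k_2 = 2 a_2 (k_2 - f) - \alpha b_1 \end{array} \right. \] where the dot denotes the derivative with respect to $s$.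
   Context: $N^4(\epsilon)$, $\epsilon\in\mathbb R$, is the 4-dimensional space form (complete, simply connected) of constant sectional curvature $\epsilon$. Manifolds are connected and immersions are isometric. For a surface $\varphi:M^2\to N^4(\epsilon)$: $B$ is the second fundamental form, $A_\eta$ the shape operator in the normal direction $\eta$, $\nabla$ the Levi-Civita connection, $\nabla^\perp$ the normal connection, $H=\frac12\operatorname{trace}B$, $f=|H|$ the mean curvature function, $K$ the Gaussian curvature. The surface has flat normal bundle if the curvature of $\nabla^\perp$ vanishes. It is biconservative if $2\operatorname{trace}A_{\nabla^\perp_{(\cdot)}H}(\cdot)+\operatorname{grad}|H|^2=0$. It is a W-surface if there is a smooth $W:\mathbb R^2\to\mathbb R$ with nowhere zero gradient such that $W(f,K)=0$ on $M$. ''Non-CMC biconservative'' means biconservative with $H\neq0$, $\operatorname{grad}f\neq0$ and $A_{H/f}\neq f\,\mathrm{Id}$ at every point. Frame (all results are local; $M$ is taken to be a connected domain where the following is defined): $E_3=H/f$, $E_4$ is a unit normal section orthogonal to $E_3$, $A_3=A_{E_3}$, $A_4=A_{E_4}$, and $\{E_1,E_2\}$ is an orthonormal tangent frame with $A_3E_1=k_1E_1$, $A_3E_2=k_2E_2$ (so $k_1+k_2=2f$, $k_1\ne k_2$). Flatness of the normal bundle gives $A_4E_1=\alpha E_1$, $A_4E_2=-\alpha E_2$ for a smooth function $\alpha$. The functions $a_i,b_i$ are defined by $\nabla_{E_1}E_1=-a_1E_2$, $\nabla_{E_2}E_2=a_2E_1$ and $b_i=\langle\nabla^\perp_{E_i}E_3,E_4\rangle$,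 $i=1,2$. Labelling convention: when $b_1b_2=0$ on $M$ and $\nabla^\perp E_3\neq0$ at every point (the first condition is automatic for the surfaces considered here), $E_1,E_2$ are labelled (interchanging them if necessary) so that $b_1\neq0$ everywhere and $b_2=0$ on $M$. *)

(* Defs.v *)
From Stdlib Require Import Reals.
From Coquelicot Require Import Coquelicot.
Open Scope R_scope.

Inductive axis := ax1 | ax2 | ax3 | ax4 | ax5.
Definition vec := axis -> R.

Definition vzero : vec := fun _ => 0.
Definition vadd (x y : vec) : vec := fun i => x i + y i.
Definition vsub (x y : vec) : vec := fun i => x i - y i.
Definition vscal (a : R) (x : vec) : vec := fun i => a * x i.

(* Euclidean for eps >= 0, Lorentzian (ax5 timelike) for eps < 0. *)
Definition ip (eps : R) (x y : vec) : R :=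
  x ax1 * y ax1 + x ax2 * y ax2 + x ax3 * y ax3 + x ax4 * y ax4
  + (if Rlt_dec eps 0 then - 1 else 1) * (x ax5 * y ax5).

(* N^4(eps): the sphere of radius 1/sqrt eps, the hyperplane x5 = 0, or the
   upper sheet of the hyperboloid <x,x> = 1/eps. *)
Definition space_form (eps : R) (x : vec) : Prop :=
  (eps = 0 -> x ax5 = 0) /\
  (eps <> 0 -> ip eps x x = / eps) /\
  (eps < 0 -> 0 < x ax5).

Definition tangent_space_form (eps : R) (x w : vec) : Prop :=
  (eps = 0 -> w ax5 = 0) /\ (eps <> 0 -> ip eps x w = 0).

(* For eps <> 0, the orthogonal projection of R^5 onto T_x N^4(eps); for
   eps = 0, the identity, applied only to vectors with x5 = 0.  The
   Levi-Civita connection of N^4(eps) is the projection of the flat one. *)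
Definition proj_space_form (eps : R) (x w : vec) : vec :=
  vsub w (vscal (eps * ip eps x w) x).

Definition smooth_on (U : R -> R -> Prop) (g : R -> R -> R) : Prop :=
  forall u v, U u v -> forall n, ex_diff_n g n u v.

Definition vsmooth_on (U : R -> R -> Prop) (V : R -> R -> vec) : Prop :=
  forall i, smooth_on U (fun u v => V u v i).

Definition open2 (U : R -> R -> Prop) : Prop :=
  forall u v, U u v -> locally_2d U u v.

Record param (M : Type) := Param {
  pdom : R -> R -> Prop;
  pmap :> R -> R -> M
}.
Arguments pdom {M}.
Arguments pmap {M}.

Definition is_param {M : Type} (x : param M) : Prop :=
  open2 (pdom x) /\
  forall u v u' v', pdom x u v -> pdom x u' v' ->
    x u v = x u' v' -> u = u' /\ v = v'.

Definition overlap {M : Type} (x y : param M) (u v : R) : Prop :=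
  pdom x u v /\ exists u' v', pdom y u' v' /\ y u' v' = x u v.

(* One direction only: the change of parameters y^{-1} o x is smooth. *)
Definition compatible {M : Type} (x y : param M) : Prop :=
  open2 (overlap x y) /\
  exists g h : R -> R -> R,
    smooth_on (overlap x y) g /\ smooth_on (overlap x y) h /\
    forall u v, overlap x y u v ->
      pdom y (g u v) (h u v) /\ y (g u v) (h u v) = x u v.

Definition open_in {M : Type} (A : nat -> param M) (O : M -> Prop) : Prop :=
  forall c u v, pdom (A c) u v -> O (A c u v) ->
    locally_2d (fun u' v' => O (A c u' v')) u v.

(* Connected smooth 2-manifold; indexing the atlas by nat (domains may be
   empty) expresses second countability. *)
Record surface := Surface {
  pt :> Type;
  chart : nat -> param pt;
  chart_param : forall c, is_param (chart c);
  chart_cover : forall p, exists c u v, pdom (chart c) u v /\ chart c u v = p;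
  chart_compatible : forall c d, compatible (chart c) (chart d);
  surface_hausdorff : forall p q : pt, p <> q ->
    exists O O' : pt -> Prop, open_in chart O /\ open_in chart O' /\
      O p /\ O' q /\ forall r, ~ (O r /\ O' r);
  surface_connected : forall O : pt -> Prop,
    open_in chart O -> open_in chart (fun p => ~ O p) ->
    (exists p, O p) -> forall p, O p
}.
Arguments chart : clear implicits.

Definition local_coordinates (M : surface) (x : param M) : Prop :=
  is_param x /\
  forall c, compatible x (chart M c) /\ compatible (chart M c) x.

Definition pull {M T : Type} (X : M -> T) (x : param M) : R -> R -> T :=
  fun u v => X (x u v).

(* Tangent vectors of a local immersion psi into N^4(eps) are identified with
   their images under d psi, so tangent and normal fields are maps into R^5
   and the induced metric is the restriction of ip. *)

Definition d1 (h : R -> R -> R) (u v : R) : R := Derive (fun z => h z v) u.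
Definition d2 (h : R -> R -> R) (u v : R) : R := Derive (fun z => h u z) v.
Definition D1 (V : R -> R -> vec) (u v : R) : vec :=
  fun i => d1 (fun u v => V u v i) u v.
Definition D2 (V : R -> R -> vec) (u v : R) : vec :=
  fun i => d2 (fun u v => V u v i) u v.

Section LocalGeometry.
Context (eps : R) (psi : R -> R -> vec).

Definition g11 (u v : R) : R := ip eps (D1 psi u v) (D1 psi u v).
Definition g12 (u v : R) : R := ip eps (D1 psi u v) (D2 psi u v).
Definition g22 (u v : R) : R := ip eps (D2 psi u v) (D2 psi u v).
Definition gdet (u v : R) : R := g11 u v * g22 u v - g12 u v * g12 u v.

(* Coordinates, then image, of the tangent vector w with
   <w, psi_1> = w1 and <w, psi_2> = w2 (raising an index). *)
Definition coef1 (w1 w2 u v : R) : R :=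
  (g22 u v * w1 - g12 u v * w2) / gdet u v.
Definition coef2 (w1 w2 u v : R) : R :=
  (g11 u v * w2 - g12 u v * w1) / gdet u v.
Definition sharp (w1 w2 u v : R) : vec :=
  vadd (vscal (coef1 w1 w2 u v) (D1 psi u v))
       (vscal (coef2 w1 w2 u v) (D2 psi u v)).

Definition comp1 (X : vec) (u v : R) : R :=
  coef1 (ip eps X (D1 psi u v)) (ip eps X (D2 psi u v)) u v.
Definition comp2 (X : vec) (u v : R) : R :=
  coef2 (ip eps X (D1 psi u v)) (ip eps X (D2 psi u v)) u v.

Definition tan_part (w : vec) (u v : R) : vec :=
  sharp (ip eps w (D1 psi u v)) (ip eps w (D2 psi u v)) u v.
Definition nor_part (w : vec) (u v : R) : vec := vsub w (tan_part w u v).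

Definition is_tangent (w : vec) (u v : R) : Prop :=
  exists a b, w = vadd (vscal a (D1 psi u v)) (vscal b (D2 psi u v)).
Definition is_normal (w : vec) (u v : R) : Prop :=
  tangent_space_form eps (psi u v) w /\
  ip eps w (D1 psi u v) = 0 /\ ip eps w (D2 psi u v) = 0.

Definition grad (h : R -> R -> R) (u v : R) : vec :=
  sharp (d1 h u v) (d2 h u v) u v.

(* Only meaningful for X tangent to psi; likewise for nabla, nabla_perp, sff
   and shape. *)
Definition nabla_bar (X : vec) (V : R -> R -> vec) (u v : R) : vec :=
  proj_space_form eps (psi u v)
    (vadd (vscal (comp1 X u v) (D1 V u v)) (vscal (comp2 X u v) (D2 V u v))).

(* The Levi-Civita connection of the induced metric and the normal connection
   are the tangent and normal parts of nabla_bar. *)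
Definition nabla (X : vec) (V : R -> R -> vec) (u v : R) : vec :=
  tan_part (nabla_bar X V u v) u v.
Definition nabla_perp (X : vec) (V : R -> R -> vec) (u v : R) : vec :=
  nor_part (nabla_bar X V u v) u v.

Definition nabla1 (V : R -> R -> vec) (u v : R) : vec :=
  nabla (D1 psi u v) V u v.
Definition nabla2 (V : R -> R -> vec) (u v : R) : vec :=
  nabla (D2 psi u v) V u v.
Definition nabla_perp1 (V : R -> R -> vec) (u v : R) : vec :=
  nabla_perp (D1 psi u v) V u v.
Definition nabla_perp2 (V : R -> R -> vec) (u v : R) : vec :=
  nabla_perp (D2 psi u v) V u v.

(* B(X, Y), extended from B(d_i, d_j) = (nabla_bar_{d_i} psi_j)^perp by
   bilinearity. *)
Definition sff (X Y : vec) (u v : R) : vec :=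
  vadd (vscal (comp1 Y u v) (nabla_perp X (D1 psi) u v))
       (vscal (comp2 Y u v) (nabla_perp X (D2 psi) u v)).

(* <A_eta X, Y> = <B(X, Y), eta>. *)
Definition shape (eta X : vec) (u v : R) : vec :=
  sharp (ip eps (sff X (D1 psi u v) u v) eta)
        (ip eps (sff X (D2 psi u v) u v) eta) u v.

(* sum_{i,j} g^{ij} T(psi_i, psi_j). *)
Definition vtrace (T : vec -> vec -> vec) (u v : R) : vec :=
  let e1 := D1 psi u v in
  let e2 := D2 psi u v in
  vscal (/ gdet u v)
    (vadd (vsub (vscal (g22 u v) (T e1 e1))
                (vscal (g12 u v) (vadd (T e1 e2) (T e2 e1))))
          (vscal (g11 u v) (T e2 e2))).

Definition mean_curvature_vector (u v : R) : vec :=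
  vscal (/ 2) (vtrace (fun X Y => sff X Y u v) u v).

Definition mean_curvature (u v : R) : R :=
  sqrt (ip eps (mean_curvature_vector u v) (mean_curvature_vector u v)).

(* <R(d_1, d_2) d_2, d_1> / det g. *)
Definition gauss_curvature (u v : R) : R :=
  ip eps (vsub (nabla1 (nabla2 (D2 psi)) u v) (nabla2 (nabla1 (D2 psi)) u v))
     (D1 psi u v) / gdet u v.

Definition flat_normal_on (U : R -> R -> Prop) : Prop :=
  forall eta : R -> R -> vec, vsmooth_on U eta ->
    (forall u v, U u v -> is_normal (eta u v) u v) ->
    forall u v, U u v ->
      nabla_perp1 (nabla_perp2 eta) u v = nabla_perp2 (nabla_perp1 eta) u v.

Definition biconservative_at (u v : R) : Prop :=
  let H := mean_curvature_vector in
  vadd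
    (vscal 2
      (vtrace (fun X Y => shape (nabla_perp X H u v) Y u v) u v))
    (grad (fun u v => ip eps (H u v) (H u v)) u v) = vzero.

End LocalGeometry.

(* M carries the induced metric, so that phi is isometric. *)
Definition immersed_surface (eps : R) (M : surface) (phi : M -> vec) : Prop :=
  (forall p, space_form eps (phi p)) /\
  forall c, vsmooth_on (pdom (chart M c)) (pull phi (chart M c)) /\
    forall u v, pdom (chart M c) u v ->
      forall a b,
        vadd (vscal a (D1 (pull phi (chart M c)) u v))
             (vscal b (D2 (pull phi (chart M c)) u v)) = vzero ->
        a = 0 /\ b = 0.

Definition flat_normal_bundle (eps : R) (M : surface) (phi : M -> vec) : Prop :=
  forall c, flat_normal_on eps (pull phi (chart M c)) (pdom (chart M c)).

Definition biconservative (eps : R) (M : surface) (phi : M -> vec) : Prop :=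
  forall c u v, pdom (chart M c) u v ->
    biconservative_at eps (pull phi (chart M c)) u v.

Definition is_mean_curvature (eps : R) (M : surface) (phi : M -> vec)
    (f : M -> R) : Prop :=
  forall c u v, pdom (chart M c) u v ->
    f (chart M c u v) = mean_curvature eps (pull phi (chart M c)) u v.

Definition is_gauss_curvature (eps : R) (M : surface) (phi : M -> vec)
    (K : M -> R) : Prop :=
  forall c u v, pdom (chart M c) u v ->
    K (chart M c u v) = gauss_curvature eps (pull phi (chart M c)) u v.

Definition non_cmc (eps : R) (M : surface) (phi : M -> vec) (f : M -> R)
    : Prop :=
  forall c u v, pdom (chart M c) u v ->
    let psi := pull phi (chart M c) in
    let f0 := f (chart M c u v) in
    let H := mean_curvature_vector eps psi u v in
    H <> vzero /\
    grad eps psi (pull f (chart M c)) u v <> vzero /\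
    exists X, is_tangent psi X u v /\
      shape eps psi (vscal (/ f0) H) X u v <> vscal f0 X.

Definition W_surface (M : surface) (f K : M -> R) : Prop :=
  exists W : R -> R -> R,
    smooth_on (fun _ _ => True) W /\
    (forall x y, d1 W x y <> 0 \/ d2 W x y <> 0) /\
    forall p, W (f p) (K p) = 0.

Record adapted_frame (eps : R) (M : surface) (phi : M -> vec)
    (f : M -> R) (E1 E2 E3 E4 : M -> vec) (k1 k2 : M -> R) : Prop := {
  frame_smooth : forall c,
    vsmooth_on (pdom (chart M c)) (pull E1 (chart M c)) /\
    vsmooth_on (pdom (chart M c)) (pull E2 (chart M c)) /\
    vsmooth_on (pdom (chart M c)) (pull E4 (chart M c));
  frame_tangent : forall c u v, pdom (chart M c) u v ->
    is_tangent (pull phi (chart M c)) (E1 (chart M c u v)) u v /\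
    is_tangent (pull phi (chart M c)) (E2 (chart M c u v)) u v;
  frame_orthonormal : forall p,
    ip eps (E1 p) (E1 p) = 1 /\ ip eps (E2 p) (E2 p) = 1 /\
    ip eps (E1 p) (E2 p) = 0;
  frame_E3 : forall c u v, pdom (chart M c) u v ->
    E3 (chart M c u v) =
    vscal (/ f (chart M c u v))
      (mean_curvature_vector eps (pull phi (chart M c)) u v);
  frame_E4 : forall c u v, pdom (chart M c) u v ->
    is_normal eps (pull phi (chart M c)) (E4 (chart M c u v)) u v /\
    ip eps (E4 (chart M c u v)) (E4 (chart M c u v)) = 1 /\
    ip eps (E3 (chart M c u v)) (E4 (chart M c u v)) = 0;
  frame_principal : forall c u v, pdom (chart M c) u v ->
    let p := chart M c u v in
    let psi := pull phi (chart M c) in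
    shape eps psi (E3 p) (E1 p) u v = vscal (k1 p) (E1 p) /\
    shape eps psi (E3 p) (E2 p) u v = vscal (k2 p) (E2 p)
}.

(* alpha is the E1-eigenvalue of A_4; when the normal bundle is flat,
   A_4 E1 = alpha E1 and A_4 E2 = - alpha E2. *)
Record frame_functions (eps : R) (M : surface) (phi : M -> vec)
    (E1 E2 E3 E4 : M -> vec) (alpha a1 a2 b1 b2 : M -> R) : Prop := {
  frame_alpha : forall c u v, pdom (chart M c) u v ->
    let p := chart M c u v in
    alpha p = ip eps (shape eps (pull phi (chart M c)) (E4 p) (E1 p) u v) (E1 p);
  frame_a : forall c u v, pdom (chart M c) u v ->
    let x := chart M c in
    let p := x u v in
    nabla eps (pull phi x) (E1 p) (pull E1 x) u v = vscal (- a1 p) (E2 p) /\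
    nabla eps (pull phi x) (E2 p) (pull E2 x) u v = vscal (a2 p) (E1 p);
  frame_b : forall c u v, pdom (chart M c) u v ->
    let x := chart M c in
    let p := x u v in
    b1 p = ip eps (nabla_perp eps (pull phi x) (E1 p) (pull E3 x) u v) (E4 p) /\
    b2 p = ip eps (nabla_perp eps (pull phi x) (E2 p) (pull E3 x) u v) (E4 p)
}.

Definition nowhere_parallel (eps : R) (M : surface) (phi eta : M -> vec)
    : Prop :=
  forall c u v, pdom (chart M c) u v ->
    exists X, is_tangent (pull phi (chart M c)) X u v /\
      nabla_perp eps (pull phi (chart M c)) X (pull eta (chart M c)) u v
      <> vzero.

Definition shape_nowhere_zero (eps : R) (M : surface) (phi eta : M -> vec)
    : Prop :=
  forall c u v, pdom (chart M c) u v ->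
    exists X, is_tangent (pull phi (chart M c)) X u v /\
      shape eps (pull phi (chart M c)) (eta (chart M c u v)) X u v <> vzero.

Definition nowhere_geodesic (eps : R) (M : surface) (phi X : M -> vec) : Prop :=
  forall c u v, pdom (chart M c) u v ->
    nabla eps (pull phi (chart M c)) (X (chart M c u v))
      (pull X (chart M c)) u v <> vzero.

(* Which principal direction is called E1; this does not presuppose that
   b1 b2 = 0. *)
Definition labelling_convention (eps : R) (M : surface) (phi E3 : M -> vec)
    (b1 b2 : M -> R) : Prop :=
  (forall p, b1 p * b2 p = 0) -> nowhere_parallel eps M phi E3 ->
  forall p, b1 p <> 0 /\ b2 p = 0.

(* The unknowns are (A, F, Al, K2) = (a_2, f, alpha, k_2); B = b_1 is a given
   coefficient.  The first clause keeps the quotient meaningful. *)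
Definition ode_system (eps : R) (A F Al K2 B : R -> R) (s : R) : Prop :=
  3 * F s - K2 s <> 0 /\
  is_derive A s (eps + K2 s * (2 * F s - K2 s) - Al s ^ 2 + A s ^ 2) /\
  is_derive F s (- (F s * Al s * B s / (3 * F s - K2 s))) /\
  is_derive Al s (2 * Al s * A s + K2 s * B s) /\
  is_derive K2 s (2 * A s * (K2 s - F s) - Al s * B s).

(* Main.v *)
From Pilot Require Import Defs.
From mathcomp Require boot.all_boot algebra.ssralg algebra.matrix reals_stdlib.Rstruct.
From Stdlib Require Import Reals Lra Psatz Nsatz FunctionalExtensionality IndefiniteDescription.
From Coquelicot Require Import Coquelicot.
(* Real analysis exports other functions named [d1] and [d2]. *)
Import Pilot.Defs.
Open Scope R_scope.

(** The proof is the method of moving frames.  Write [p], [q] for the derivatives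
    of [f] along [E1], [E2], put [k1 = f + k] and [k2 = f - k], and let [omega1],
    [omega2] be the coframe dual to [E1], [E2].

    The frame spans the tangent space of the space form, and for [eps <> 0] the
    position vector completes it to a basis of the ambient space
    ([space_form_frame]).  Expanding derivatives in it, one identity for the
    connection forms ([connection_curvature], [connection_product]) contains the
    equations of Gauss, Codazzi and Ricci.  Flatness of the normal bundle makes
    the shape operators commute ([flat_shape_operators_commute]), so both are
    diagonal and the equations take the form [structure_equations].
    Biconservativity reads [(f + k1) p = - f al b1] and [(f + k2) q = f al b2].

    With [S = k^2 + al^2] the curvature is [eps + f^2 - S], and the equations
    give [dS = 4 S (a2 omega1 - a1 omega2) - 4 f df].  The Weingarten relation
    makes [df] and [dS] proportional, whence [a1 p + a2 q = 0]
    ([bracket_annihilates_f]).  Since neither [a2] nor [df] vanishes, [p] does not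
    vanish, and [a1 = lam q], [a2 = - lam p] with [lam] smooth.  Integrability of
    [dS = - 4 (f + lam S) df] makes [d lam] proportional to [df] ([lam_df]);
    integrability of [dk] determines the mixed second derivative of [f]
    ([mixed_derivative_f]); the Ricci equation then reduces to
    [p q (al^2 - 4 f^2 + k^2) = 0] ([E2_f_eq_0]).  The last factor is
    [- (3 f^2 + K - eps)], so [q = 0].  Therefore [a1] and [b2] vanish and every
    invariant is constant along [E2] ([principal_rigidity]).

    As [a1 = 0], the form [omega1] is closed and locally [omega1 = ds].  Next to
    [s] one of the coordinates of the chart can serve as [t]
    ([closed_form_coordinates]).  A function annihilated by [E2] has differential
    a multiple of [ds]: it depends on [s] only, and its derivative with respect
    to [s] is its derivative along [E1] ([coordinate_change_derivatives]).  The
    structure equations along [E1] are then the differential system. *)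

(** * Smooth functions of two real variables *)

Definition Cn (U : R -> R -> Prop) (n : nat) (g : R -> R -> R) : Prop :=
  forall u v, U u v -> ex_diff_n g n u v.

Lemma smooth_Cn U g : smooth_on U g <-> forall n, Cn U n g.
Proof.
  split.
  - intros H n u v Huv; exact (H u v Huv n).
  - intros H u v Huv n; exact (H n u v Huv).
Qed.

Lemma open_nbhd (U : R -> R -> Prop) (P : R -> R -> Prop) u v :
  open2 U -> U u v -> (forall u v, U u v -> P u v) -> locally_2d P u v.
Proof.
  intros HU Huv HP; destruct (HU u v Huv) as [d Hd].
  exists d; intros a b Ha Hb; apply HP, Hd; assumption.
Qed.

Lemma open_near1 (U : R -> R -> Prop) u v :
  open2 U -> U u v -> locally u (fun z => U z v).
Proof.
  intros HU Huv; apply (locally_2d_1d_const_y U), HU, Huv.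
Qed.

Lemma open_near2 (U : R -> R -> Prop) u v :
  open2 U -> U u v -> locally v (fun z => U u z).
Proof.
  intros HU Huv; apply (locally_2d_1d_const_x U), HU, Huv.
Qed.

Lemma Cn_le U n m g : (m <= n)%nat -> Cn U n g -> Cn U m g.
Proof. intros Hm H u v Huv; apply (ex_diff_n_m n m Hm), H, Huv. Qed.

Lemma Cn_continuous U n g u v : Cn U n g -> U u v -> continuity_2d_pt g u v.
Proof. intros H Huv; specialize (H u v Huv); destruct n; apply H. Qed.

Lemma Cn_ext U n g h : open2 U -> (forall u v, U u v -> g u v = h u v) ->
  Cn U n g -> Cn U n h.
Proof.
  intros HU E H u v Huv; apply (ex_diff_n_ext_loc g).
  - apply (open_nbhd U); auto.
  - auto.
Qed.

Lemma differentiable_partials g u v l1 l2 : differentiable_pt_lim g u v l1 l2 ->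
  is_derive (fun z => g z v) u l1 /\ is_derive (fun z => g u z) v l2.
Proof.
  intros H; split; apply is_derive_Reals.
  - replace l1 with (l1 * 1 + l2 * 0) by ring.
    apply (derivable_pt_lim_comp_2d g (fun z => z) (fun _ => v) u l1 l2 1 0 H).
    + apply derivable_pt_lim_id.
    + apply derivable_pt_lim_const.
  - replace l2 with (l1 * 0 + l2 * 1) by ring.
    apply (derivable_pt_lim_comp_2d g (fun _ => u) (fun z => z) v l1 l2 0 1 H).
    + apply derivable_pt_lim_const.
    + apply derivable_pt_lim_id.
Qed.

Lemma differentiable_d1_d2 g u v l1 l2 : differentiable_pt_lim g u v l1 l2 ->
  d1 g u v = l1 /\ d2 g u v = l2.
Proof.
  intros H; destruct (differentiable_partials _ _ _ _ _ H) as [H1 H2].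
  split; apply is_derive_unique; assumption.
Qed.

(** The induction step of the regularity proofs: the partial derivatives, which
    are values of [Derive], may be replaced by formulas valid on the domain only. *)
Lemma Cn_step U n g g1 g2 : open2 U ->
  (forall u v, U u v -> differentiable_pt_lim g u v (g1 u v) (g2 u v)) ->
  Cn U n g1 -> Cn U n g2 -> Cn U (S n) g.
Proof.
  intros HU Hd H1 H2 u v Huv.
  pose proof (Hd u v Huv) as D.
  destruct (differentiable_partials _ _ _ _ _ D) as [E1 E2].
  simpl; repeat split.
  - apply differentiable_continuity_pt; exists (g1 u v), (g2 u v); exact D.
  - exists (g1 u v); exact E1.
  - exists (g2 u v); exact E2.
  - apply (Cn_ext U n g1); trivial.
    intros a b Hab; symmetry; apply (differentiable_d1_d2 _ _ _ _ _ (Hd a b Hab)).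
  - apply (Cn_ext U n g2); trivial.
    intros a b Hab; symmetry; apply (differentiable_d1_d2 _ _ _ _ _ (Hd a b Hab)).
Qed.

Lemma Cn_d1 U n g : Cn U (S n) g -> Cn U n (d1 g).
Proof. intros H u v Huv; apply ex_diff_n_deriv_aux1, H, Huv. Qed.

Lemma Cn_d2 U n g : Cn U (S n) g -> Cn U n (d2 g).
Proof. intros H u v Huv; apply ex_diff_n_deriv_aux2, H, Huv. Qed.

Lemma Cn_differentiable U n g u v : open2 U -> Cn U (S n) g -> U u v ->
  differentiable_pt_lim g u v (d1 g u v) (d2 g u v).
Proof.
  intros HU H Huv.
  apply filterdiff_differentiable_pt_lim.
  apply (is_derive_filterdiff g u v (d1 g) (d2 g u v)).
  - apply (locally_2d_locally (fun a b => is_derive (fun z => g z b) a (d1 g a b))).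
    apply (open_nbhd U); trivial.
    intros a b Hab; apply Derive_correct, (H a b Hab).
  - apply Derive_correct, (H u v Huv).
  - apply continuity_2d_pt_filterlim, (Cn_continuous U n); trivial; apply Cn_d1, H.
Qed.

Lemma smooth_ext U g h : open2 U -> (forall u v, U u v -> g u v = h u v) ->
  smooth_on U g -> smooth_on U h.
Proof.
  intros HU E H; apply smooth_Cn; intros n.
  apply (Cn_ext U n g); trivial; apply smooth_Cn, H.
Qed.

Lemma smooth_subset (U V : R -> R -> Prop) g :
  (forall u v, V u v -> U u v) -> smooth_on U g -> smooth_on V g.
Proof. intros HUV H u v Huv; apply H, HUV, Huv. Qed.

Lemma smooth_d1 U g : smooth_on U g -> smooth_on U (d1 g).
Proof.
  intros H; apply smooth_Cn; intros n; apply Cn_d1, smooth_Cn, H.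
Qed.

Lemma smooth_d2 U g : smooth_on U g -> smooth_on U (d2 g).
Proof.
  intros H; apply smooth_Cn; intros n; apply Cn_d2, smooth_Cn, H.
Qed.

Lemma smooth_continuous U g u v : smooth_on U g -> U u v -> continuity_2d_pt g u v.
Proof. intros H; apply (Cn_continuous U 0), smooth_Cn, H. Qed.

Lemma smooth_differentiable U g u v : open2 U -> smooth_on U g -> U u v ->
  differentiable_pt_lim g u v (d1 g u v) (d2 g u v).
Proof. intros HU H; apply (Cn_differentiable U 0); trivial; apply smooth_Cn, H. Qed.

Lemma smooth_derive1 U g u v : smooth_on U g -> U u v -> ex_derive (fun z => g z v) u.
Proof. intros H Huv; apply (H u v Huv 1%nat). Qed.

Lemma smooth_derive2 U g u v : smooth_on U g -> U u v -> ex_derive (fun z => g u z) v.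
Proof. intros H Huv; apply (H u v Huv 1%nat). Qed.

Lemma smooth_schwarz U g u v : open2 U -> smooth_on U g -> U u v ->
  d1 (d2 g) u v = d2 (d1 g) u v.
Proof.
  intros HU H Huv; apply (Schwarz g u v).
  - apply (open_nbhd U); trivial; intros a b Hab; repeat split.
    + apply (smooth_derive1 U); trivial.
    + apply (smooth_derive2 U); trivial.
    + apply (smooth_derive1 U (d2 g)); trivial; apply smooth_d2, H.
    + apply (smooth_derive2 U (d1 g)); trivial; apply smooth_d1, H.
  - apply (smooth_continuous U (d1 (d2 g))); trivial; apply smooth_d1, smooth_d2, H.
  - apply (smooth_continuous U (d2 (d1 g))); trivial; apply smooth_d2, smooth_d1, H.
Qed.

(** ** Closure of smoothness under the operations *)

Lemma Cn_const U n c : open2 U -> Cn U n (fun _ _ => c).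
Proof.
  intros HU; revert c; induction n as [|n IH]; intros c.
  - intros u v _; split; trivial; apply continuity_2d_pt_const.
  - apply (Cn_step U n _ (fun _ _ => 0) (fun _ _ => 0)); trivial.
    intros u v _ e; apply locally_2d_forall; intros a b.
    replace (c - c - _) with 0 by ring; rewrite Rabs_R0.
    apply Rmult_le_pos; [left; apply cond_pos|].
    apply (Rle_trans _ (Rabs (a - u))); [apply Rabs_pos | apply Rmax_l].
Qed.

Lemma differentiable_plus f g u v f1 f2 g1 g2 :
  differentiable_pt_lim f u v f1 f2 -> differentiable_pt_lim g u v g1 g2 ->
  differentiable_pt_lim (fun a b => f a b + g a b) u v (f1 + g1) (f2 + g2).
Proof.
  intros Hf Hg.
  assert (P : differentiable_pt_lim Rplus (f u v) (g u v) 1 1).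
  { intros e; apply locally_2d_forall; intros a b.
    replace (a + b - _ - _) with 0 by ring; rewrite Rabs_R0.
    apply Rmult_le_pos; [left; apply cond_pos|].
    apply (Rle_trans _ (Rabs (a - f u v))); [apply Rabs_pos | apply Rmax_l]. }
  replace (f1 + g1) with (1 * f1 + 1 * g1) by ring.
  replace (f2 + g2) with (1 * f2 + 1 * g2) by ring.
  exact (differentiable_pt_lim_comp _ _ _ _ _ _ _ _ _ _ _ P Hf Hg).
Qed.

Lemma differentiable_mult f g u v f1 f2 g1 g2 :
  differentiable_pt_lim f u v f1 f2 -> differentiable_pt_lim g u v g1 g2 ->
  differentiable_pt_lim (fun a b => f a b * g a b) u v
    (f1 * g u v + f u v * g1) (f2 * g u v + f u v * g2).
Proof.
  intros Hf Hg.
  assert (P : differentiable_pt_lim Rmult (f u v) (g u v) (g u v) (f u v)).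
  { intros e; exists e; intros a b Ha Hb.
    replace (a * b - _ - _) with ((a - f u v) * (b - g u v)) by ring.
    rewrite Rabs_mult; apply Rmult_le_compat; try apply Rabs_pos.
    - left; exact Ha.
    - apply Rmax_r. }
  replace (f1 * g u v + f u v * g1) with (g u v * f1 + f u v * g1) by ring.
  replace (f2 * g u v + f u v * g2) with (g u v * f2 + f u v * g2) by ring.
  exact (differentiable_pt_lim_comp _ _ _ _ _ _ _ _ _ _ _ P Hf Hg).
Qed.

Lemma Cn_plus U n f g : open2 U -> Cn U n f -> Cn U n g ->
  Cn U n (fun u v => f u v + g u v).
Proof.
  intros HU; revert f g; induction n as [|n IH]; intros f g Hf Hg.
  - intros u v Huv; split; trivial.
    apply continuity_2d_pt_plus; [apply Hf | apply Hg]; trivial.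
  - apply (Cn_step U n _ (fun u v => d1 f u v + d1 g u v)
             (fun u v => d2 f u v + d2 g u v)); trivial.
    + intros u v Huv; apply differentiable_plus; apply (Cn_differentiable U n); trivial.
    + apply IH; apply Cn_d1; trivial.
    + apply IH; apply Cn_d2; trivial.
Qed.

Lemma Cn_mult U n f g : open2 U -> Cn U n f -> Cn U n g ->
  Cn U n (fun u v => f u v * g u v).
Proof.
  intros HU; revert f g; induction n as [|n IH]; intros f g Hf Hg.
  - intros u v Huv; split; trivial.
    apply continuity_2d_pt_mult; [apply Hf | apply Hg]; trivial.
  - assert (Hf' : Cn U n f) by (apply (Cn_le U (S n)); auto).
    assert (Hg' : Cn U n g) by (apply (Cn_le U (S n)); auto).
    apply (Cn_step U n _ (fun u v => d1 f u v * g u v + f u v * d1 g u v)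
             (fun u v => d2 f u v * g u v + f u v * d2 g u v)); trivial.
    + intros u v Huv; apply differentiable_mult; apply (Cn_differentiable U n); trivial.
    + apply Cn_plus; trivial; apply IH; trivial; apply Cn_d1; trivial.
    + apply Cn_plus; trivial; apply IH; trivial; apply Cn_d2; trivial.
Qed.

Lemma continuity_2d_comp g x y u v : continuity_2d_pt g (x u v) (y u v) ->
  continuity_2d_pt x u v -> continuity_2d_pt y u v ->
  continuity_2d_pt (fun a b => g (x a b) (y a b)) u v.
Proof.
  intros Hg Hx Hy e; destruct (Hg e) as [d Hd].
  generalize (locally_2d_and _ _ _ _ (Hx d) (Hy d)).
  apply locally_2d_impl, locally_2d_forall; intros a b [H1 H2].
  apply Hd; assumption.
Qed.

Lemma Cn_comp U V n g x y : open2 U -> open2 V ->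
  (forall u v, U u v -> V (x u v) (y u v)) ->
  Cn V n g -> Cn U n x -> Cn U n y -> Cn U n (fun u v => g (x u v) (y u v)).
Proof.
  intros HU HV HUV; revert g; induction n as [|n IH]; intros g Hg Hx Hy.
  - intros u v Huv; split; trivial.
    apply continuity_2d_comp; [apply Hg, HUV | apply Hx | apply Hy]; trivial.
  - assert (Hx' : Cn U n x) by (apply (Cn_le U (S n)); auto).
    assert (Hy' : Cn U n y) by (apply (Cn_le U (S n)); auto).
    pose proof (IH _ (Cn_d1 _ _ _ Hg) Hx' Hy') as I1.
    pose proof (IH _ (Cn_d2 _ _ _ Hg) Hx' Hy') as I2.
    apply (Cn_step U n _
      (fun u v => d1 g (x u v) (y u v) * d1 x u v + d2 g (x u v) (y u v) * d1 y u v)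
      (fun u v => d1 g (x u v) (y u v) * d2 x u v + d2 g (x u v) (y u v) * d2 y u v));
      trivial.
    + intros u v Huv; apply differentiable_pt_lim_comp;
        [apply (Cn_differentiable V n); auto | |]; apply (Cn_differentiable U n); trivial.
    + apply Cn_plus; trivial; apply Cn_mult; trivial; apply Cn_d1; trivial.
    + apply Cn_plus; trivial; apply Cn_mult; trivial; apply Cn_d2; trivial.
Qed.

Lemma smooth_const U c : open2 U -> smooth_on U (fun _ _ => c).
Proof. intros HU; apply smooth_Cn; intros n; apply Cn_const, HU. Qed.

Lemma smooth_plus U f g : open2 U -> smooth_on U f -> smooth_on U g ->
  smooth_on U (fun u v => f u v + g u v).
Proof.
  intros HU Hf Hg; apply smooth_Cn; intros n; apply Cn_plus; trivial;
    apply smooth_Cn; trivial.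
Qed.

Lemma smooth_mult U f g : open2 U -> smooth_on U f -> smooth_on U g ->
  smooth_on U (fun u v => f u v * g u v).
Proof.
  intros HU Hf Hg; apply smooth_Cn; intros n; apply Cn_mult; trivial;
    apply smooth_Cn; trivial.
Qed.

Lemma smooth_opp U f : open2 U -> smooth_on U f -> smooth_on U (fun u v => - f u v).
Proof.
  intros HU Hf; apply (smooth_ext U (fun u v => -1 * f u v)); trivial.
  - intros; ring.
  - apply smooth_mult; trivial; apply smooth_const, HU.
Qed.

Lemma smooth_minus U f g : open2 U -> smooth_on U f -> smooth_on U g ->
  smooth_on U (fun u v => f u v - g u v).
Proof.
  intros HU Hf Hg; apply (smooth_plus U f (fun u v => - g u v)); trivial.
  apply smooth_opp; trivial.
Qed.

Lemma smooth_comp U V g x y : open2 U -> open2 V ->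
  (forall u v, U u v -> V (x u v) (y u v)) ->
  smooth_on V g -> smooth_on U x -> smooth_on U y ->
  smooth_on U (fun u v => g (x u v) (y u v)).
Proof.
  intros HU HV HUV Hg Hx Hy; apply smooth_Cn; intros n.
  apply (Cn_comp U V); trivial; apply smooth_Cn; trivial.
Qed.

Lemma differentiable_comp1 phi g u v l g1 g2 :
  is_derive phi (g u v) l -> differentiable_pt_lim g u v g1 g2 ->
  differentiable_pt_lim (fun a b => phi (g a b)) u v (l * g1) (l * g2).
Proof.
  intros Hp Hg.
  replace (l * g1) with (l * g1 + 0 * g1) by ring.
  replace (l * g2) with (l * g2 + 0 * g2) by ring.
  apply (differentiable_pt_lim_comp (fun a _ => phi a) g g); trivial.
  apply differentiable_pt_lim_proj1_0, is_derive_Reals, Hp.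
Qed.

Lemma smooth_inv U f : open2 U -> smooth_on U f ->
  (forall u v, U u v -> f u v <> 0) -> smooth_on U (fun u v => / f u v).
Proof.
  intros HU Hf Hn; apply smooth_Cn; intros n; induction n as [|n IH].
  - intros u v Huv; split; trivial; apply continuity_2d_pt_inv; auto.
    apply (smooth_continuous U); trivial.
  - assert (IH2 : Cn U n (fun u v => - (/ f u v * / f u v))).
    { apply (Cn_ext U n (fun u v => -1 * (/ f u v * / f u v))); trivial.
      - intros; ring.
      - apply Cn_mult; trivial; [apply Cn_const; trivial | apply Cn_mult; trivial]. }
    apply (Cn_step U n _ (fun u v => - (/ f u v * / f u v) * d1 f u v)
             (fun u v => - (/ f u v * / f u v) * d2 f u v)); trivial.
    + intros u v Huv.
      apply (differentiable_comp1 Rinv).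
      * replace (- (/ f u v * / f u v)) with (- 1 / f u v ^ 2) by (field; auto).
        apply (is_derive_inv (fun x => x) (f u v) 1); auto; apply @is_derive_id.
      * apply (smooth_differentiable U); trivial.
    + apply Cn_mult; trivial; apply smooth_Cn, smooth_d1, Hf.
    + apply Cn_mult; trivial; apply smooth_Cn, smooth_d2, Hf.
Qed.

Lemma smooth_sqrt U f : open2 U -> smooth_on U f ->
  (forall u v, U u v -> 0 < f u v) -> smooth_on U (fun u v => sqrt (f u v)).
Proof.
  intros HU Hf Hn; apply smooth_Cn; intros n; induction n as [|n IH].
  - intros u v Huv; split; trivial; apply continuity_1d_2d_pt_comp.
    + apply continuity_pt_sqrt; left; auto.
    + apply (smooth_continuous U); trivial.
  - assert (IH2 : Cn U n (fun u v => / (2 * sqrt (f u v)))).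
    { apply (Cn_ext U n (fun u v => / 2 * (sqrt (f u v) * / f u v))); trivial.
      - intros u v Huv; specialize (Hn u v Huv).
        pose proof (sqrt_lt_R0 _ Hn) as Hs.
        rewrite <- (sqrt_sqrt (f u v)) at 2 by lra; field; lra.
      - apply Cn_mult; trivial; [apply Cn_const; trivial | apply Cn_mult; trivial].
        apply smooth_Cn, smooth_inv; trivial.
        intros u v Huv; specialize (Hn u v Huv); lra. }
    apply (Cn_step U n _ (fun u v => / (2 * sqrt (f u v)) * d1 f u v)
             (fun u v => / (2 * sqrt (f u v)) * d2 f u v)); trivial.
    + intros u v Huv; apply (differentiable_comp1 sqrt).
      * apply is_derive_Reals, derivable_pt_lim_sqrt; auto.
      * apply (smooth_differentiable U); trivial.
    + apply Cn_mult; trivial; apply smooth_Cn, smooth_d1, Hf.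
    + apply Cn_mult; trivial; apply smooth_Cn, smooth_d2, Hf.
Qed.

Lemma smooth_div U f g : open2 U -> smooth_on U f -> smooth_on U g ->
  (forall u v, U u v -> g u v <> 0) -> smooth_on U (fun u v => f u v / g u v).
Proof.
  intros HU Hf Hg Hn; apply (smooth_mult U f (fun u v => / g u v)); trivial.
  apply smooth_inv; trivial.
Qed.

(** ** Directional derivatives along a vector field [(x1, x2)] *)

Definition dir (x1 x2 : R -> R -> R) (h : R -> R -> R) (u v : R) : R :=
  x1 u v * d1 h u v + x2 u v * d2 h u v.

Section Dir.
Context (U : R -> R -> Prop) (HU : open2 U) (x1 x2 : R -> R -> R).

Lemma smooth_dir h : smooth_on U x1 -> smooth_on U x2 -> smooth_on U h ->
  smooth_on U (dir x1 x2 h).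
Proof.
  intros H1 H2 Hh; apply smooth_plus; trivial; apply smooth_mult; trivial;
    [apply smooth_d1 | apply smooth_d2]; trivial.
Qed.

Lemma d1_ext g h u v : (forall u v, U u v -> g u v = h u v) -> U u v ->
  d1 g u v = d1 h u v.
Proof.
  intros E Huv; apply Derive_ext_loc.
  generalize (open_near1 U u v HU Huv); apply filter_imp; auto.
Qed.

Lemma d2_ext g h u v : (forall u v, U u v -> g u v = h u v) -> U u v ->
  d2 g u v = d2 h u v.
Proof.
  intros E Huv; apply Derive_ext_loc.
  generalize (open_near2 U u v HU Huv); apply filter_imp; auto.
Qed.

Lemma dir_ext g h u v : (forall u v, U u v -> g u v = h u v) -> U u v ->
  dir x1 x2 g u v = dir x1 x2 h u v.
Proof.
  intros E Huv; unfold dir.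
  rewrite (d1_ext g h), (d2_ext g h); trivial.
Qed.

Lemma dir_const c u v : dir x1 x2 (fun _ _ => c) u v = 0.
Proof. unfold dir, d1, d2; rewrite 2!Derive_const; ring. Qed.

Lemma dir_differentiable h u v l1 l2 : differentiable_pt_lim h u v l1 l2 ->
  dir x1 x2 h u v = x1 u v * l1 + x2 u v * l2.
Proof.
  intros H; destruct (differentiable_d1_d2 _ _ _ _ _ H) as [E1 E2].
  unfold dir; rewrite E1, E2; reflexivity.
Qed.

Lemma dir_plus f g u v : smooth_on U f -> smooth_on U g -> U u v ->
  dir x1 x2 (fun u v => f u v + g u v) u v = dir x1 x2 f u v + dir x1 x2 g u v.
Proof.
  intros Hf Hg Huv.
  rewrite (dir_differentiable _ u v _ _ (differentiable_plus _ _ _ _ _ _ _ _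
    (smooth_differentiable U f u v HU Hf Huv) (smooth_differentiable U g u v HU Hg Huv))).
  unfold dir; ring.
Qed.

Lemma dir_mult f g u v : smooth_on U f -> smooth_on U g -> U u v ->
  dir x1 x2 (fun u v => f u v * g u v) u v
  = dir x1 x2 f u v * g u v + f u v * dir x1 x2 g u v.
Proof.
  intros Hf Hg Huv.
  rewrite (dir_differentiable _ u v _ _ (differentiable_mult _ _ _ _ _ _ _ _
    (smooth_differentiable U f u v HU Hf Huv) (smooth_differentiable U g u v HU Hg Huv))).
  unfold dir; ring.
Qed.

Lemma dir_opp f u v : smooth_on U f -> U u v ->
  dir x1 x2 (fun u v => - f u v) u v = - dir x1 x2 f u v.
Proof.
  intros Hf Huv.
  rewrite (dir_ext _ (fun u v => -1 * f u v)) by (intros; try ring; trivial).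
  rewrite dir_mult by (trivial; apply smooth_const, HU).
  rewrite dir_const; ring.
Qed.

Lemma dir_minus f g u v : smooth_on U f -> smooth_on U g -> U u v ->
  dir x1 x2 (fun u v => f u v - g u v) u v = dir x1 x2 f u v - dir x1 x2 g u v.
Proof.
  intros Hf Hg Huv.
  rewrite (dir_plus f (fun u v => - g u v)), dir_opp; trivial.
  apply smooth_opp; trivial.
Qed.

End Dir.

(** The bracket of two coordinate vector fields: second derivatives cancel by
    the symmetry of the Hessian. *)
Lemma dir_bracket U x1 x2 y1 y2 h u v : open2 U ->
  smooth_on U x1 -> smooth_on U x2 -> smooth_on U y1 -> smooth_on U y2 ->
  smooth_on U h -> U u v ->
  dir x1 x2 (dir y1 y2 h) u v - dir y1 y2 (dir x1 x2 h) u v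
  = (dir x1 x2 y1 u v - dir y1 y2 x1 u v) * d1 h u v
    + (dir x1 x2 y2 u v - dir y1 y2 x2 u v) * d2 h u v.
Proof.
  intros HU X1 X2 Y1 Y2 Hh Huv.
  assert (E : forall a1 a2 b1 b2, smooth_on U b1 -> smooth_on U b2 ->
    dir a1 a2 (dir b1 b2 h) u v
    = dir a1 a2 b1 u v * d1 h u v + b1 u v * dir a1 a2 (d1 h) u v
      + (dir a1 a2 b2 u v * d2 h u v + b2 u v * dir a1 a2 (d2 h) u v)).
  { intros a1 a2 b1 b2 B1 B2.
    unfold dir at 2.
    rewrite (dir_plus U HU _ _ (fun u v => b1 u v * d1 h u v) (fun u v => b2 u v * d2 h u v)); trivial.
    - rewrite 2!(dir_mult U HU); trivial; [apply smooth_d2 | apply smooth_d1]; trivial.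
    - apply smooth_mult; trivial; apply smooth_d1; trivial.
    - apply smooth_mult; trivial; apply smooth_d2; trivial. }
  rewrite 2!E; trivial.
  unfold dir; rewrite (smooth_schwarz U h u v HU Hh Huv); ring.
Qed.

(** * The ambient inner product *)

Definition axis_sum (F : axis -> R) : R := F ax1 + F ax2 + F ax3 + F ax4 + F ax5.

Definition axis_eqb (i j : axis) : bool :=
  match i, j with
  | ax1, ax1 | ax2, ax2 | ax3, ax3 | ax4, ax4 | ax5, ax5 => true
  | _, _ => false
  end.

Definition kronecker (i j : axis) : R := if axis_eqb i j then 1 else 0.

Section MatrixInverse.
Import boot.all_boot algebra.ssralg algebra.matrix reals_stdlib.Rstruct.

Let axis_of (i : 'I_5) : axis := nth ax1 [:: ax1; ax2; ax3; ax4; ax5] i.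

Let axis_sumE (F : axis -> R) : axis_sum F = (\sum_(i < 5) F (axis_of i))%R.
Proof.
rewrite !big_ord_recl big_ord0 /axis_sum -!RplusE /=; cbn; rewrite /axis_of /=.
by change (GRing.zero) with 0; ring.
Qed.

Lemma left_inverse_right_inverse (A B : axis -> axis -> R) :
  (forall i j, axis_sum (fun k => A i k * B k j) = kronecker i j) ->
  forall i j, axis_sum (fun k => B i k * A k j) = kronecker i j.
Proof.
move=> AB i j.
have axisK k : exists o : 'I_5, axis_of o = k.
  case: k; [exists (@Ordinal 5 0 isT) | exists (@Ordinal 5 1 isT)
    | exists (@Ordinal 5 2 isT) | exists (@Ordinal 5 3 isT)
    | exists (@Ordinal 5 4 isT)]; by [].
have kroneckerE (m n : 'I_5) : kronecker (axis_of m) (axis_of n) = ((m == n)%:R)%R.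
  by case: m n => [[|[|[|[|[|m]]]]] Hm] // [[|[|[|[|[|n]]]]] Hn].
pose toM (C : axis -> axis -> R) : 'M[R]_5 :=
  (\matrix_(m, n) C (axis_of m) (axis_of n))%R.
have AB1 : (toM A *m toM B = 1%:M)%R.
  apply/matrixP => m n; rewrite !mxE -kroneckerE -AB axis_sumE.
  by apply: eq_bigr => k _; rewrite !mxE.
have /matrixP BA1 := mulmx1C AB1.
have [m <-] := axisK i; have [n <-] := axisK j.
move: (BA1 m n); rewrite !mxE -kroneckerE => <-; rewrite axis_sumE.
by apply: eq_bigr => k _; rewrite !mxE.
Qed.
End MatrixInverse.

(** ** Bilinearity *)

Lemma ip_comm eps x y : ip eps x y = ip eps y x.
Proof. unfold ip; ring. Qed.

Lemma ip_addl eps x y z : ip eps (vadd x y) z = ip eps x z + ip eps y z.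
Proof. unfold ip, vadd; ring. Qed.

Lemma ip_addr eps x y z : ip eps z (vadd x y) = ip eps z x + ip eps z y.
Proof. unfold ip, vadd; ring. Qed.

Lemma ip_subl eps x y z : ip eps (vsub x y) z = ip eps x z - ip eps y z.
Proof. unfold ip, vsub; ring. Qed.

Lemma ip_subr eps x y z : ip eps z (vsub x y) = ip eps z x - ip eps z y.
Proof. unfold ip, vsub; ring. Qed.

Lemma ip_scall eps a x z : ip eps (vscal a x) z = a * ip eps x z.
Proof. unfold ip, vscal; ring. Qed.

Lemma ip_scalr eps a x z : ip eps z (vscal a x) = a * ip eps z x.
Proof. unfold ip, vscal; ring. Qed.

Lemma ip_0l eps z : ip eps vzero z = 0.
Proof. unfold ip, vzero; ring. Qed.

Ltac ip_expand := repeat rewrite ?ip_addl, ?ip_addr, ?ip_subl, ?ip_subr,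
  ?ip_scall, ?ip_scalr, ?ip_0l.

Lemma vec_ext (x y : vec) : (forall i, x i = y i) -> x = y.
Proof. intros H; apply functional_extensionality, H. Qed.

(** ** Orthogonal frames *)

(** Parseval's identity.  In matrix form orthogonality says that the frame has a
    one-sided inverse; the identity is the statement that this inverse is
    two-sided, so it holds whatever the signs of the squares [c]. *)
Lemma orthogonal_frame_parseval eps (e : axis -> vec) (c : axis -> R) x y :
  (forall a, c a <> 0) ->
  (forall a b, ip eps (e a) (e b) = c a * kronecker a b) ->
  ip eps x y = axis_sum (fun a => ip eps x (e a) * ip eps y (e a) / c a).
Proof.
  intros Hc He.
  set (s := fun j : axis => match j with ax5 => if Rlt_dec eps 0 then -1 else 1 | _ => 1 end).
  assert (Eip : forall x y, ip eps x y = axis_sum (fun j => s j * (x j * y j))).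
  { intros; unfold ip, axis_sum, s; ring. }
  assert (Inv : forall j k,
    axis_sum (fun a => s j * (e a j / c a) * e a k) = kronecker j k).
  { apply (left_inverse_right_inverse (fun a k => e a k) (fun j a => s j * (e a j / c a))).
    intros a b.
    transitivity (ip eps (e a) (e b) / c b).
    - rewrite Eip; unfold axis_sum; field; apply Hc.
    - rewrite He; destruct a, b; unfold kronecker; simpl; field; apply Hc. }
  transitivity (axis_sum (fun j => axis_sum (fun k =>
    x j * y k * s k * axis_sum (fun a => s j * (e a j / c a) * e a k)))).
  - transitivity (axis_sum (fun j => axis_sum (fun k => x j * y k * s k * kronecker j k))).
    + rewrite Eip; unfold axis_sum, kronecker; simpl; ring.
    + f_equal; apply functional_extensionality; intros j.
      f_equal; apply functional_extensionality; intros k.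
      rewrite Inv; reflexivity.
  - unfold axis_sum; rewrite !Eip; unfold axis_sum, Rdiv; ring.
Qed.

(** Completeness of an orthonormal frame of the space form at [p]: the position
    vector supplies the missing fifth direction when [eps <> 0], and the
    direction [ax5] does when [eps = 0]. *)
Lemma space_form_frame eps p (e1 e2 e3 e4 x y : vec) :
  space_form eps p ->
  tangent_space_form eps p e1 -> tangent_space_form eps p e2 ->
  tangent_space_form eps p e3 -> tangent_space_form eps p e4 ->
  ip eps e1 e1 = 1 -> ip eps e2 e2 = 1 -> ip eps e3 e3 = 1 -> ip eps e4 e4 = 1 ->
  ip eps e1 e2 = 0 -> ip eps e1 e3 = 0 -> ip eps e1 e4 = 0 ->
  ip eps e2 e3 = 0 -> ip eps e2 e4 = 0 -> ip eps e3 e4 = 0 ->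
  (eps = 0 -> x ax5 = 0) ->
  ip eps x y = ip eps x e1 * ip eps y e1 + ip eps x e2 * ip eps y e2
    + ip eps x e3 * ip eps y e3 + ip eps x e4 * ip eps y e4
    + eps * (ip eps x p * ip eps y p).
Proof.
  intros (P0 & P1 & _) (T1 & T1') (T2 & T2') (T3 & T3') (T4 & T4')
    H11 H22 H33 H44 H12 H13 H14 H23 H24 H34 Hx.
  pose proof (fun a b => ip_comm eps a b) as C.
  destruct (Req_dec eps 0) as [E0|E0].
  - set (e := fun a => match a with ax1 => e1 | ax2 => e2 | ax3 => e3 | ax4 => e4
      | ax5 => (fun i => match i with ax5 => 1 | _ => 0 end) : vec end).
    assert (N : forall w : vec, ip eps w (e ax5) = w ax5 /\ ip eps (e ax5) w = w ax5).
    { intros w; unfold ip; simpl; destruct (Rlt_dec eps 0); [lra | split; ring]. }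
    rewrite (orthogonal_frame_parseval eps e (fun _ => 1)).
    + unfold axis_sum; rewrite (proj1 (N x)), (Hx E0); simpl; rewrite E0; field.
    + intros _; lra.
    + intros a b; destruct a, b;
        rewrite ?(proj1 (N _)), ?(proj2 (N _)); unfold kronecker; simpl;
        rewrite ?T1, ?T2, ?T3, ?T4 by exact E0;
        first [lra | rewrite C; lra].
  - set (e := fun a => match a with ax1 => e1 | ax2 => e2 | ax3 => e3 | ax4 => e4
      | ax5 => p end).
    rewrite (orthogonal_frame_parseval eps e
      (fun a => match a with ax5 => / eps | _ => 1 end)).
    + unfold axis_sum; simpl; field; exact E0.
    + intros []; try lra; apply Rinv_neq_0_compat, E0.
    + specialize (P1 E0); specialize (T1' E0); specialize (T2' E0);
        specialize (T3' E0); specialize (T4' E0).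
      intros a b; destruct a, b; unfold kronecker; simpl;
        first [lra | rewrite C; lra].
Qed.

(** ** Positivity on the tangent spaces of the space form *)

Lemma sum4_sqr_zero a b c d : a * a + b * b + c * c + d * d <= 0 ->
  a = 0 /\ b = 0 /\ c = 0 /\ d = 0.
Proof. intros H; repeat split; nra. Qed.

Lemma cauchy_schwarz4 a b c d a' b' c' d' :
  (a * a' + b * b' + c * c' + d * d') * (a * a' + b * b' + c * c' + d * d')
  <= (a * a + b * b + c * c + d * d) * (a' * a' + b' * b' + c' * c' + d' * d').
Proof.
  assert (L : 0 <= (a*b'-b*a')*(a*b'-b*a') + (a*c'-c*a')*(a*c'-c*a')
    + (a*d'-d*a')*(a*d'-d*a') + (b*c'-c*b')*(b*c'-c*b')
    + (b*d'-d*b')*(b*d'-d*b') + (c*d'-d*c')*(c*d'-d*c')).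
  { repeat apply Rplus_le_le_0_compat; apply Rle_0_sqr. }
  nra.
Qed.

(** In the hyperbolic case this is the reversed Cauchy-Schwarz inequality: the
    orthogonal complement of a timelike vector is spacelike. *)
Lemma tangent_positive eps p w : space_form eps p -> tangent_space_form eps p w ->
  w <> vzero -> 0 < ip eps w w.
Proof.
  intros (P0 & P1 & _) (T0 & T1) Hw.
  assert (Hw' : ~ (w ax1 = 0 /\ w ax2 = 0 /\ w ax3 = 0 /\ w ax4 = 0 /\ w ax5 = 0)).
  { intros (A & B & C & D & E); apply Hw, vec_ext; intros []; assumption. }
  apply Rnot_le_lt; intros Hle; apply Hw'; clear Hw Hw'.
  destruct (Rlt_dec eps 0) as [Hn|Hn].
  - assert (E0 : eps <> 0) by lra.
    specialize (P1 E0); specialize (T1 E0).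
    pose proof (Rinv_lt_0_compat _ Hn) as Hi.
    unfold ip in *; destruct (Rlt_dec eps 0); [|lra].
    pose proof (cauchy_schwarz4 (p ax1) (p ax2) (p ax3) (p ax4)
      (w ax1) (w ax2) (w ax3) (w ax4)) as CS.
    set (P := p ax1 * p ax1 + p ax2 * p ax2 + p ax3 * p ax3 + p ax4 * p ax4) in *.
    set (W := w ax1 * w ax1 + w ax2 * w ax2 + w ax3 * w ax3 + w ax4 * w ax4) in *.
    replace (p ax1 * w ax1 + p ax2 * w ax2 + p ax3 * w ax3 + p ax4 * w ax4)
      with (p ax5 * w ax5) in CS by lra.
    assert (HW : 0 <= W) by (unfold W; nra).
    assert (HP : 0 <= P) by (unfold P; nra).
    assert (W0 : W <= 0).
    { apply Rnot_lt_le; intros HW0.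
      assert (P * W < (p ax5 * p ax5) * W) by (apply Rmult_lt_compat_r; lra).
      assert ((p ax5 * p ax5) * W <= (p ax5 * p ax5) * (w ax5 * w ax5))
        by (apply Rmult_le_compat_l; [nra|lra]).
      nra. }
    destruct (sum4_sqr_zero _ _ _ _ W0) as (A & B & C & D); repeat split; trivial.
    assert (p ax5 * w ax5 = 0) by (rewrite A, B, C, D in T1; lra).
    assert (p ax5 <> 0) by (intros E; rewrite E in P1; nra).
    nra.
  - unfold ip in Hle; destruct (Rlt_dec eps 0); [lra|].
    assert (0 <= w ax5 * w ax5) by nra.
    destruct (sum4_sqr_zero (w ax1) (w ax2) (w ax3) (w ax4)) as (A & B & C & D); [lra|].
    repeat split; trivial.
    rewrite A, B, C, D in Hle; nra.
Qed.

(** * Pointwise geometry of an immersed surface *)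

Section Pointwise.
Context (eps : R) (psi : R -> R -> vec) (u v : R).
Notation Pu := (D1 psi u v).
Notation Pv := (D2 psi u v).

Lemma comp1_add X Y : comp1 eps psi (vadd X Y) u v = comp1 eps psi X u v + comp1 eps psi Y u v.
Proof. unfold comp1, coef1, Rdiv; ip_expand; ring. Qed.

Lemma comp2_add X Y : comp2 eps psi (vadd X Y) u v = comp2 eps psi X u v + comp2 eps psi Y u v.
Proof. unfold comp2, coef2, Rdiv; ip_expand; ring. Qed.

Lemma comp1_scal a X : comp1 eps psi (vscal a X) u v = a * comp1 eps psi X u v.
Proof. unfold comp1, coef1, Rdiv; ip_expand; ring. Qed.

Lemma comp2_scal a X : comp2 eps psi (vscal a X) u v = a * comp2 eps psi X u v.
Proof. unfold comp2, coef2, Rdiv; ip_expand; ring. Qed.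

Lemma tangent_Pu : is_tangent psi Pu u v.
Proof. exists 1, 0; apply vec_ext; intros i; unfold vadd, vscal; ring. Qed.

Lemma tangent_Pv : is_tangent psi Pv u v.
Proof. exists 0, 1; apply vec_ext; intros i; unfold vadd, vscal; ring. Qed.

Lemma tangent_sharp w1 w2 : is_tangent psi (sharp eps psi w1 w2 u v) u v.
Proof. exists (coef1 eps psi w1 w2 u v), (coef2 eps psi w1 w2 u v); reflexivity. Qed.

(** Orthonormal tangent vectors make the Gram determinant of the coordinate
    fields invertible, because it is the inverse square of the determinant of
    the change of basis. *)
Lemma gdet_neq_0 e1 e2 : is_tangent psi e1 u v -> is_tangent psi e2 u v ->
  ip eps e1 e1 = 1 -> ip eps e2 e2 = 1 -> ip eps e1 e2 = 0 -> gdet eps psi u v <> 0.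
Proof.
  intros (a & b & ->) (c & d & ->) H1 H2 H3 Hg.
  assert (E : (a * d - b * c) * (a * d - b * c) * gdet eps psi u v
    = ip eps (vadd (vscal a Pu) (vscal b Pv)) (vadd (vscal a Pu) (vscal b Pv))
      * ip eps (vadd (vscal c Pu) (vscal d Pv)) (vadd (vscal c Pu) (vscal d Pv))
      - ip eps (vadd (vscal a Pu) (vscal b Pv)) (vadd (vscal c Pu) (vscal d Pv))
        * ip eps (vadd (vscal a Pu) (vscal b Pv)) (vadd (vscal c Pu) (vscal d Pv))).
  { unfold gdet, g11, g12, g22; ip_expand; rewrite (ip_comm eps Pv Pu); ring. }
  rewrite H1, H2, H3 in E.
  rewrite Hg in E; lra.
Qed.

Section Nondegenerate.
Context (Hg : gdet eps psi u v <> 0).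

Lemma comp1_tangent a b : comp1 eps psi (vadd (vscal a Pu) (vscal b Pv)) u v = a.
Proof.
  unfold comp1, coef1; ip_expand; rewrite (ip_comm eps Pv Pu).
  fold (g11 eps psi u v) (g12 eps psi u v) (g22 eps psi u v).
  apply (Rmult_eq_reg_r (gdet eps psi u v)); trivial.
  unfold Rdiv; rewrite Rmult_assoc, Rinv_l, Rmult_1_r; trivial; unfold gdet; ring.
Qed.

Lemma comp2_tangent a b : comp2 eps psi (vadd (vscal a Pu) (vscal b Pv)) u v = b.
Proof.
  unfold comp2, coef2; ip_expand; rewrite (ip_comm eps Pv Pu).
  fold (g11 eps psi u v) (g12 eps psi u v) (g22 eps psi u v).
  apply (Rmult_eq_reg_r (gdet eps psi u v)); trivial.
  unfold Rdiv; rewrite Rmult_assoc, Rinv_l, Rmult_1_r; trivial; unfold gdet; ring.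
Qed.

Lemma tangent_comp X : is_tangent psi X u v ->
  X = vadd (vscal (comp1 eps psi X u v) Pu) (vscal (comp2 eps psi X u v) Pv).
Proof. intros (a & b & ->); rewrite comp1_tangent, comp2_tangent; reflexivity. Qed.

Lemma comp_Pu : comp1 eps psi Pu u v = 1 /\ comp2 eps psi Pu u v = 0.
Proof.
  assert (E : Pu = vadd (vscal 1 Pu) (vscal 0 Pv)).
  { apply vec_ext; intros i; unfold vadd, vscal; ring. }
  rewrite E; rewrite comp1_tangent, comp2_tangent; split; reflexivity.
Qed.

Lemma comp_Pv : comp1 eps psi Pv u v = 0 /\ comp2 eps psi Pv u v = 1.
Proof.
  assert (E : Pv = vadd (vscal 0 Pu) (vscal 1 Pv)).
  { apply vec_ext; intros i; unfold vadd, vscal; ring. }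
  rewrite E; rewrite comp1_tangent, comp2_tangent; split; reflexivity.
Qed.

Lemma ip_sharp w1 w2 X : is_tangent psi X u v ->
  ip eps (sharp eps psi w1 w2 u v) X = comp1 eps psi X u v * w1 + comp2 eps psi X u v * w2.
Proof.
  intros HX; rewrite (tangent_comp X HX) at 1; unfold sharp, coef1, coef2; ip_expand.
  rewrite (ip_comm eps Pv Pu).
  fold (g11 eps psi u v) (g12 eps psi u v) (g22 eps psi u v).
  apply (Rmult_eq_reg_r (gdet eps psi u v)); trivial.
  transitivity ((g22 eps psi u v * w1 - g12 eps psi u v * w2) *
    (comp1 eps psi X u v * g11 eps psi u v + comp2 eps psi X u v * g12 eps psi u v)
    + (g11 eps psi u v * w2 - g12 eps psi u v * w1) *
    (comp1 eps psi X u v * g12 eps psi u v + comp2 eps psi X u v * g22 eps psi u v)).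
  - field; trivial.
  - unfold gdet; ring.
Qed.

Lemma ip_tan_part w X : is_tangent psi X u v ->
  ip eps (tan_part eps psi w u v) X = ip eps w X.
Proof.
  intros HX; unfold tan_part; rewrite ip_sharp by trivial.
  rewrite (tangent_comp X HX) at 3; ip_expand; reflexivity.
Qed.

Lemma ip_nor_part_tangent w X : is_tangent psi X u v ->
  ip eps (nor_part eps psi w u v) X = 0.
Proof. intros HX; unfold nor_part; ip_expand; rewrite ip_tan_part by trivial; ring. Qed.

Lemma ip_normal_tangent n X : is_normal eps psi n u v -> is_tangent psi X u v ->
  ip eps n X = 0.
Proof. intros (_ & H1 & H2) (a & b & ->); ip_expand; rewrite H1, H2; ring. Qed.

Lemma ip_nor_part_normal w n : is_normal eps psi n u v ->
  ip eps (nor_part eps psi w u v) n = ip eps w n.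
Proof.
  intros Hn; unfold nor_part; ip_expand.
  rewrite (ip_comm eps (tan_part _ _ _ _ _)), (ip_normal_tangent n); trivial; [ring|].
  apply tangent_sharp.
Qed.

Lemma ip_proj_orthogonal w n : tangent_space_form eps (psi u v) n ->
  ip eps (proj_space_form eps (psi u v) w) n = ip eps w n.
Proof.
  intros [_ Hn]; unfold proj_space_form; ip_expand.
  destruct (Req_dec eps 0) as [E|E]; [rewrite E at 2; ring | rewrite Hn by exact E; ring].
Qed.

Lemma normal_add X Y : is_normal eps psi X u v -> is_normal eps psi Y u v ->
  is_normal eps psi (vadd X Y) u v.
Proof.
  intros ((A & B) & C & D) ((A' & B') & C' & D').
  repeat split; ip_expand; rewrite ?C, ?C', ?D, ?D'; try ring.
  - intros E; unfold vadd; rewrite A, A' by exact E; ring.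
  - intros E; ip_expand; rewrite B, B' by exact E; ring.
Qed.

Lemma normal_scal a X : is_normal eps psi X u v -> is_normal eps psi (vscal a X) u v.
Proof.
  intros ((A & B) & C & D).
  repeat split; ip_expand; rewrite ?C, ?D; try ring.
  - intros E; unfold vscal; rewrite A by exact E; ring.
  - intros E; ip_expand; rewrite B by exact E; ring.
Qed.

(** ** Expressions in an orthonormal tangent basis *)

Section Orthonormal.
Context (e1 e2 : vec) (T1 : is_tangent psi e1 u v) (T2 : is_tangent psi e2 u v)
  (N1 : ip eps e1 e1 = 1) (N2 : ip eps e2 e2 = 1) (N12 : ip eps e1 e2 = 0).

Lemma tangent_orthonormal X : is_tangent psi X u v ->
  X = vadd (vscal (ip eps X e1) e1) (vscal (ip eps X e2) e2).
Proof.
  assert (S : forall a b c d, e1 = vadd (vscal a Pu) (vscal b Pv) ->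
    e2 = vadd (vscal c Pu) (vscal d Pv) -> a * d - b * c <> 0).
  { intros a b c d E1 E2 H.
    assert (Z : vsub (vscal c e1) (vscal a e2) = vscal (- (a * d - b * c)) Pv).
    { rewrite E1, E2; apply vec_ext; intros i; unfold vsub, vadd, vscal; ring. }
    assert (Z' : vsub (vscal d e1) (vscal b e2) = vscal (a * d - b * c) Pu).
    { rewrite E1, E2; apply vec_ext; intros i; unfold vsub, vadd, vscal; ring. }
    assert (Q : forall p q, p * p + q * q
      = ip eps (vsub (vscal p e1) (vscal q e2)) (vsub (vscal p e1) (vscal q e2))).
    { intros p q; ip_expand; rewrite (ip_comm eps e2 e1), N1, N2, N12; ring. }
    pose proof (Q c a) as Q1; pose proof (Q d b) as Q2.
    rewrite Z in Q1; rewrite Z' in Q2; rewrite H in Q1, Q2.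
    revert Q1 Q2; ip_expand; intros Q1 Q2.
    assert (A0 : a = 0) by nra.
    assert (B0 : b = 0) by nra.
    rewrite E1, A0, B0 in N1; revert N1; ip_expand; lra. }
  intros HX.
  assert (HX' : exists p q, X = vadd (vscal p e1) (vscal q e2)).
  { destruct T1 as (a & b & E1), T2 as (c & d & E2), HX as (x & y & EX).
    specialize (S a b c d E1 E2).
    exists ((x * d - y * c) / (a * d - b * c)), ((a * y - b * x) / (a * d - b * c)).
    rewrite EX, E1, E2; apply vec_ext; intros i; unfold vadd, vscal; field; exact S. }
  destruct HX' as (p & q & ->).
  ip_expand; rewrite (ip_comm eps e2 e1), N1, N2, N12.
  apply vec_ext; intros i; unfold vadd, vscal; ring.
Qed.

Lemma comp_duality :
  let a := ip eps Pu e1 in let b := ip eps Pu e2 in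
  let c := ip eps Pv e1 in let d := ip eps Pv e2 in
  let x1 := comp1 eps psi e1 u v in let x2 := comp2 eps psi e1 u v in
  let y1 := comp1 eps psi e2 u v in let y2 := comp2 eps psi e2 u v in
  a * x1 + b * y1 = 1 /\ a * x2 + b * y2 = 0 /\
  c * x1 + d * y1 = 0 /\ c * x2 + d * y2 = 1.
Proof.
  destruct comp_Pu as [U1 U2], comp_Pv as [V1 V2].
  pose proof (tangent_orthonormal Pu tangent_Pu) as EU.
  pose proof (tangent_orthonormal Pv tangent_Pv) as EV.
  rewrite EU in U1, U2; rewrite EV in V1, V2.
  rewrite comp1_add, 2!comp1_scal in U1, V1.
  rewrite comp2_add, 2!comp2_scal in U2, V2.
  repeat split; assumption.
Qed.

Lemma comp_det_neq_0 : comp1 eps psi e1 u v * comp2 eps psi e2 u v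
  - comp2 eps psi e1 u v * comp1 eps psi e2 u v <> 0.
Proof.
  destruct comp_duality as (H1 & H2 & H3 & H4); cbv zeta in *.
  intros E.
  set (a := ip eps Pu e1) in *; set (b := ip eps Pu e2) in *.
  set (c := ip eps Pv e1) in *; set (d := ip eps Pv e2) in *.
  set (x1 := comp1 eps psi e1 u v) in *; set (x2 := comp2 eps psi e1 u v) in *.
  set (y1 := comp1 eps psi e2 u v) in *; set (y2 := comp2 eps psi e2 u v) in *.
  assert (F : (a * d - b * c) * (x1 * y2 - x2 * y1) = 1).
  { transitivity ((a * x1 + b * y1) * (c * x2 + d * y2)
      - (a * x2 + b * y2) * (c * x1 + d * y1)); [ring|].
    rewrite H1, H2, H3, H4; ring. }
  rewrite E in F; lra.
Qed.

(** The inverse of the Gram matrix has the entries [x^i x^j + y^i y^j], with [x]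
    and [y] the coordinates of the basis vectors.  This turns the traces in the
    mean curvature and in the biconservative equation into sums of two terms. *)
Lemma ip_vtrace T z :
  (forall a b c d, ip eps (T (vadd (vscal a e1) (vscal b e2)) (vadd (vscal c e1) (vscal d e2))) z
    = a * c * ip eps (T e1 e1) z + a * d * ip eps (T e1 e2) z
      + b * c * ip eps (T e2 e1) z + b * d * ip eps (T e2 e2) z) ->
  ip eps (vtrace eps psi T u v) z = ip eps (T e1 e1) z + ip eps (T e2 e2) z.
Proof.
  intros HT.
  pose proof (tangent_orthonormal Pu tangent_Pu) as EU.
  pose proof (tangent_orthonormal Pv tangent_Pv) as EV.
  set (a := ip eps Pu e1) in *; set (b := ip eps Pu e2) in *.
  set (c := ip eps Pv e1) in *; set (d := ip eps Pv e2) in *.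
  assert (G11 : g11 eps psi u v = a * a + b * b).
  { unfold g11; rewrite EU; ip_expand; rewrite (ip_comm eps e2 e1), N1, N2, N12; ring. }
  assert (G12 : g12 eps psi u v = a * c + b * d).
  { unfold g12; rewrite EU, EV; ip_expand; rewrite (ip_comm eps e2 e1), N1, N2, N12; ring. }
  assert (G22 : g22 eps psi u v = c * c + d * d).
  { unfold g22; rewrite EV; ip_expand; rewrite (ip_comm eps e2 e1), N1, N2, N12; ring. }
  unfold vtrace; cbv zeta; ip_expand.
  rewrite EU, EV, !HT.
  apply (Rmult_eq_reg_l (gdet eps psi u v)); trivial.
  rewrite <- Rmult_assoc, Rinv_r by trivial.
  unfold gdet; rewrite G11, G12, G22; ring.
Qed.

End Orthonormal.
End Nondegenerate.
End Pointwise.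

(** * Fields along an immersion *)

Section Fields.
Context (U : R -> R -> Prop) (HU : open2 U) (eps : R).

Lemma vsmooth_add X Y : vsmooth_on U X -> vsmooth_on U Y ->
  vsmooth_on U (fun u v => vadd (X u v) (Y u v)).
Proof. intros HX HY i; apply smooth_plus; trivial. Qed.

Lemma vsmooth_sub X Y : vsmooth_on U X -> vsmooth_on U Y ->
  vsmooth_on U (fun u v => vsub (X u v) (Y u v)).
Proof. intros HX HY i; apply smooth_minus; trivial. Qed.

Lemma vsmooth_scal a X : smooth_on U a -> vsmooth_on U X ->
  vsmooth_on U (fun u v => vscal (a u v) (X u v)).
Proof. intros Ha HX i; apply smooth_mult; trivial. Qed.

Lemma vsmooth_D1 X : vsmooth_on U X -> vsmooth_on U (D1 X).
Proof. intros HX i; apply (smooth_d1 U (fun u v => X u v i)); trivial. Qed.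

Lemma vsmooth_D2 X : vsmooth_on U X -> vsmooth_on U (D2 X).
Proof. intros HX i; apply (smooth_d2 U (fun u v => X u v i)); trivial. Qed.

Lemma vsmooth_ext X Y : (forall u v, U u v -> X u v = Y u v) -> vsmooth_on U X ->
  vsmooth_on U Y.
Proof.
  intros E HX i; apply (smooth_ext U (fun u v => X u v i)); trivial.
  intros u v Huv; rewrite E; trivial.
Qed.

Lemma smooth_ip X Y : vsmooth_on U X -> vsmooth_on U Y ->
  smooth_on U (fun u v => ip eps (X u v) (Y u v)).
Proof.
  intros HX HY; unfold ip.
  repeat first [apply smooth_plus | apply smooth_mult | apply smooth_const
    | apply HX | apply HY]; trivial.
Qed.

(** The flat connection of the ambient vector space; the connection of the space
    form differs from it by a multiple of the position vector, to which all
    vectors tangent to the space form are orthogonal when that multiple is not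
    zero. *)
Definition vdir (x1 x2 : R -> R -> R) (V : R -> R -> vec) (u v : R) : vec :=
  vadd (vscal (x1 u v) (D1 V u v)) (vscal (x2 u v) (D2 V u v)).

Lemma vsmooth_vdir x1 x2 V : smooth_on U x1 -> smooth_on U x2 -> vsmooth_on U V ->
  vsmooth_on U (vdir x1 x2 V).
Proof.
  intros H1 H2 HV; apply vsmooth_add; apply vsmooth_scal; trivial;
    [apply vsmooth_D1 | apply vsmooth_D2]; trivial.
Qed.

Lemma dir_ip x1 x2 X Y u v : vsmooth_on U X -> vsmooth_on U Y -> U u v ->
  dir x1 x2 (fun u v => ip eps (X u v) (Y u v)) u v
  = ip eps (vdir x1 x2 X u v) (Y u v) + ip eps (X u v) (vdir x1 x2 Y u v).
Proof.
  intros HX HY Huv; unfold ip at 1.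
  assert (M : forall i j, smooth_on U (fun u v => X u v i * Y u v j)).
  { intros i j; apply smooth_mult; trivial. }
  assert (M4 : smooth_on U (fun u v => (if Rlt_dec eps 0 then -1 else 1)
      * (X u v ax5 * Y u v ax5))).
  { apply smooth_mult; trivial; apply smooth_const, HU. }
  assert (C : smooth_on U (fun _ _ => if Rlt_dec eps 0 then -1 else 1))
    by apply smooth_const, HU.
  assert (M1 := smooth_plus U _ _ HU (M ax1 ax1) (M ax2 ax2)); cbv beta in M1.
  assert (M2 := smooth_plus U _ _ HU M1 (M ax3 ax3)); cbv beta in M2.
  assert (M3 := smooth_plus U _ _ HU M2 (M ax4 ax4)); cbv beta in M3.
  rewrite (dir_plus U HU x1 x2 _ _ u v M3 M4), (dir_plus U HU x1 x2 _ _ u v M2),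
    (dir_plus U HU x1 x2 _ _ u v M1), (dir_plus U HU x1 x2 _ _ u v (M ax1 ax1)),
    (dir_mult U HU x1 x2 (fun _ _ => if Rlt_dec eps 0 then -1 else 1)), dir_const; trivial.
  rewrite 5!(dir_mult U HU) by trivial.
  unfold ip, vdir, vadd, vscal, D1, D2, dir; ring.
Qed.

Lemma dir_1_0 h u v : dir (fun _ _ => 1) (fun _ _ => 0) h u v = d1 h u v.
Proof. unfold dir; ring. Qed.

Lemma dir_0_1 h u v : dir (fun _ _ => 0) (fun _ _ => 1) h u v = d2 h u v.
Proof. unfold dir; ring. Qed.

Lemma vdir_1_0 V u v : vdir (fun _ _ => 1) (fun _ _ => 0) V u v = D1 V u v.
Proof. apply vec_ext; intros i; unfold vdir, vadd, vscal; ring. Qed.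

Lemma vdir_0_1 V u v : vdir (fun _ _ => 0) (fun _ _ => 1) V u v = D2 V u v.
Proof. apply vec_ext; intros i; unfold vdir, vadd, vscal; ring. Qed.

Lemma d1_ip X Y u v : vsmooth_on U X -> vsmooth_on U Y -> U u v ->
  d1 (fun u v => ip eps (X u v) (Y u v)) u v
  = ip eps (D1 X u v) (Y u v) + ip eps (X u v) (D1 Y u v).
Proof. intros HX HY Huv; rewrite <- dir_1_0, dir_ip, 2!vdir_1_0; trivial. Qed.

Lemma d2_ip X Y u v : vsmooth_on U X -> vsmooth_on U Y -> U u v ->
  d2 (fun u v => ip eps (X u v) (Y u v)) u v
  = ip eps (D2 X u v) (Y u v) + ip eps (X u v) (D2 Y u v).
Proof. intros HX HY Huv; rewrite <- dir_0_1, dir_ip, 2!vdir_0_1; trivial. Qed.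

Lemma dir_const_on x1 x2 g c u v : (forall u v, U u v -> g u v = c) -> U u v ->
  dir x1 x2 g u v = 0.
Proof.
  intros E Huv; rewrite (dir_ext U HU x1 x2 g (fun _ _ => c)); trivial; apply dir_const.
Qed.

Lemma vdir_ext x1 x2 X Y u v : (forall u v, U u v -> X u v = Y u v) -> U u v ->
  vdir x1 x2 X u v = vdir x1 x2 Y u v.
Proof.
  intros E Huv; apply vec_ext; intros i.
  apply (dir_ext U HU x1 x2 (fun u v => X u v i) (fun u v => Y u v i)); trivial.
  intros a b Hab; rewrite E; trivial.
Qed.

Lemma D_schwarz X u v : vsmooth_on U X -> U u v -> D1 (D2 X) u v = D2 (D1 X) u v.
Proof.
  intros HX Huv; apply vec_ext; intros i.
  apply (smooth_schwarz U (fun u v => X u v i)); trivial.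
Qed.

Section Immersion.
Context (psi : R -> R -> vec) (Hpsi : vsmooth_on U psi)
  (Hg : forall u v, U u v -> gdet eps psi u v <> 0).

Lemma smooth_coef w1 w2 : smooth_on U w1 -> smooth_on U w2 ->
  smooth_on U (fun u v => coef1 eps psi (w1 u v) (w2 u v) u v) /\
  smooth_on U (fun u v => coef2 eps psi (w1 u v) (w2 u v) u v).
Proof.
  intros H1 H2.
  assert (P1 := vsmooth_D1 psi Hpsi); assert (P2 := vsmooth_D2 psi Hpsi).
  assert (G11 := smooth_ip _ _ P1 P1); assert (G12 := smooth_ip _ _ P1 P2).
  assert (G22 := smooth_ip _ _ P2 P2).
  assert (GD : smooth_on U (gdet eps psi)).
  { apply smooth_minus; trivial; apply smooth_mult; trivial. }
  split; apply smooth_div; trivial; apply smooth_minus; trivial; apply smooth_mult; trivial.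
Qed.

Lemma smooth_comp12 X : vsmooth_on U X ->
  smooth_on U (fun u v => comp1 eps psi (X u v) u v) /\
  smooth_on U (fun u v => comp2 eps psi (X u v) u v).
Proof.
  intros HX; apply smooth_coef; apply smooth_ip; trivial;
    [apply vsmooth_D1 | apply vsmooth_D2]; trivial.
Qed.

Lemma vsmooth_tan_part w : vsmooth_on U w ->
  vsmooth_on U (fun u v => tan_part eps psi (w u v) u v).
Proof.
  intros Hw; destruct (smooth_comp12 w Hw) as [C1 C2].
  apply vsmooth_add; apply vsmooth_scal; trivial; [apply vsmooth_D1 | apply vsmooth_D2]; trivial.
Qed.

Lemma vsmooth_nabla_bar X V : vsmooth_on U X -> vsmooth_on U V ->
  vsmooth_on U (fun u v => nabla_bar eps psi (X u v) V u v).
Proof.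
  intros HX HV; destruct (smooth_comp12 X HX) as [C1 C2].
  assert (W := vsmooth_vdir _ _ V C1 C2 HV).
  apply vsmooth_sub; [exact W|].
  apply vsmooth_scal; trivial; apply smooth_mult; trivial.
  - apply smooth_const, HU.
  - exact (smooth_ip _ _ Hpsi W).
Qed.

Lemma vsmooth_nabla_perp X V : vsmooth_on U X -> vsmooth_on U V ->
  vsmooth_on U (fun u v => nabla_perp eps psi (X u v) V u v).
Proof.
  intros HX HV; assert (W := vsmooth_nabla_bar X V HX HV).
  apply vsmooth_sub; trivial; apply (vsmooth_tan_part _ W).
Qed.

Lemma vsmooth_nabla X V : vsmooth_on U X -> vsmooth_on U V ->
  vsmooth_on U (fun u v => nabla eps psi (X u v) V u v).
Proof.
  intros HX HV; apply (vsmooth_tan_part _ (vsmooth_nabla_bar X V HX HV)).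
Qed.

Lemma vsmooth_sff X Y : vsmooth_on U X -> vsmooth_on U Y ->
  vsmooth_on U (fun u v => sff eps psi (X u v) (Y u v) u v).
Proof.
  intros HX HY; destruct (smooth_comp12 Y HY) as [C1 C2].
  apply vsmooth_add; apply vsmooth_scal; trivial; apply vsmooth_nabla_perp; trivial;
    [apply vsmooth_D1 | apply vsmooth_D2]; trivial.
Qed.

Lemma vsmooth_mean_curvature_vector : vsmooth_on U (mean_curvature_vector eps psi).
Proof.
  assert (P1 := vsmooth_D1 psi Hpsi); assert (P2 := vsmooth_D2 psi Hpsi).
  assert (G11 := smooth_ip _ _ P1 P1); assert (G12 := smooth_ip _ _ P1 P2).
  assert (G22 := smooth_ip _ _ P2 P2).
  assert (GD : smooth_on U (gdet eps psi)).
  { apply smooth_minus; trivial; apply smooth_mult; trivial. }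
  assert (B11 := vsmooth_sff _ _ P1 P1); assert (B12 := vsmooth_sff _ _ P1 P2).
  assert (B21 := vsmooth_sff _ _ P2 P1); assert (B22 := vsmooth_sff _ _ P2 P2).
  assert (GI := smooth_inv U _ HU GD Hg); assert (C := smooth_const U (/ 2) HU).
  unfold mean_curvature_vector, vtrace; cbv zeta.
  repeat first [assumption | apply vsmooth_scal | apply vsmooth_sub | apply vsmooth_add].
Qed.

(** ** Normal parts *)

Lemma ip_nabla_perp X V n u v : U u v -> is_normal eps psi n u v ->
  ip eps (nabla_perp eps psi X V u v) n
  = comp1 eps psi X u v * ip eps (D1 V u v) n + comp2 eps psi X u v * ip eps (D2 V u v) n.
Proof.
  intros Huv Hn; unfold nabla_perp, nabla_bar.
  rewrite ip_nor_part_normal, ip_proj_orthogonal; auto; [|apply Hn].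
  ip_expand; reflexivity.
Qed.

Lemma ip_sff X Y n u v : U u v -> is_normal eps psi n u v ->
  ip eps (sff eps psi X Y u v) n
  = comp1 eps psi Y u v * (comp1 eps psi X u v * ip eps (D1 (D1 psi) u v) n
      + comp2 eps psi X u v * ip eps (D2 (D1 psi) u v) n)
  + comp2 eps psi Y u v * (comp1 eps psi X u v * ip eps (D1 (D2 psi) u v) n
      + comp2 eps psi X u v * ip eps (D2 (D2 psi) u v) n).
Proof.
  intros Huv Hn; unfold sff; ip_expand; rewrite 2!ip_nabla_perp; trivial.
Qed.

(** Only the derivatives of the coordinate fields contribute to the normal part
    of the derivative of a tangent field. *)
Lemma ip_sff_field X Y n u v : U u v -> is_normal eps psi n u v -> vsmooth_on U Y ->
  (forall u v, U u v -> is_tangent psi (Y u v) u v) ->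
  ip eps (sff eps psi X (Y u v) u v) n
  = comp1 eps psi X u v * ip eps (D1 Y u v) n + comp2 eps psi X u v * ip eps (D2 Y u v) n.
Proof.
  intros Huv Hn HY HT.
  destruct (smooth_comp12 Y HY) as [C1 C2].
  set (c1 := fun u v => comp1 eps psi (Y u v) u v) in *.
  set (c2 := fun u v => comp2 eps psi (Y u v) u v) in *.
  assert (P1 := vsmooth_D1 psi Hpsi); assert (P2 := vsmooth_D2 psi Hpsi).
  assert (EY : forall u v, U u v -> Y u v
    = vadd (vscal (c1 u v) (D1 psi u v)) (vscal (c2 u v) (D2 psi u v))).
  { intros a b Hab; apply (tangent_comp eps psi a b); auto. }
  assert (L : forall x1 x2, vdir x1 x2 Y u v =
    vadd (vadd (vscal (dir x1 x2 c1 u v) (D1 psi u v)) (vscal (c1 u v) (vdir x1 x2 (D1 psi) u v)))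
      (vadd (vscal (dir x1 x2 c2 u v) (D2 psi u v)) (vscal (c2 u v) (vdir x1 x2 (D2 psi) u v)))).
  { intros x1 x2; rewrite (vdir_ext x1 x2 _ _ u v EY Huv).
    apply vec_ext; intros i.
    transitivity (dir x1 x2 (fun u v => c1 u v * D1 psi u v i + c2 u v * D2 psi u v i) u v);
      [reflexivity|].
    rewrite (dir_plus U HU x1 x2 (fun u v => c1 u v * D1 psi u v i)
      (fun u v => c2 u v * D2 psi u v i)) by (trivial; apply smooth_mult; trivial).
    rewrite 2!(dir_mult U HU) by trivial; reflexivity. }
  assert (N : forall x1 x2, ip eps (vdir x1 x2 Y u v) n
    = c1 u v * ip eps (vdir x1 x2 (D1 psi) u v) n + c2 u v * ip eps (vdir x1 x2 (D2 psi) u v) n).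
  { intros x1 x2; rewrite L; ip_expand.
    rewrite (ip_comm eps (D1 psi u v)), (ip_comm eps (D2 psi u v)).
    destruct Hn as (_ & -> & ->); ring. }
  rewrite ip_sff by trivial.
  rewrite <- (vdir_1_0 Y), <- (vdir_0_1 Y), 2!N, 2!vdir_1_0, 2!vdir_0_1.
  unfold c1, c2; ring.
Qed.

Lemma ip_shape n X Z u v : U u v -> is_tangent psi Z u v ->
  ip eps (shape eps psi n X u v) Z = ip eps (sff eps psi X Z u v) n.
Proof.
  intros Huv HZ; unfold shape; rewrite ip_sharp by auto.
  destruct (comp_Pu eps psi u v (Hg u v Huv)) as [U1 U2].
  destruct (comp_Pv eps psi u v (Hg u v Huv)) as [V1 V2].
  unfold sff; ip_expand; rewrite U1, U2, V1, V2; ring.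
Qed.

Context (Hsf : forall u v, U u v -> space_form eps (psi u v)).

Lemma derivative_ax5 V : (forall u v, U u v -> V u v ax5 = 0) ->
  forall u v, U u v -> D1 V u v ax5 = 0 /\ D2 V u v ax5 = 0.
Proof.
  intros HV u v Huv; unfold D1, D2; split.
  - rewrite <- (dir_1_0 (fun u v => V u v ax5)); exact (dir_const_on _ _ _ 0 u v HV Huv).
  - rewrite <- (dir_0_1 (fun u v => V u v ax5)); exact (dir_const_on _ _ _ 0 u v HV Huv).
Qed.

Lemma tangent_is_tangent_space_form X u v : U u v -> is_tangent psi X u v ->
  tangent_space_form eps (psi u v) X.
Proof.
  intros Huv (a & b & ->); split; intros E.
  - assert (Z : forall u v, U u v -> psi u v ax5 = 0) by (intros p q H; apply (Hsf p q H), E).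
    destruct (derivative_ax5 psi Z u v Huv) as [Z1 Z2].
    unfold vadd, vscal; rewrite Z1, Z2; ring.
  - assert (Z : forall u v, U u v -> ip eps (psi u v) (psi u v) = / eps)
      by (intros p q H; apply (Hsf p q H), E).
    assert (Z1 := d1_ip psi psi u v Hpsi Hpsi Huv).
    assert (Z2 := d2_ip psi psi u v Hpsi Hpsi Huv).
    rewrite <- dir_1_0, (dir_const_on _ _ _ (/ eps) u v Z Huv) in Z1.
    rewrite <- dir_0_1, (dir_const_on _ _ _ (/ eps) u v Z Huv) in Z2.
    rewrite (ip_comm eps (D1 psi u v)) in Z1; rewrite (ip_comm eps (D2 psi u v)) in Z2.
    ip_expand; nra.
Qed.

Lemma nor_part_is_normal w u v : U u v -> tangent_space_form eps (psi u v) w ->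
  is_normal eps psi (nor_part eps psi w u v) u v.
Proof.
  intros Huv [W0 W1].
  assert (T := tangent_is_tangent_space_form (tan_part eps psi w u v) u v Huv
    (tangent_sharp _ _ _ _ _ _)).
  destruct T as [T0 T1].
  repeat split.
  - intros E; unfold nor_part, vsub; rewrite (W0 E), (T0 E); ring.
  - intros E; unfold nor_part; ip_expand; rewrite (W1 E), (T1 E); ring.
  - apply ip_nor_part_tangent; auto; apply tangent_Pu.
  - apply ip_nor_part_tangent; auto; apply tangent_Pv.
Qed.

Lemma nabla_perp_is_normal X V u v : U u v ->
  (eps = 0 -> forall u v, U u v -> V u v ax5 = 0) ->
  is_normal eps psi (nabla_perp eps psi X V u v) u v.
Proof.
  intros Huv HV; apply nor_part_is_normal; trivial; unfold nabla_bar, proj_space_form.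
  set (w := vadd _ _); destruct (Hsf u v Huv) as (P0 & P1 & _); split; intros E.
  - destruct (derivative_ax5 V (HV E) u v Huv) as [Z1 Z2].
    unfold w, vsub, vadd, vscal; rewrite Z1, Z2, (P0 E); ring.
  - ip_expand; rewrite (P1 E); field; exact E.
Qed.

Lemma sff_is_normal X Y u v : U u v -> is_normal eps psi (sff eps psi X Y u v) u v.
Proof.
  intros Huv.
  assert (Z : eps = 0 -> forall u v, U u v -> D1 psi u v ax5 = 0 /\ D2 psi u v ax5 = 0).
  { intros E; apply derivative_ax5; intros p q H; apply (Hsf p q H), E. }
  apply normal_add; apply normal_scal; apply nabla_perp_is_normal; trivial;
    intros E p q H; apply (Z E p q H).
Qed.

Lemma mean_curvature_vector_is_normal u v : U u v ->
  is_normal eps psi (mean_curvature_vector eps psi u v) u v.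
Proof.
  intros Huv; unfold mean_curvature_vector, vtrace; cbv zeta.
  apply normal_scal, normal_scal, normal_add; [|apply normal_scal, sff_is_normal, Huv].
  match goal with |- is_normal _ _ (vsub ?x (vscal ?a ?y)) _ _ =>
    replace (vsub x (vscal a y)) with (vadd x (vscal (- a) y)) end.
  - apply normal_add; apply normal_scal; [|apply normal_add]; apply sff_is_normal, Huv.
  - apply vec_ext; intros i; unfold vadd, vsub, vscal; ring.
Qed.

End Immersion.
End Fields.

(** * Structure equations of a Darboux frame *)

Lemma zero_mult_eq r a b : r = 0 -> r * a = r * b.
Proof. intros ->; ring. Qed.

Set Implicit Arguments.
Record darboux_frame (eps : R) (psi : R -> R -> vec) (U : R -> R -> Prop)
    (e1 e2 e3 e4 : R -> R -> vec) : Prop := {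
  df_open : open2 U;
  df_psi : vsmooth_on U psi;
  df_space : forall u v, U u v -> space_form eps (psi u v);
  df_s1 : vsmooth_on U e1;
  df_s2 : vsmooth_on U e2;
  df_s3 : vsmooth_on U e3;
  df_s4 : vsmooth_on U e4;
  df_t1 : forall u v, U u v -> is_tangent psi (e1 u v) u v;
  df_t2 : forall u v, U u v -> is_tangent psi (e2 u v) u v;
  df_n3 : forall u v, U u v -> is_normal eps psi (e3 u v) u v;
  df_n4 : forall u v, U u v -> is_normal eps psi (e4 u v) u v;
  df_11 : forall u v, U u v -> ip eps (e1 u v) (e1 u v) = 1;
  df_22 : forall u v, U u v -> ip eps (e2 u v) (e2 u v) = 1;
  df_33 : forall u v, U u v -> ip eps (e3 u v) (e3 u v) = 1;
  df_44 : forall u v, U u v -> ip eps (e4 u v) (e4 u v) = 1;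
  df_12 : forall u v, U u v -> ip eps (e1 u v) (e2 u v) = 0;
  df_34 : forall u v, U u v -> ip eps (e3 u v) (e4 u v) = 0
}.
Unset Implicit Arguments.

Section Darboux.
Context (eps : R) (psi : R -> R -> vec) (U : R -> R -> Prop)
  (e1 e2 e3 e4 : R -> R -> vec) (F : darboux_frame eps psi U e1 e2 e3 e4).

Let HU := df_open F.
Let Hpsi := df_psi F.
Let Hsf := df_space F.
Let S1 := df_s1 F.
Let S2 := df_s2 F.
Let S3 := df_s3 F.
Let S4 := df_s4 F.
Let T1 := df_t1 F.
Let T2 := df_t2 F.
Let N3 := df_n3 F.
Let N4 := df_n4 F.
Let I11 := df_11 F.
Let I22 := df_22 F.
Let I33 := df_33 F.
Let I44 := df_44 F.
Let I12 := df_12 F.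
Let I34 := df_34 F.

Let Hg u v (Huv : U u v) : gdet eps psi u v <> 0 :=
  gdet_neq_0 eps psi u v _ _ (T1 u v Huv) (T2 u v Huv) (I11 u v Huv) (I22 u v Huv)
    (I12 u v Huv).

Let x1 u v := comp1 eps psi (e1 u v) u v.
Let x2 u v := comp2 eps psi (e1 u v) u v.
Let y1 u v := comp1 eps psi (e2 u v) u v.
Let y2 u v := comp2 eps psi (e2 u v) u v.

Notation E1 := (dir x1 x2).
Notation E2 := (dir y1 y2).
Notation V1 := (vdir x1 x2).
Notation V2 := (vdir y1 y2).

Lemma frame_comp_smooth : smooth_on U x1 /\ smooth_on U x2 /\ smooth_on U y1 /\ smooth_on U y2.
Proof.
  destruct (smooth_comp12 U HU eps psi Hpsi Hg e1 S1) as [A B].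
  destruct (smooth_comp12 U HU eps psi Hpsi Hg e2 S2) as [C D].
  repeat split; assumption.
Qed.

Let X1 : smooth_on U x1 := proj1 frame_comp_smooth.
Let X2 : smooth_on U x2 := proj1 (proj2 frame_comp_smooth).
Let Y1 : smooth_on U y1 := proj1 (proj2 (proj2 frame_comp_smooth)).
Let Y2 : smooth_on U y2 := proj2 (proj2 (proj2 frame_comp_smooth)).

Lemma V1_psi u v : U u v -> V1 psi u v = e1 u v.
Proof. intros Huv; symmetry; apply (tangent_comp eps psi u v (Hg u v Huv)), T1, Huv. Qed.

Lemma V2_psi u v : U u v -> V2 psi u v = e2 u v.
Proof. intros Huv; symmetry; apply (tangent_comp eps psi u v (Hg u v Huv)), T2, Huv. Qed.

Lemma ip_e1_e3 u v : U u v -> ip eps (e1 u v) (e3 u v) = 0.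
Proof.
  intros Huv; rewrite ip_comm; apply (ip_normal_tangent eps psi u v); auto.
Qed.

Lemma ip_e1_e4 u v : U u v -> ip eps (e1 u v) (e4 u v) = 0.
Proof.
  intros Huv; rewrite ip_comm; apply (ip_normal_tangent eps psi u v); auto.
Qed.

Lemma ip_e2_e3 u v : U u v -> ip eps (e2 u v) (e3 u v) = 0.
Proof.
  intros Huv; rewrite ip_comm; apply (ip_normal_tangent eps psi u v); auto.
Qed.

Lemma ip_e2_e4 u v : U u v -> ip eps (e2 u v) (e4 u v) = 0.
Proof.
  intros Huv; rewrite ip_comm; apply (ip_normal_tangent eps psi u v); auto.
Qed.

Lemma frame_expansion x y u v : U u v -> (eps = 0 -> x ax5 = 0) ->
  ip eps x y = ip eps x (e1 u v) * ip eps y (e1 u v) + ip eps x (e2 u v) * ip eps y (e2 u v)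
    + ip eps x (e3 u v) * ip eps y (e3 u v) + ip eps x (e4 u v) * ip eps y (e4 u v)
    + eps * (ip eps x (psi u v) * ip eps y (psi u v)).
Proof.
  intros Huv Hx; apply space_form_frame; auto using ip_e1_e3, ip_e1_e4, ip_e2_e3, ip_e2_e4.
  - apply (tangent_is_tangent_space_form U HU eps psi Hpsi Hsf); auto.
  - apply (tangent_is_tangent_space_form U HU eps psi Hpsi Hsf); auto.
  - apply N3, Huv.
  - apply N4, Huv.
Qed.

Lemma normal_expansion x y u v : U u v -> is_normal eps psi x u v -> is_normal eps psi y u v ->
  ip eps x y = ip eps x (e3 u v) * ip eps y (e3 u v) + ip eps x (e4 u v) * ip eps y (e4 u v).
Proof.
  intros Huv Hx Hy; rewrite (frame_expansion x y u v Huv (proj1 (proj1 Hx))).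
  rewrite (ip_normal_tangent eps psi u v x (e1 u v)), (ip_normal_tangent eps psi u v x (e2 u v));
    auto.
  assert (Z : eps * ip eps x (psi u v) = 0).
  { destruct (Req_dec eps 0) as [E|E]; [rewrite E at 1; ring|].
    rewrite ip_comm, (proj2 (proj1 Hx) E); ring. }
  rewrite <- Rmult_assoc, Z; ring.
Qed.

(** Compatibility of the connection with the metric: in a frame, the connection
    forms are skew. *)
Lemma connection_skew z1 z2 X Y c u v : vsmooth_on U X -> vsmooth_on U Y ->
  (forall u v, U u v -> ip eps (X u v) (Y u v) = c) -> U u v ->
  ip eps (vdir z1 z2 Y u v) (X u v) = - ip eps (vdir z1 z2 X u v) (Y u v).
Proof.
  intros HX HY E Huv; pose proof (dir_ip U HU eps z1 z2 X Y u v HX HY Huv) as D.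
  rewrite (dir_const_on U HU z1 z2 _ c u v E Huv) in D.
  rewrite (ip_comm eps (vdir z1 z2 Y u v)); lra.
Qed.

Lemma connection_unit z1 z2 X u v : vsmooth_on U X ->
  (forall u v, U u v -> ip eps (X u v) (X u v) = 1) -> U u v ->
  ip eps (vdir z1 z2 X u v) (X u v) = 0.
Proof.
  intros HX E Huv; pose proof (connection_skew z1 z2 X X 1 u v HX HX E Huv); lra.
Qed.

Lemma connection_position z1 z2 X u v : vsmooth_on U X ->
  (forall u v, U u v -> tangent_space_form eps (psi u v) (X u v)) -> U u v ->
  eps * ip eps (vdir z1 z2 X u v) (psi u v) = - (eps * ip eps (X u v) (vdir z1 z2 psi u v)).
Proof.
  intros HX HT Huv; destruct (Req_dec eps 0) as [E|E].
  - rewrite E at 1 3; ring.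
  - assert (C : forall u v, U u v -> ip eps (psi u v) (X u v) = 0)
      by (intros a b Hab; apply (HT a b Hab), E).
    rewrite (connection_skew z1 z2 psi X 0 u v Hpsi HX C Huv).
    rewrite (ip_comm eps (X u v)); ring.
Qed.

Lemma frame_tangent_space_form X :
  X = e1 \/ X = e2 \/ X = e3 \/ X = e4 ->
  vsmooth_on U X /\ (forall u v, U u v -> tangent_space_form eps (psi u v) (X u v)) /\
  (forall z1 z2 u v, U u v -> eps = 0 -> vdir z1 z2 X u v ax5 = 0).
Proof.
  intros HX.
  assert (SX : vsmooth_on U X) by (intuition subst; trivial).
  assert (TX : forall u v, U u v -> tangent_space_form eps (psi u v) (X u v)).
  { intros u v Huv; destruct HX as [-> | [-> | [-> | ->]]].
    - apply (tangent_is_tangent_space_form U HU eps psi Hpsi Hsf); auto.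
    - apply (tangent_is_tangent_space_form U HU eps psi Hpsi Hsf); auto.
    - apply N3, Huv.
    - apply N4, Huv. }
  repeat split; trivial; try (intros; apply TX; assumption).
  intros z1 z2 u v Huv E.
  destruct (derivative_ax5 U HU X (fun a b Hab => proj1 (TX a b Hab) E) u v Huv) as [A B].
  unfold vdir, vadd, vscal; rewrite A, B; ring.
Qed.

(** Torsion-freeness: the difference of the derivatives of the frame fields is
    the bracket, which is tangent. *)
Lemma frame_bracket u v : U u v ->
  vsub (V1 e2 u v) (V2 e1 u v)
  = vadd (vscal (E1 y1 u v - E2 x1 u v) (D1 psi u v))
      (vscal (E1 y2 u v - E2 x2 u v) (D2 psi u v)).
Proof.
  intros Huv; apply vec_ext; intros i.
  transitivity (V1 (V2 psi) u v i - V2 (V1 psi) u v i).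
  - unfold vsub; rewrite (vdir_ext U HU x1 x2 (V2 psi) e2), (vdir_ext U HU y1 y2 (V1 psi) e1);
      trivial; [apply V1_psi | apply V2_psi].
  - exact (dir_bracket U x1 x2 y1 y2 (fun u v => psi u v i) u v HU X1 X2 Y1 Y2 (Hpsi i) Huv).
Qed.

Lemma bracket_normal u v n : U u v -> is_normal eps psi n u v ->
  ip eps (V2 e1 u v) n = ip eps (V1 e2 u v) n.
Proof.
  intros Huv Hn.
  assert (E : ip eps (vsub (V1 e2 u v) (V2 e1 u v)) n = 0).
  { rewrite ip_comm; apply (ip_normal_tangent eps psi u v); trivial.
    rewrite frame_bracket by trivial; eexists; eexists; reflexivity. }
  revert E; ip_expand; lra.
Qed.

Lemma ip_sff_frame n u v : U u v -> is_normal eps psi n u v ->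
  ip eps (sff eps psi (e1 u v) (e1 u v) u v) n = ip eps (V1 e1 u v) n /\
  ip eps (sff eps psi (e1 u v) (e2 u v) u v) n = ip eps (V1 e2 u v) n /\
  ip eps (sff eps psi (e2 u v) (e1 u v) u v) n = ip eps (V2 e1 u v) n /\
  ip eps (sff eps psi (e2 u v) (e2 u v) u v) n = ip eps (V2 e2 u v) n.
Proof.
  intros Huv Hn.
  rewrite 2!(ip_sff_field U HU eps psi Hpsi Hg _ e1), 2!(ip_sff_field U HU eps psi Hpsi Hg _ e2)
    by trivial.
  unfold vdir; ip_expand; repeat split; reflexivity.
Qed.

Lemma ip_mean_curvature_vector n u v : U u v -> is_normal eps psi n u v ->
  ip eps (mean_curvature_vector eps psi u v) n
  = / 2 * (ip eps (V1 e1 u v) n + ip eps (V2 e2 u v) n).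
Proof.
  intros Huv Hn; unfold mean_curvature_vector; rewrite ip_scall.
  rewrite (ip_vtrace eps psi u v (Hg u v Huv) (e1 u v) (e2 u v) (T1 u v Huv) (T2 u v Huv)
    (I11 u v Huv) (I22 u v Huv) (I12 u v Huv)).
  - destruct (ip_sff_frame n u v Huv Hn) as (A & _ & _ & B); rewrite A, B; reflexivity.
  - intros a b c d; rewrite !(ip_sff U eps psi) by trivial.
    rewrite !comp1_add, !comp2_add, !comp1_scal, !comp2_scal; ring.
Qed.

(** The first shape operator is diagonal by the choice of [e1] and [e2]; the
    second is trace-free, but its off-diagonal entry [g] vanishes only when the
    normal bundle is flat. *)
Context (k1 k2 al a1 a2 b1 b2 g : R -> R -> R)
  (Ha1 : forall u v, U u v -> ip eps (V1 e1 u v) (e2 u v) = - a1 u v)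
  (Ha2 : forall u v, U u v -> ip eps (V2 e2 u v) (e1 u v) = a2 u v)
  (Hk1 : forall u v, U u v -> ip eps (V1 e1 u v) (e3 u v) = k1 u v)
  (Hk12 : forall u v, U u v -> ip eps (V1 e2 u v) (e3 u v) = 0)
  (Hk2 : forall u v, U u v -> ip eps (V2 e2 u v) (e3 u v) = k2 u v)
  (Hal1 : forall u v, U u v -> ip eps (V1 e1 u v) (e4 u v) = al u v)
  (Hal2 : forall u v, U u v -> ip eps (V2 e2 u v) (e4 u v) = - al u v)
  (Hal12 : forall u v, U u v -> ip eps (V1 e2 u v) (e4 u v) = g u v)
  (Hb1 : forall u v, U u v -> ip eps (V1 e3 u v) (e4 u v) = b1 u v)
  (Hb2 : forall u v, U u v -> ip eps (V2 e3 u v) (e4 u v) = b2 u v).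

Lemma connection_table u v : U u v ->
  (ip eps (V1 e1 u v) (e1 u v) = 0 /\ ip eps (V2 e1 u v) (e1 u v) = 0 /\
   ip eps (V2 e1 u v) (e2 u v) = - a2 u v /\
   ip eps (V2 e1 u v) (e3 u v) = 0 /\ ip eps (V2 e1 u v) (e4 u v) = g u v) /\
  (ip eps (V1 e2 u v) (e1 u v) = a1 u v /\
   ip eps (V1 e2 u v) (e2 u v) = 0 /\ ip eps (V2 e2 u v) (e2 u v) = 0) /\
  (ip eps (V1 e3 u v) (e1 u v) = - k1 u v /\ ip eps (V2 e3 u v) (e1 u v) = 0 /\
   ip eps (V1 e3 u v) (e2 u v) = 0 /\ ip eps (V2 e3 u v) (e2 u v) = - k2 u v /\
   ip eps (V1 e3 u v) (e3 u v) = 0 /\ ip eps (V2 e3 u v) (e3 u v) = 0) /\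
  (ip eps (V1 e4 u v) (e1 u v) = - al u v /\ ip eps (V2 e4 u v) (e1 u v) = - g u v /\
   ip eps (V1 e4 u v) (e2 u v) = - g u v /\ ip eps (V2 e4 u v) (e2 u v) = al u v /\
   ip eps (V1 e4 u v) (e3 u v) = - b1 u v /\ ip eps (V2 e4 u v) (e3 u v) = - b2 u v /\
   ip eps (V1 e4 u v) (e4 u v) = 0 /\ ip eps (V2 e4 u v) (e4 u v) = 0).
Proof.
  intros Huv.
  assert (I21 : forall u v, U u v -> ip eps (e2 u v) (e1 u v) = 0)
    by (intros; rewrite ip_comm; auto).
  assert (Z3 : ip eps (V2 e1 u v) (e3 u v) = 0) by (rewrite bracket_normal; auto).
  assert (Z4 : ip eps (V2 e1 u v) (e4 u v) = g u v) by (rewrite bracket_normal; auto).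
  rewrite (connection_unit x1 x2 e1), (connection_unit y1 y2 e1), (connection_unit x1 x2 e2),
    (connection_unit y1 y2 e2), (connection_unit x1 x2 e3), (connection_unit y1 y2 e3),
    (connection_unit x1 x2 e4), (connection_unit y1 y2 e4) by trivial.
  rewrite (connection_skew y1 y2 e2 e1 0), (connection_skew x1 x2 e1 e2 0) by trivial.
  rewrite (connection_skew x1 x2 e1 e3 0), (connection_skew y1 y2 e1 e3 0),
    (connection_skew x1 x2 e2 e3 0), (connection_skew y1 y2 e2 e3 0),
    (connection_skew x1 x2 e1 e4 0), (connection_skew y1 y2 e1 e4 0),
    (connection_skew x1 x2 e2 e4 0), (connection_skew y1 y2 e2 e4 0),
    (connection_skew x1 x2 e3 e4 0), (connection_skew y1 y2 e3 e4 0)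
    by (trivial; first [apply ip_e1_e3 | apply ip_e1_e4 | apply ip_e2_e3 | apply ip_e2_e4]).
  rewrite Z3, Z4, Ha1, Ha2, Hk1, Hk12, Hk2, Hal1, Hal2, Hal12, Hb1, Hb2 by trivial.
  repeat split; ring.
Qed.

Lemma connection_smooth : smooth_on U a1 /\ smooth_on U a2 /\ smooth_on U k1 /\
  smooth_on U k2 /\ smooth_on U al /\ smooth_on U b1 /\ smooth_on U b2.
Proof.
  assert (W : forall z1 z2 X Y h, smooth_on U z1 -> smooth_on U z2 -> vsmooth_on U X ->
    vsmooth_on U Y -> (forall u v, U u v -> ip eps (vdir z1 z2 X u v) (Y u v) = h u v) ->
    smooth_on U h).
  { intros z1 z2 X Y h H1 H2 HX HY E.
    apply (smooth_ext U (fun u v => ip eps (vdir z1 z2 X u v) (Y u v))); trivial.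
    apply smooth_ip; trivial; apply vsmooth_vdir; trivial. }
  repeat split.
  - apply (W x1 x2 e2 e1); trivial; apply connection_table.
  - apply (W y1 y2 e2 e1); trivial.
  - apply (W x1 x2 e1 e3); trivial.
  - apply (W y1 y2 e2 e3); trivial.
  - apply (W x1 x2 e1 e4); trivial.
  - apply (W x1 x2 e3 e4); trivial.
  - apply (W y1 y2 e3 e4); trivial.
Qed.

(** By torsion-freeness the bracket of [e1] and [e2] is [a1 e1 + a2 e2]. *)
Lemma bracket_coefficients u v : U u v ->
  E1 y1 u v - E2 x1 u v = a1 u v * x1 u v + a2 u v * y1 u v /\
  E1 y2 u v - E2 x2 u v = a1 u v * x2 u v + a2 u v * y2 u v.
Proof.
  intros Huv; destruct (connection_table u v Huv) as ((A1 & A2 & A3 & _) & (B1 & B2 & _) & _).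
  assert (B := frame_bracket u v Huv).
  assert (Ht : is_tangent psi (vsub (V1 e2 u v) (V2 e1 u v)) u v).
  { rewrite B; eexists; eexists; reflexivity. }
  assert (C := tangent_orthonormal eps psi u v (e1 u v) (e2 u v) (T1 u v Huv) (T2 u v Huv)
    (I11 u v Huv) (I22 u v Huv) (I12 u v Huv) _ Ht).
  rewrite !ip_subl, A2, A3, B1, B2, B in C.
  split.
  - rewrite <- (comp1_tangent eps psi u v (Hg u v Huv) (E1 y1 u v - E2 x1 u v)
      (E1 y2 u v - E2 x2 u v)), C, comp1_add, 2!comp1_scal; unfold x1, y1; ring.
  - rewrite <- (comp2_tangent eps psi u v (Hg u v Huv) (E1 y1 u v - E2 x1 u v)
      (E1 y2 u v - E2 x2 u v)), C, comp2_add, 2!comp2_scal; unfold x2, y2; ring.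
Qed.

Lemma bracket_scalar h u v : smooth_on U h -> U u v ->
  E1 (E2 h) u v - E2 (E1 h) u v = a1 u v * E1 h u v + a2 u v * E2 h u v.
Proof.
  intros Hh Huv; rewrite (dir_bracket U) by trivial.
  destruct (bracket_coefficients u v Huv) as [-> ->]; unfold dir; ring.
Qed.

(** The exterior derivative of a connection form.  Second derivatives of [X] enter
    only through the bracket, because the ambient connection is flat. *)
Lemma connection_curvature X Y u v : vsmooth_on U X -> vsmooth_on U Y -> U u v ->
  E1 (fun u v => ip eps (V2 X u v) (Y u v)) u v - E2 (fun u v => ip eps (V1 X u v) (Y u v)) u v
  = a1 u v * ip eps (V1 X u v) (Y u v) + a2 u v * ip eps (V2 X u v) (Y u v)
    + ip eps (V2 X u v) (V1 Y u v) - ip eps (V1 X u v) (V2 Y u v).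
Proof.
  intros HX HY Huv.
  assert (W1 : vsmooth_on U (V1 X)) by (apply vsmooth_vdir; trivial).
  assert (W2 : vsmooth_on U (V2 X)) by (apply vsmooth_vdir; trivial).
  rewrite 2!(dir_ip U HU) by trivial.
  assert (B : vsub (V1 (V2 X) u v) (V2 (V1 X) u v)
    = vadd (vscal (a1 u v) (V1 X u v)) (vscal (a2 u v) (V2 X u v))).
  { apply vec_ext; intros i.
    exact (bracket_scalar (fun u v => X u v i) u v (HX i) Huv). }
  assert (B' := f_equal (fun w => ip eps w (Y u v)) B); cbv beta in B'.
  revert B'; ip_expand; lra.
Qed.

(** The position vector contributes the last line, which is the curvature of the
    space form: each frame field is orthogonal to it, and differentiating this
    relation gives its component of the derivative of the field. *)
Lemma connection_product X Y u v :
  X = e1 \/ X = e2 \/ X = e3 \/ X = e4 -> Y = e1 \/ Y = e2 \/ Y = e3 \/ Y = e4 -> U u v ->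
  ip eps (V2 X u v) (V1 Y u v) - ip eps (V1 X u v) (V2 Y u v)
  = ip eps (V2 X u v) (e1 u v) * ip eps (V1 Y u v) (e1 u v)
    + ip eps (V2 X u v) (e2 u v) * ip eps (V1 Y u v) (e2 u v)
    + ip eps (V2 X u v) (e3 u v) * ip eps (V1 Y u v) (e3 u v)
    + ip eps (V2 X u v) (e4 u v) * ip eps (V1 Y u v) (e4 u v)
    - (ip eps (V1 X u v) (e1 u v) * ip eps (V2 Y u v) (e1 u v)
    + ip eps (V1 X u v) (e2 u v) * ip eps (V2 Y u v) (e2 u v)
    + ip eps (V1 X u v) (e3 u v) * ip eps (V2 Y u v) (e3 u v)
    + ip eps (V1 X u v) (e4 u v) * ip eps (V2 Y u v) (e4 u v))
    + eps * (ip eps (X u v) (e2 u v) * ip eps (Y u v) (e1 u v)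
      - ip eps (X u v) (e1 u v) * ip eps (Y u v) (e2 u v)).
Proof.
  intros HX HY Huv.
  destruct (frame_tangent_space_form X HX) as (SX & TX & ZX).
  destruct (frame_tangent_space_form Y HY) as (SY & TY & ZY).
  rewrite (frame_expansion (V2 X u v) (V1 Y u v) u v Huv (ZX y1 y2 u v Huv)).
  rewrite (frame_expansion (V1 X u v) (V2 Y u v) u v Huv (ZX x1 x2 u v Huv)).
  pose proof (connection_position x1 x2 X u v SX TX Huv) as P1.
  pose proof (connection_position y1 y2 X u v SX TX Huv) as P2.
  rewrite V1_psi in P1 by trivial; rewrite V2_psi in P2 by trivial.
  assert (R1 : eps * ip eps (V2 Y u v) (psi u v) = - (eps * ip eps (Y u v) (e2 u v))).
  { rewrite (connection_position y1 y2 Y u v SY TY Huv), V2_psi; trivial. }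
  assert (R2 : eps * ip eps (V1 Y u v) (psi u v) = - (eps * ip eps (Y u v) (e1 u v))).
  { rewrite (connection_position x1 x2 Y u v SY TY Huv), V1_psi; trivial. }
  assert (Z : eps * (ip eps (V2 X u v) (psi u v) * ip eps (V1 Y u v) (psi u v))
      = eps * (ip eps (X u v) (e2 u v) * ip eps (Y u v) (e1 u v))).
  { destruct (Req_dec eps 0) as [E|E]; [apply (zero_mult_eq eps); exact E|].
    apply (Rmult_eq_reg_l eps); trivial.
    transitivity ((eps * ip eps (V2 X u v) (psi u v)) * (eps * ip eps (V1 Y u v) (psi u v)));
      [ring | rewrite P2, R2; ring]. }
  assert (Z' : eps * (ip eps (V1 X u v) (psi u v) * ip eps (V2 Y u v) (psi u v))
      = eps * (ip eps (X u v) (e1 u v) * ip eps (Y u v) (e2 u v))).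
  { destruct (Req_dec eps 0) as [E|E]; [apply (zero_mult_eq eps); exact E|].
    apply (Rmult_eq_reg_l eps); trivial.
    transitivity ((eps * ip eps (V1 X u v) (psi u v)) * (eps * ip eps (V2 Y u v) (psi u v)));
      [ring | rewrite P1, R1; ring]. }
  rewrite Z, Z'; ring.
Qed.

Let i1 : e1 = e1 \/ e1 = e2 \/ e1 = e3 \/ e1 = e4 := or_introl eq_refl.
Let i2 : e2 = e1 \/ e2 = e2 \/ e2 = e3 \/ e2 = e4 := or_intror (or_introl eq_refl).
Let i3 : e3 = e1 \/ e3 = e2 \/ e3 = e3 \/ e3 = e4 := or_intror (or_intror (or_introl eq_refl)).
Let i4 : e4 = e1 \/ e4 = e2 \/ e4 = e3 \/ e4 = e4 := or_intror (or_intror (or_intror eq_refl)).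

(** Flatness of the normal bundle says that the form [<d e3, e4>] is closed;
    by the previous expansion the shape operators then commute. *)
Lemma flat_shape_operators_commute u v : U u v -> flat_normal_on eps psi U ->
  k1 u v <> k2 u v -> g u v = 0.
Proof.
  intros Huv Hflat Hk.
  assert (P1 := vsmooth_D1 U psi Hpsi); assert (P2 := vsmooth_D2 U psi Hpsi).
  assert (Q1 : vsmooth_on U (nabla_perp1 eps psi e3)) by (apply vsmooth_nabla_perp; trivial).
  assert (Q2 : vsmooth_on U (nabla_perp2 eps psi e3)) by (apply vsmooth_nabla_perp; trivial).
  assert (Z0 : forall u v, U u v -> eps = 0 -> e3 u v ax5 = 0).
  { intros a b Hab; apply (N3 a b Hab). }
  assert (A1 : forall u v n, U u v -> is_normal eps psi n u v -> forall V,
    ip eps (nabla_perp1 eps psi V u v) n = ip eps (D1 V u v) n).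
  { intros a b n Hab Hn V; unfold nabla_perp1; rewrite (ip_nabla_perp U) by trivial.
    destruct (comp_Pu eps psi a b (Hg a b Hab)) as [-> ->]; ring. }
  assert (A2 : forall u v n, U u v -> is_normal eps psi n u v -> forall V,
    ip eps (nabla_perp2 eps psi V u v) n = ip eps (D2 V u v) n).
  { intros a b n Hab Hn V; unfold nabla_perp2; rewrite (ip_nabla_perp U) by trivial.
    destruct (comp_Pv eps psi a b (Hg a b Hab)) as [-> ->]; ring. }
  assert (O : forall z1 z2 u v, U u v -> ip eps (vdir z1 z2 e3 u v) (e3 u v) = 0 /\
    ip eps (vdir z1 z2 e4 u v) (e4 u v) = 0).
  { intros; split; apply connection_unit; trivial. }
  assert (N : forall u v V, U u v -> (eps = 0 -> forall u v, U u v -> V u v ax5 = 0) ->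
    is_normal eps psi (nabla_perp1 eps psi V u v) u v /\
    is_normal eps psi (nabla_perp2 eps psi V u v) u v).
  { intros; split; apply (nabla_perp_is_normal U HU eps psi Hpsi); trivial. }
  (* The connection form of the normal bundle is skew, so that its products
     with itself cancel. *)
  assert (C1 : ip eps (nabla_perp2 eps psi e3 u v) (D1 e4 u v) = 0).
  { rewrite ip_comm, <- (A1 u v _ Huv (proj2 (N u v e3 Huv (fun E a b H => Z0 a b H E)))).
    rewrite normal_expansion with (u := u) (v := v); trivial.
    - rewrite (A2 u v (e3 u v)), (A1 u v (e4 u v)) by auto.
      rewrite <- (vdir_0_1 e3), <- (vdir_1_0 e4), (proj1 (O _ _ u v Huv)), (proj2 (O _ _ u v Huv)); ring.
    - apply N; trivial; intros E a b Hab; apply (N4 a b Hab), E.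
    - apply N; trivial; intros E a b Hab; apply Z0; trivial. }
  assert (C2 : ip eps (nabla_perp1 eps psi e3 u v) (D2 e4 u v) = 0).
  { rewrite ip_comm, <- (A2 u v _ Huv (proj1 (N u v e3 Huv (fun E a b H => Z0 a b H E)))).
    rewrite normal_expansion with (u := u) (v := v); trivial.
    - rewrite (A1 u v (e3 u v)), (A2 u v (e4 u v)) by auto.
      rewrite <- (vdir_1_0 e3), <- (vdir_0_1 e4), (proj1 (O _ _ u v Huv)), (proj2 (O _ _ u v Huv)); ring.
    - apply N; trivial; intros E a b Hab; apply (N4 a b Hab), E.
    - apply N; trivial; intros E a b Hab; apply Z0; trivial. }
  assert (K := f_equal (fun w => ip eps w (e4 u v)) (Hflat e3 S3 N3 u v Huv)); cbv beta in K.
  rewrite A1, A2 in K by auto.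
  assert (K1 := d1_ip U HU eps _ _ u v Q2 S4 Huv).
  assert (K2 := d2_ip U HU eps _ _ u v Q1 S4 Huv).
  rewrite (d1_ext U HU _ (fun u v => ip eps (D2 e3 u v) (e4 u v))) in K1 by auto.
  rewrite (d2_ext U HU _ (fun u v => ip eps (D1 e3 u v) (e4 u v))) in K2 by auto.
  rewrite (d1_ip U HU) in K1 by (trivial; apply vsmooth_D2; trivial).
  rewrite (d2_ip U HU) in K2 by (trivial; apply vsmooth_D1; trivial).
  rewrite C1 in K1; rewrite C2 in K2.
  rewrite (D_schwarz U HU e3 u v S3 Huv) in K1.
  assert (M : ip eps (D2 e3 u v) (D1 e4 u v) = ip eps (D1 e3 u v) (D2 e4 u v)) by lra.
  assert (L : ip eps (V2 e3 u v) (V1 e4 u v) - ip eps (V1 e3 u v) (V2 e4 u v) = 0).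
  { unfold vdir; ip_expand; rewrite M; ring. }
  rewrite connection_product in L by trivial.
  destruct (connection_table u v Huv) as (_ & _ & (C31 & C31' & C32 & C32' & C33 & C33') &
    (C41 & C41' & C42 & C42' & C43 & C43' & C44 & C44')).
  rewrite C31, C31', C32, C32', C33, C33', C41, C41', C42, C42', C43, C43', C44, C44' in L.
  rewrite (ip_comm eps (e3 u v) (e2 u v)), (ip_comm eps (e3 u v) (e1 u v)),
    ip_e1_e3, ip_e2_e3 in L by trivial.
  assert (L' : (k2 u v - k1 u v) * g u v = 0) by lra.
  destruct (Rmult_integral _ _ L') as [L0|L0]; [exfalso; apply Hk; lra | exact L0].
Qed.

Section FlatFrame.
Context (Hflat : forall u v, U u v -> g u v = 0).

Lemma structure_equations u v : U u v ->
  E1 k2 u v = a2 u v * (k2 u v - k1 u v) - al u v * b1 u v /\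
  E2 k1 u v = a1 u v * (k2 u v - k1 u v) + al u v * b2 u v /\
  E1 al u v = k2 u v * b1 u v + 2 * al u v * a2 u v /\
  E2 al u v = - 2 * al u v * a1 u v - k1 u v * b2 u v /\
  E1 b2 u v - E2 b1 u v = a1 u v * b1 u v + a2 u v * b2 u v /\
  E1 a2 u v - E2 a1 u v
    = eps + k1 u v * k2 u v - al u v * al u v + a1 u v * a1 u v + a2 u v * a2 u v.
Proof.
  intros Huv.
  destruct connection_smooth as (Sa1 & Sa2 & _ & _ & Sal & _).
  assert (T := fun a b Hab => connection_table a b Hab).
  assert (V21_2 : forall u v, U u v -> ip eps (V2 e1 u v) (e2 u v) = - a2 u v) by apply T.
  assert (V21_3 : forall u v, U u v -> ip eps (V2 e1 u v) (e3 u v) = 0) by apply T.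
  assert (V21_4 : forall u v, U u v -> ip eps (V2 e1 u v) (e4 u v) = 0).
  { intros a b Hab; rewrite <- (Hflat a b Hab); apply T, Hab. }
  assert (V12_4 : forall u v, U u v -> ip eps (V1 e2 u v) (e4 u v) = 0).
  { intros a b Hab; rewrite <- (Hflat a b Hab); apply Hal12, Hab. }
  assert (M12 := connection_curvature e1 e2 u v S1 S2 Huv).
  assert (M13 := connection_curvature e1 e3 u v S1 S3 Huv).
  assert (M14 := connection_curvature e1 e4 u v S1 S4 Huv).
  assert (M23 := connection_curvature e2 e3 u v S2 S3 Huv).
  assert (M24 := connection_curvature e2 e4 u v S2 S4 Huv).
  assert (M34 := connection_curvature e3 e4 u v S3 S4 Huv).
  assert (S : forall a b c d, a + b + c - d = a + b + (c - d)) by (intros; ring).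
  rewrite S, connection_product in M12, M13, M14, M23, M24, M34 by trivial.
  rewrite (dir_ext U HU x1 x2 _ (fun u v => - a2 u v)) in M12 by auto.
  rewrite (dir_ext U HU y1 y2 _ (fun u v => - a1 u v)) in M12 by auto.
  rewrite (dir_const_on U HU x1 x2 _ 0) in M13 by auto.
  rewrite (dir_ext U HU y1 y2 _ k1) in M13 by auto.
  rewrite (dir_const_on U HU x1 x2 _ 0) in M14 by auto.
  rewrite (dir_ext U HU y1 y2 _ al) in M14 by auto.
  rewrite (dir_ext U HU x1 x2 _ k2) in M23 by auto.
  rewrite (dir_const_on U HU y1 y2 _ 0) in M23 by auto.
  rewrite (dir_ext U HU x1 x2 _ (fun u v => - al u v)) in M24 by auto.
  rewrite (dir_const_on U HU y1 y2 _ 0) in M24 by auto.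
  rewrite (dir_ext U HU x1 x2 _ b2) in M34 by auto.
  rewrite (dir_ext U HU y1 y2 _ b1) in M34 by auto.
  destruct (connection_table u v Huv) as ((C11 & C11' & C12' & C13' & C14') &
    (C21 & C22 & C22') & (C31 & C31' & C32 & C32' & C33 & C33') &
    (C41 & C41' & C42 & C42' & C43 & C43' & C44 & C44')).
  revert M12 M13 M14 M23 M24 M34.
  rewrite (ip_comm eps (e2 u v) (e1 u v)), (ip_comm eps (e3 u v) (e1 u v)),
    (ip_comm eps (e3 u v) (e2 u v)), (ip_comm eps (e4 u v) (e1 u v)),
    (ip_comm eps (e4 u v) (e2 u v)), I11, I12, I22, ip_e1_e3, ip_e1_e4, ip_e2_e3, ip_e2_e4,
    C11, C11', C12', C13', C14', C21, C22, C22', C31, C31', C32, C32', C33, C33',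
    C41, C41', C42, C42', C43, C43', C44, C44',
    Ha1, Ha2, Hk1, Hk12, Hk2, Hal1, Hal2, Hal12, Hb1, Hb2, Hflat by trivial.
  intros M12 M13 M14 M23 M24 M34.
  rewrite (dir_opp U HU x1 x2 a2) in M12 by trivial.
  rewrite (dir_opp U HU y1 y2 a1) in M12 by trivial.
  rewrite (dir_opp U HU x1 x2 al) in M24 by trivial.
  repeat split; lra.
Qed.

(** Skewness moves the derivative from the tangent field to [e3] and [e4], whose
    tangential derivatives are given by the diagonal shape operators. *)
Lemma second_form_coordinates Y u v : U u v -> vsmooth_on U Y ->
  (forall u v, U u v -> is_tangent psi (Y u v) u v) ->
  let p1 := ip eps (D1 psi u v) (e1 u v) in let p2 := ip eps (D1 psi u v) (e2 u v) in
  let q1 := ip eps (D2 psi u v) (e1 u v) in let q2 := ip eps (D2 psi u v) (e2 u v) in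
  let t1 := ip eps (Y u v) (e1 u v) in let t2 := ip eps (Y u v) (e2 u v) in
  ip eps (D1 Y u v) (e3 u v) = k1 u v * (p1 * t1) + k2 u v * (p2 * t2) /\
  ip eps (D2 Y u v) (e3 u v) = k1 u v * (q1 * t1) + k2 u v * (q2 * t2) /\
  ip eps (D1 Y u v) (e4 u v) = al u v * (p1 * t1) - al u v * (p2 * t2) /\
  ip eps (D2 Y u v) (e4 u v) = al u v * (q1 * t1) - al u v * (q2 * t2).
Proof.
  intros Huv SY TY; cbv zeta.
  destruct (comp_duality eps psi u v (Hg u v Huv) (e1 u v) (e2 u v)) as (A & B & C & D); auto.
  cbv zeta in A, B, C, D.
  fold (x1 u v) (x2 u v) (y1 u v) (y2 u v) in A, B, C, D.
  set (p1 := ip eps (D1 psi u v) (e1 u v)) in *; set (p2 := ip eps (D1 psi u v) (e2 u v)) in *.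
  set (q1 := ip eps (D2 psi u v) (e1 u v)) in *; set (q2 := ip eps (D2 psi u v) (e2 u v)) in *.
  assert (L1 : forall V, D1 V u v = vadd (vscal p1 (V1 V u v)) (vscal p2 (V2 V u v))).
  { intros V; apply vec_ext; intros i; unfold vdir, vadd, vscal.
    transitivity ((p1 * x1 u v + p2 * y1 u v) * D1 V u v i
      + (p1 * x2 u v + p2 * y2 u v) * D2 V u v i); [rewrite A, B|]; ring. }
  assert (L2 : forall V, D2 V u v = vadd (vscal q1 (V1 V u v)) (vscal q2 (V2 V u v))).
  { intros V; apply vec_ext; intros i; unfold vdir, vadd, vscal.
    transitivity ((q1 * x1 u v + q2 * y1 u v) * D1 V u v i
      + (q1 * x2 u v + q2 * y2 u v) * D2 V u v i); [rewrite C, D|]; ring. }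
  destruct (connection_table u v Huv) as (_ & _ & (C31 & C31' & C32 & C32' & _) &
    (C41 & C41' & C42 & C42' & _)).
  assert (EY := tangent_orthonormal eps psi u v (e1 u v) (e2 u v) (T1 u v Huv) (T2 u v Huv)
    (I11 u v Huv) (I22 u v Huv) (I12 u v Huv) _ (TY u v Huv)).
  assert (E3 : forall z1 z2, ip eps (vdir z1 z2 Y u v) (e3 u v)
    = - ip eps (vdir z1 z2 e3 u v) (Y u v)).
  { intros z1 z2; apply (connection_skew z1 z2 e3 Y 0); trivial.
    intros a b Hab; apply (ip_normal_tangent eps psi a b); auto. }
  assert (E4 : forall z1 z2, ip eps (vdir z1 z2 Y u v) (e4 u v)
    = - ip eps (vdir z1 z2 e4 u v) (Y u v)).
  { intros z1 z2; apply (connection_skew z1 z2 e4 Y 0); trivial.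
    intros a b Hab; apply (ip_normal_tangent eps psi a b); auto. }
  set (t1 := ip eps (Y u v) (e1 u v)) in *; set (t2 := ip eps (Y u v) (e2 u v)) in *.
  rewrite (L1 Y), (L2 Y); ip_expand; rewrite 2!E3, 2!E4, EY; ip_expand.
  rewrite C31, C31', C32, C32', C41, C41', C42, C42', Hflat by trivial.
  repeat split; ring.
Qed.

(** The equation of Gauss.  The definition of the curvature uses the coordinate
    fields instead of the frame, so it is derived from the second fundamental
    form in coordinates, and not from [connection_curvature]. *)
Lemma gauss_curvature_frame u v : U u v ->
  gauss_curvature eps psi u v = eps + k1 u v * k2 u v - al u v * al u v.
Proof.
  intros Huv.
  assert (P1 := vsmooth_D1 U psi Hpsi); assert (P2 := vsmooth_D2 U psi Hpsi).
  assert (P22 := vsmooth_D2 U _ P2); assert (P12 := vsmooth_D1 U _ P2).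
  assert (Q1 : vsmooth_on U (nabla1 eps psi (D2 psi))) by (apply vsmooth_nabla; trivial).
  assert (Q2 : vsmooth_on U (nabla2 eps psi (D2 psi))) by (apply vsmooth_nabla; trivial).
  assert (TT := tangent_is_tangent_space_form U HU eps psi Hpsi Hsf).
  assert (TU : forall u v, is_tangent psi (D1 psi u v) u v) by apply tangent_Pu.
  assert (TV : forall u v, is_tangent psi (D2 psi u v) u v) by apply tangent_Pv.
  assert (A1 : forall V Z u v, U u v -> is_tangent psi Z u v ->
    ip eps (nabla1 eps psi V u v) Z = ip eps (D1 V u v) Z).
  { intros V Z a b Hab HZ; unfold nabla1, nabla, nabla_bar.
    rewrite ip_tan_part, ip_proj_orthogonal by auto.
    destruct (comp_Pu eps psi a b (Hg a b Hab)) as [-> ->]; ip_expand; ring. }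
  assert (A2 : forall V Z u v, U u v -> is_tangent psi Z u v ->
    ip eps (nabla2 eps psi V u v) Z = ip eps (D2 V u v) Z).
  { intros V Z a b Hab HZ; unfold nabla2, nabla, nabla_bar.
    rewrite ip_tan_part, ip_proj_orthogonal by auto.
    destruct (comp_Pv eps psi a b (Hg a b Hab)) as [-> ->]; ip_expand; ring. }
  assert (K1 := d1_ip U HU eps _ _ u v Q2 P1 Huv).
  assert (K2 := d2_ip U HU eps _ _ u v Q1 P1 Huv).
  rewrite (d1_ext U HU _ (fun u v => ip eps (D2 (D2 psi) u v) (D1 psi u v))) in K1 by auto.
  rewrite (d2_ext U HU _ (fun u v => ip eps (D1 (D2 psi) u v) (D1 psi u v))) in K2 by auto.
  rewrite (d1_ip U HU) in K1 by trivial.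
  rewrite (d2_ip U HU) in K2 by trivial.
  (* The tangential part drops out of the difference of a derivative and its
     projection, which leaves the second fundamental form and the curvature of
     the ambient space. *)
  assert (W : forall x t y, (eps = 0 -> x ax5 = 0) -> is_tangent psi t u v ->
    (forall Z, is_tangent psi Z u v -> ip eps t Z = ip eps x Z) ->
    ip eps x y - ip eps t y = ip eps x (e3 u v) * ip eps y (e3 u v)
      + ip eps x (e4 u v) * ip eps y (e4 u v) + eps * (ip eps x (psi u v) * ip eps y (psi u v))).
  { intros x t y Hx Ht E; rewrite (frame_expansion x y u v Huv Hx).
    rewrite (tangent_orthonormal eps psi u v (e1 u v) (e2 u v) (T1 u v Huv) (T2 u v Huv)
      (I11 u v Huv) (I22 u v Huv) (I12 u v Huv) t Ht).
    ip_expand; rewrite 2!E, (ip_comm eps y (e1 u v)), (ip_comm eps y (e2 u v)) by auto; ring. }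
  assert (Z5 : eps = 0 -> D1 (D2 psi) u v ax5 = 0 /\ D2 (D2 psi) u v ax5 = 0).
  { intros E; apply (derivative_ax5 U HU (D2 psi)); trivial; intros a b Hab.
    apply (TT (D2 psi a b) a b); auto. }
  assert (W1 := W (D2 (D2 psi) u v) (nabla2 eps psi (D2 psi) u v) (D1 (D1 psi) u v)
    (fun E => proj2 (Z5 E)) (tangent_sharp _ _ _ _ _ _) (fun Z HZ => A2 _ Z u v Huv HZ)).
  assert (W2 := W (D1 (D2 psi) u v) (nabla1 eps psi (D2 psi) u v) (D2 (D1 psi) u v)
    (fun E => proj1 (Z5 E)) (tangent_sharp _ _ _ _ _ _) (fun Z HZ => A1 _ Z u v Huv HZ)).
  destruct (second_form_coordinates (D1 psi) u v Huv P1 (fun a b _ => TU a b))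
    as (B1 & B2 & B3 & B4); cbv zeta in B1, B2, B3, B4.
  destruct (second_form_coordinates (D2 psi) u v Huv P2 (fun a b _ => TV a b))
    as (B5 & B6 & B7 & B8); cbv zeta in B5, B6, B7, B8.
  assert (O : forall z1 z2 Y, vsmooth_on U Y -> (forall u v, is_tangent psi (Y u v) u v) ->
    eps * ip eps (vdir z1 z2 Y u v) (psi u v) = - (eps * ip eps (Y u v) (vdir z1 z2 psi u v))).
  { intros z1 z2 Y SY TY; apply connection_position; auto. }
  assert (O1 := O (fun _ _ => 1) (fun _ _ => 0) _ P1 TU); rewrite 2!vdir_1_0 in O1.
  assert (O2 := O (fun _ _ => 0) (fun _ _ => 1) _ P1 TU); rewrite 2!vdir_0_1 in O2.
  assert (O3 := O (fun _ _ => 1) (fun _ _ => 0) _ P2 TV); rewrite 2!vdir_1_0 in O3.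
  assert (O4 := O (fun _ _ => 0) (fun _ _ => 1) _ P2 TV); rewrite 2!vdir_0_1 in O4.
  assert (R : forall a b c d, eps * a = - (eps * c) -> eps * b = - (eps * d) ->
    eps * (a * b) = eps * (c * d)).
  { intros a b c d H1 H2; destruct (Req_dec eps 0) as [E|E].
    - apply zero_mult_eq, E.
    - apply (Rmult_eq_reg_l eps); trivial.
      transitivity ((eps * a) * (eps * b)); [ring | rewrite H1, H2; ring]. }
  rewrite (R _ _ _ _ O4 O1) in W1; rewrite (R _ _ _ _ O3 O2) in W2.
  rewrite B1, B3, B6, B8 in W1; rewrite B2, B4, B5, B7 in W2.
  assert (EU := tangent_orthonormal eps psi u v (e1 u v) (e2 u v) (T1 u v Huv) (T2 u v Huv)
    (I11 u v Huv) (I22 u v Huv) (I12 u v Huv) _ (TU u v)).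
  assert (EV := tangent_orthonormal eps psi u v (e1 u v) (e2 u v) (T1 u v Huv) (T2 u v Huv)
    (I11 u v Huv) (I22 u v Huv) (I12 u v Huv) _ (TV u v)).
  assert (G : forall X Y, is_tangent psi X u v -> is_tangent psi Y u v -> ip eps X Y
    = ip eps X (e1 u v) * ip eps Y (e1 u v) + ip eps X (e2 u v) * ip eps Y (e2 u v)).
  { intros X Y HX HY.
    rewrite (tangent_orthonormal eps psi u v (e1 u v) (e2 u v) (T1 u v Huv) (T2 u v Huv)
      (I11 u v Huv) (I22 u v Huv) (I12 u v Huv) _ HX) at 1.
    ip_expand; rewrite (ip_comm eps (e1 u v) Y), (ip_comm eps (e2 u v) Y); ring. }
  assert (GD := Hg u v Huv).
  unfold gauss_curvature; rewrite ip_subl, A1, A2 by auto.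
  assert (S12 := D_schwarz U HU (D2 psi) u v P2 Huv).
  rewrite S12 in K1.
  apply (Rmult_eq_reg_r (gdet eps psi u v)); trivial.
  unfold Rdiv; rewrite Rmult_assoc, Rinv_l, Rmult_1_r by trivial.
  unfold gdet, g11, g12, g22.
  rewrite (G (D1 psi u v) (D1 psi u v)) in * by auto.
  rewrite (G (D1 psi u v) (D2 psi u v)) in * by auto.
  rewrite (G (D2 psi u v) (D1 psi u v)) in * by auto.
  rewrite (G (D2 psi u v) (D2 psi u v)) in * by auto.
  clear - K1 K2 W1 W2; nra.
Qed.

(** Biconservativity in the frame, when the mean curvature vector is [f e3]:
    the normal derivative of [f e3] has components the derivative of [f] and
    [f] times the torsion. *)
Lemma biconservative_equations f u v : U u v -> smooth_on U f ->
  (forall u v, U u v -> mean_curvature_vector eps psi u v = vscal (f u v) (e3 u v)) ->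
  biconservative_at eps psi u v ->
  (f u v + k1 u v) * E1 f u v = - (f u v * al u v * b1 u v) /\
  (f u v + k2 u v) * E2 f u v = f u v * al u v * b2 u v.
Proof.
  intros Huv Sf HH Hb.
  assert (LH : forall z1 z2, vdir z1 z2 (mean_curvature_vector eps psi) u v
    = vadd (vscal (dir z1 z2 f u v) (e3 u v)) (vscal (f u v) (vdir z1 z2 e3 u v))).
  { intros z1 z2; rewrite (vdir_ext U HU z1 z2 _ _ u v HH Huv); apply vec_ext; intros i.
    exact (dir_mult U HU z1 z2 f (fun u v => e3 u v i) u v Sf (S3 i) Huv). }
  set (H := mean_curvature_vector eps psi) in *.
  assert (NH : forall X, is_normal eps psi (nabla_perp eps psi X H u v) u v).
  { intros X; apply (nabla_perp_is_normal U HU eps psi Hpsi Hg Hsf); trivial.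
    intros E a b Hab; apply (mean_curvature_vector_is_normal U HU eps psi Hpsi Hg Hsf a b Hab), E. }
  assert (NS : forall X Y, is_normal eps psi (sff eps psi X Y u v) u v).
  { intros X Y; apply (sff_is_normal U HU eps psi Hpsi); trivial. }
  assert (ES : forall X Y Z, ip eps (sff eps psi X Y u v) (nabla_perp eps psi Z H u v)
    = ip eps (sff eps psi X Y u v) (e3 u v) * ip eps (nabla_perp eps psi Z H u v) (e3 u v)
    + ip eps (sff eps psi X Y u v) (e4 u v) * ip eps (nabla_perp eps psi Z H u v) (e4 u v)).
  { intros; apply normal_expansion; auto. }
  assert (Tr : forall Z, is_tangent psi Z u v ->
    ip eps (vtrace eps psi (fun X Y => shape eps psi (nabla_perp eps psi X H u v) Y u v) u v) Z
    = ip eps (sff eps psi (e1 u v) Z u v) (nabla_perp eps psi (e1 u v) H u v)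
      + ip eps (sff eps psi (e2 u v) Z u v) (nabla_perp eps psi (e2 u v) H u v)).
  { intros Z HZ.
    rewrite (ip_vtrace eps psi u v (Hg u v Huv) (e1 u v) (e2 u v) (T1 u v Huv) (T2 u v Huv)
    (I11 u v Huv) (I22 u v Huv) (I12 u v Huv)).
    - rewrite 2!(ip_shape U eps psi Hg) by trivial; reflexivity.
    - intros a b c d; rewrite 5!(ip_shape U eps psi Hg) by trivial.
      rewrite 5!ES.
      rewrite !(ip_nabla_perp U eps psi), !(ip_sff U eps psi) by auto.
      rewrite !comp1_add, !comp2_add, !comp1_scal, !comp2_scal; ring. }
  destruct (ip_sff_frame (e3 u v) u v Huv (N3 u v Huv)) as (F11 & F12 & F21 & F22).
  destruct (ip_sff_frame (e4 u v) u v Huv (N4 u v Huv)) as (G11 & G12 & G21 & G22).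
  destruct (connection_table u v Huv) as ((_ & _ & _ & C13' & C14') & _ &
    (_ & _ & _ & _ & C33 & C33') & _).
  assert (NP : forall X n, is_normal eps psi n u v ->
    ip eps (nabla_perp eps psi X H u v) n
    = comp1 eps psi X u v * ip eps (D1 H u v) n + comp2 eps psi X u v * ip eps (D2 H u v) n).
  { intros; apply (ip_nabla_perp U); trivial. }
  assert (NV1 : forall n, is_normal eps psi n u v ->
    ip eps (nabla_perp eps psi (e1 u v) H u v) n = ip eps (V1 H u v) n).
  { intros n Hn; rewrite NP by trivial; unfold vdir; ip_expand; reflexivity. }
  assert (NV2 : forall n, is_normal eps psi n u v ->
    ip eps (nabla_perp eps psi (e2 u v) H u v) n = ip eps (V2 H u v) n).
  { intros n Hn; rewrite NP by trivial; unfold vdir; ip_expand; reflexivity. }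
  assert (M13 : ip eps (nabla_perp eps psi (e1 u v) H u v) (e3 u v) = E1 f u v).
  { rewrite NV1, LH by auto; ip_expand; rewrite I33, C33 by trivial; ring. }
  assert (M14 : ip eps (nabla_perp eps psi (e1 u v) H u v) (e4 u v) = f u v * b1 u v).
  { rewrite NV1, LH by auto; ip_expand; rewrite I34, Hb1 by trivial; ring. }
  assert (M23 : ip eps (nabla_perp eps psi (e2 u v) H u v) (e3 u v) = E2 f u v).
  { rewrite NV2, LH by auto; ip_expand; rewrite I33, C33' by trivial; ring. }
  assert (M24 : ip eps (nabla_perp eps psi (e2 u v) H u v) (e4 u v) = f u v * b2 u v).
  { rewrite NV2, LH by auto; ip_expand; rewrite I34, Hb2 by trivial; ring. }
  assert (Gr : forall z1 z2, dir z1 z2 (fun u v => ip eps (H u v) (H u v)) u v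
    = 2 * f u v * dir z1 z2 f u v).
  { intros z1 z2; rewrite (dir_ext U HU z1 z2 _ (fun u v => f u v * f u v)).
    - rewrite (dir_mult U HU) by trivial; ring.
    - intros a b Hab; rewrite HH by trivial; ip_expand; rewrite I33 by trivial; ring.
    - trivial. }
  unfold biconservative_at in Hb; cbv zeta in Hb; fold H in Hb.
  assert (Q1 := f_equal (fun w => ip eps w (e1 u v)) Hb).
  assert (Q2 := f_equal (fun w => ip eps w (e2 u v)) Hb); cbv beta in Q1, Q2.
  revert Q1 Q2; ip_expand; rewrite 2!Tr by auto; unfold grad; rewrite 2!ip_sharp by auto.
  rewrite 4!ES, F11, F12, F21, F22, G11, G12, G21, G22, M13, M14, M23, M24.
  rewrite C13', C14', Hk1, Hk12, Hk2, Hal1, Hal2, Hal12, Hflat by trivial.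
  fold (x1 u v) (x2 u v) (y1 u v) (y2 u v).
  assert (G1 := Gr x1 x2); assert (G2 := Gr y1 y2); unfold dir in G1 at 1, G2 at 1.
  rewrite G1, G2; intros Q1 Q2; split; lra.
Qed.

End FlatFrame.
End Darboux.

(** * Rigidity of the structure equations *)

Set Implicit Arguments.
(** The equations satisfied by the coordinates [(x1, x2)] and [(y1, y2)] of the
    principal directions and by the scalar invariants of a biconservative
    surface with flat normal bundle; [pd_weingarten] is the infinitesimal form
    of a functional relation between [f] and the curvature. *)
Record principal_data (eps : R) (U : R -> R -> Prop)
    (x1 x2 y1 y2 f k1 k2 al a1 a2 b1 b2 : R -> R -> R) : Prop := {
  pd_open : open2 U;
  pd_smooth_frame : smooth_on U x1 /\ smooth_on U x2 /\ smooth_on U y1 /\ smooth_on U y2;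
  pd_det : forall u v, U u v -> x1 u v * y2 u v - x2 u v * y1 u v <> 0;
  pd_smooth_f : smooth_on U f;
  pd_smooth : smooth_on U a1 /\ smooth_on U a2 /\ smooth_on U k1 /\
    smooth_on U k2 /\ smooth_on U al /\ smooth_on U b1 /\ smooth_on U b2;
  pd_bracket : forall u v, U u v ->
    dir x1 x2 y1 u v - dir y1 y2 x1 u v = a1 u v * x1 u v + a2 u v * y1 u v /\
    dir x1 x2 y2 u v - dir y1 y2 x2 u v = a1 u v * x2 u v + a2 u v * y2 u v;
  pd_structure : forall u v, U u v ->
    dir x1 x2 k2 u v = a2 u v * (k2 u v - k1 u v) - al u v * b1 u v /\
    dir y1 y2 k1 u v = a1 u v * (k2 u v - k1 u v) + al u v * b2 u v /\
    dir x1 x2 al u v = k2 u v * b1 u v + 2 * al u v * a2 u v /\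
    dir y1 y2 al u v = - 2 * al u v * a1 u v - k1 u v * b2 u v /\
    dir x1 x2 b2 u v - dir y1 y2 b1 u v = a1 u v * b1 u v + a2 u v * b2 u v /\
    dir x1 x2 a2 u v - dir y1 y2 a1 u v
      = eps + k1 u v * k2 u v - al u v * al u v + a1 u v * a1 u v + a2 u v * a2 u v;
  pd_mean : forall u v, U u v -> k1 u v + k2 u v = 2 * f u v;
  pd_biconservative : forall u v, U u v ->
    (f u v + k1 u v) * dir x1 x2 f u v = - (f u v * al u v * b1 u v) /\
    (f u v + k2 u v) * dir y1 y2 f u v = f u v * al u v * b2 u v;
  pd_weingarten : forall u v, U u v ->
    dir x1 x2 f u v * dir y1 y2 (fun u v => k1 u v * k2 u v - al u v * al u v) u v
    = dir y1 y2 f u v * dir x1 x2 (fun u v => k1 u v * k2 u v - al u v * al u v) u v;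
  pd_f : forall u v, U u v -> f u v <> 0;
  pd_al : forall u v, U u v -> al u v <> 0;
  pd_a2 : forall u v, U u v -> a2 u v <> 0;
  pd_grad : forall u v, U u v -> dir x1 x2 f u v <> 0 \/ dir y1 y2 f u v <> 0;
  pd_generic : forall u v, U u v ->
    3 * f u v ^ 2 + k1 u v * k2 u v - al u v * al u v <> 0
}.
Unset Implicit Arguments.

Section Rigidity.
Context (eps : R) (U : R -> R -> Prop)
  (x1 x2 y1 y2 f k1 k2 al a1 a2 b1 b2 : R -> R -> R)
  (P : principal_data eps U x1 x2 y1 y2 f k1 k2 al a1 a2 b1 b2).

Let HU : open2 U := pd_open P.
Let Sf : smooth_on U f := pd_smooth_f P.

Notation E1 := (dir x1 x2).
Notation E2 := (dir y1 y2).

(* Half the difference of the principal curvatures. *)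
Let k u v := f u v - k2 u v.
(* This is [eps + f^2] minus the Gaussian curvature. *)
Let S u v := k u v * k u v + al u v * al u v.

Ltac smooth := repeat first
  [assumption | apply smooth_dir | apply smooth_plus | apply smooth_minus
  | apply smooth_mult | apply smooth_opp | apply smooth_const].

Ltac dirs := repeat first
  [rewrite dir_const | rewrite (dir_plus U HU) by smooth | rewrite (dir_minus U HU) by smooth
  | rewrite (dir_mult U HU) by smooth | rewrite (dir_opp U HU) by smooth].

Lemma principal_bracket h u v : smooth_on U h -> U u v ->
  E1 (E2 h) u v - E2 (E1 h) u v = a1 u v * E1 h u v + a2 u v * E2 h u v.
Proof.
  intros Hh Huv; destruct (pd_smooth_frame P) as (A & B & C & D).
  rewrite (dir_bracket U) by trivial.
  destruct (pd_bracket P u v Huv) as [-> ->]; unfold dir; ring.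
Qed.

Lemma k_derivatives u v : U u v ->
  k1 u v = f u v + k u v /\ k2 u v = f u v - k u v /\
  E1 k u v = E1 f u v + 2 * a2 u v * k u v + al u v * b1 u v /\
  E2 k u v = - E2 f u v - 2 * a1 u v * k u v + al u v * b2 u v.
Proof.
  intros Huv.
  destruct (pd_smooth P) as (Sa1 & Sa2 & Sk1 & Sk2 & Sal & Sb1 & Sb2).
  destruct (pd_structure P u v Huv) as (C1 & C2 & _).
  pose proof (pd_mean P) as M.
  assert (Mk : forall u v, U u v -> k u v = k1 u v - f u v).
  { intros a b Hab; specialize (M a b Hab); unfold k; lra. }
  repeat split.
  - rewrite (Mk u v Huv); ring.
  - unfold k; ring.
  - unfold k at 1; dirs; trivial; rewrite C1.
    specialize (M u v Huv); unfold k; nra.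
  - rewrite (dir_ext U HU y1 y2 k (fun u v => k1 u v - f u v)) by auto; dirs; trivial; rewrite C2.
    specialize (M u v Huv); unfold k; nra.
Qed.

Lemma smooth_k : smooth_on U k.
Proof.
  destruct (pd_smooth P) as (Sa1 & Sa2 & Sk1 & Sk2 & Sal & Sb1 & Sb2).
  unfold k; smooth.
Qed.

Lemma S_derivatives u v : U u v ->
  E1 S u v = 4 * a2 u v * S u v - 4 * f u v * E1 f u v /\
  E2 S u v = - 4 * a1 u v * S u v - 4 * f u v * E2 f u v.
Proof.
  intros Huv; pose proof smooth_k as Sk.
  destruct (pd_smooth P) as (Sa1 & Sa2 & Sk1 & Sk2 & Sal & Sb1 & Sb2).
  destruct (k_derivatives u v Huv) as (K1 & K2 & Ek1 & Ek2).
  destruct (pd_structure P u v Huv) as (_ & _ & C3 & C4 & _).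
  destruct (pd_biconservative P u v Huv) as (B1 & B2).
  unfold S at 1 3; dirs; trivial.
  rewrite Ek1, Ek2, C3, C4, K1, K2; rewrite K1 in B1; rewrite K2 in B2; unfold S.
  split; nra.
Qed.

(** The Weingarten relation kills the bracket of the principal directions on
    [f]: the curvature is [eps + f^2 - S], and [S] varies with [f] up to the
    terms in [a1] and [a2]. *)
Lemma bracket_annihilates_f u v : U u v -> a1 u v * E1 f u v + a2 u v * E2 f u v = 0.
Proof.
  intros Huv; pose proof smooth_k as Sk.
  destruct (pd_smooth P) as (Sa1 & Sa2 & Sk1 & Sk2 & Sal & Sb1 & Sb2).
  destruct (S_derivatives u v Huv) as (D1 & D2).
  pose proof (pd_weingarten P u v Huv) as W.
  assert (EK : forall z1 z2, dir z1 z2 (fun u v => k1 u v * k2 u v - al u v * al u v) u v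
    = 2 * f u v * dir z1 z2 f u v - dir z1 z2 S u v).
  { intros z1 z2.
    rewrite (dir_ext U HU z1 z2 _ (fun u v => f u v * f u v - S u v)); trivial.
    - unfold S; dirs; trivial; ring.
    - intros a b Hab; destruct (k_derivatives a b Hab) as (-> & -> & _); unfold S; ring. }
  rewrite 2!EK, D1, D2 in W.
  assert (S0 : S u v <> 0).
  { pose proof (pd_al P u v Huv); unfold S; nra. }
  apply (Rmult_eq_reg_l (4 * S u v)); lra.
Qed.

Lemma E1_f_neq_0 u v : U u v -> E1 f u v <> 0.
Proof.
  intros Huv E; pose proof (bracket_annihilates_f u v Huv) as B; rewrite E in B.
  pose proof (pd_a2 P u v Huv) as A2.
  destruct (pd_grad P u v Huv) as [G|G]; [tauto|].
  apply G; apply (Rmult_eq_reg_l (a2 u v)); trivial; lra.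
Qed.

(* Since [(a1, a2)] is orthogonal to the gradient [(p, q)] of [f], it is a multiple
   of [(q, - p)]; this is the factor. *)
Let lam u v := - a2 u v / E1 f u v.

Lemma smooth_lam : smooth_on U lam.
Proof.
  destruct (pd_smooth P) as (_ & Sa2 & _).
  destruct (pd_smooth_frame P) as (A & B & _).
  apply (smooth_div U (fun u v => - a2 u v)); smooth.
  exact E1_f_neq_0.
Qed.

Lemma lam_spec u v : U u v ->
  a2 u v = - (lam u v * E1 f u v) /\ a1 u v = lam u v * E2 f u v.
Proof.
  intros Huv; pose proof (E1_f_neq_0 u v Huv) as N.
  pose proof (bracket_annihilates_f u v Huv) as B.
  unfold lam; split; [field; exact N|].
  apply (Rmult_eq_reg_r (E1 f u v)); trivial.
  transitivity (- a2 u v * E2 f u v); [lra | field; exact N].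
Qed.

Lemma second_derivative_f u v : U u v -> E1 (E2 f) u v = E2 (E1 f) u v.
Proof.
  intros Huv; pose proof (principal_bracket f u v Sf Huv) as B.
  pose proof (bracket_annihilates_f u v Huv); lra.
Qed.

(** [S] satisfies [dS = -4 (f + lam S) df]; differentiating once more,
    [d lam] is proportional to [df]. *)
Lemma lam_df u v : U u v -> E2 f u v * E1 lam u v = E1 f u v * E2 lam u v.
Proof.
  intros Huv; pose proof smooth_k as Sk; pose proof smooth_lam as Sl.
  destruct (pd_smooth P) as (Sa1 & Sa2 & Sk1 & Sk2 & Sal & Sb1 & Sb2).
  destruct (pd_smooth_frame P) as (A & B & C & D).
  assert (SS : smooth_on U S) by (unfold S; smooth).
  assert (F : forall u v, U u v ->
    E1 S u v = -4 * (E1 f u v * (f u v + lam u v * S u v)) /\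
    E2 S u v = -4 * (E2 f u v * (f u v + lam u v * S u v))).
  { intros a b Hab; destruct (S_derivatives a b Hab) as (-> & ->).
    destruct (lam_spec a b Hab) as (-> & ->); split; ring. }
  pose proof (principal_bracket S u v SS Huv) as Br.
  rewrite (dir_ext U HU x1 x2 _ _ u v (fun a b H => proj2 (F a b H)) Huv) in Br.
  rewrite (dir_ext U HU y1 y2 _ _ u v (fun a b H => proj1 (F a b H)) Huv) in Br.
  revert Br; dirs; trivial.
  rewrite (second_derivative_f u v Huv).
  destruct (F u v Huv) as (-> & ->); destruct (lam_spec u v Huv) as (-> & ->); intros Br.
  assert (S0 : S u v <> 0).
  { pose proof (pd_al P u v Huv); unfold S; nra. }
  apply (Rmult_eq_reg_l (4 * S u v)); lra.
Qed.

(** The integrability condition of [dk] determines the mixed second derivative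
    of [f]. *)
Lemma mixed_derivative_f u v : U u v ->
  f u v * E2 (E1 f) u v = - (E1 f u v * E2 f u v * (1 + 3 * lam u v * f u v)).
Proof.
  intros Huv; pose proof smooth_k as Sk; pose proof smooth_lam as Sl.
  destruct (pd_smooth P) as (Sa1 & Sa2 & Sk1 & Sk2 & Sal & Sb1 & Sb2).
  destruct (pd_smooth_frame P) as (A & B & C & D).
  assert (F : forall u v, U u v ->
    f u v * E1 k u v = - (E1 f u v * (f u v + k u v + 2 * lam u v * f u v * k u v)) /\
    f u v * E2 k u v = E2 f u v * (f u v - k u v - 2 * lam u v * f u v * k u v)).
  { intros a b Hab.
    destruct (k_derivatives a b Hab) as (K1 & K2 & -> & ->).
    destruct (pd_biconservative P a b Hab) as (B1 & B2).
    rewrite K1 in B1; rewrite K2 in B2.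
    destruct (lam_spec a b Hab) as (-> & ->); split; nra. }
  pose proof (principal_bracket k u v Sk Huv) as Br.
  assert (G1 := dir_ext U HU y1 y2 _ _ u v (fun a b H => proj1 (F a b H)) Huv).
  assert (G2 := dir_ext U HU x1 x2 _ _ u v (fun a b H => proj2 (F a b H)) Huv).
  revert G1 G2; dirs; trivial; intros G1 G2.
  pose proof (lam_df u v Huv) as L.
  rewrite (second_derivative_f u v Huv) in G2.
  destruct (F u v Huv) as (F1 & F2).
  destruct (lam_spec u v Huv) as (E & E'); rewrite E, E' in Br; clear E E'.
  pose proof (pd_f P u v Huv) as f0.
  set (r := E2 (E1 f) u v) in *; set (s := E1 (E2 k) u v) in *; set (t := E2 (E1 k) u v) in *.
  set (p := E1 f u v) in *; set (q := E2 f u v) in *.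
  set (m := lam u v) in *; set (m1 := E1 lam u v) in *; set (m2 := E2 lam u v) in *.
  set (F0 := f u v) in *; set (K0 := k u v) in *.
  set (c1 := E1 k u v) in *; set (c2 := E2 k u v) in *.
  clearbody r s t p q m m1 m2 F0 K0 c1 c2; clear - Br G1 G2 L F1 F2 f0.
  apply (Rmult_eq_reg_l F0); trivial.
  nsatz.
Qed.

(** The Ricci equation is the integrability condition that remains.  Given the
    mixed derivative of [f], it reads
    [E1 f * E2 f * (al^2 - 4 f^2 + k^2) = 0], and the last factor is the
    genericity assumption. *)
Lemma E2_f_eq_0 u v : U u v -> E2 f u v = 0.
Proof.
  intros Huv; pose proof smooth_k as Sk; pose proof smooth_lam as Sl.
  destruct (pd_smooth P) as (Sa1 & Sa2 & Sk1 & Sk2 & Sal & Sb1 & Sb2).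
  destruct (pd_smooth_frame P) as (A & B & C & D).
  assert (F : forall u v, U u v ->
    f u v * (al u v * b1 u v) = - ((2 * f u v + k u v) * E1 f u v) /\
    f u v * (al u v * b2 u v) = (2 * f u v - k u v) * E2 f u v).
  { intros a b Hab.
    destruct (k_derivatives a b Hab) as (K1 & K2 & _).
    destruct (pd_biconservative P a b Hab) as (B1 & B2).
    rewrite K1 in B1; rewrite K2 in B2; lra. }
  assert (G1 := dir_ext U HU y1 y2 _ _ u v (fun a b H => proj1 (F a b H)) Huv).
  assert (G2 := dir_ext U HU x1 x2 _ _ u v (fun a b H => proj2 (F a b H)) Huv).
  revert G1 G2; dirs; trivial; intros G1 G2.
  rewrite (second_derivative_f u v Huv) in G2.
  pose proof (mixed_derivative_f u v Huv) as Mx.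
  destruct (F u v Huv) as (F1 & F2).
  destruct (k_derivatives u v Huv) as (K1 & K2 & Ek1 & Ek2).
  destruct (pd_structure P u v Huv) as (_ & _ & C3 & C4 & C5 & _).
  pose proof (pd_generic P u v Huv) as Gn.
  rewrite Ek2, C4 in G1; rewrite Ek1, C3 in G2.
  destruct (lam_spec u v Huv) as (L2 & L1).
  rewrite K1, K2 in *; rewrite L1, L2 in *.
  pose proof (pd_f P u v Huv) as f0.
  pose proof (pd_al P u v Huv) as al0.
  pose proof (E1_f_neq_0 u v Huv) as p0.
  set (r := E2 (E1 f) u v) in *; set (s := E1 b2 u v) in *; set (t := E2 b1 u v) in *.
  set (p := E1 f u v) in *; set (q := E2 f u v) in *.
  set (m := lam u v) in *; set (F0 := f u v) in *; set (K0 := k u v) in *.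
  set (A0 := al u v) in *; set (c1 := b1 u v) in *; set (c2 := b2 u v) in *.
  clearbody r s t p q m F0 K0 A0 c1 c2.
  clear - F1 F2 G1 G2 Mx C5 Gn f0 al0 p0.
  assert (Z : F0 * (A0 * A0 * (p * (q * (4 * (F0 * F0) - K0 * K0 - A0 * A0)))) = 0) by nsatz.
  destruct (Rmult_integral _ _ Z) as [Z0|Z1]; [tauto|].
  destruct (Rmult_integral _ _ Z1) as [Z2|Z3]; [exfalso; nra|].
  destruct (Rmult_integral _ _ Z3) as [Z4|Z5]; [tauto|].
  destruct (Rmult_integral _ _ Z5) as [Z6|Z7]; [exact Z6|].
  exfalso; apply Gn; lra.
Qed.

(** Once [f] is constant along the second direction, biconservativity and the
    structure equations in that direction leave only zeros; [a2] needs in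
    addition that [d lam] is proportional to [df]. *)
Lemma principal_rigidity u v : U u v ->
  a1 u v = 0 /\ b2 u v = 0 /\ E2 f u v = 0 /\ E2 k1 u v = 0 /\ E2 k2 u v = 0 /\
  E2 al u v = 0 /\ E2 a2 u v = 0 /\ E2 b1 u v = 0.
Proof.
  pose proof smooth_k as Sk; pose proof smooth_lam as Sl.
  destruct (pd_smooth P) as (Sa1 & Sa2 & Sk1 & Sk2 & Sal & Sb1 & Sb2).
  destruct (pd_smooth_frame P) as (A & B & C & D).
  assert (A1 : forall u v, U u v -> a1 u v = 0).
  { intros a b Hab; rewrite (proj2 (lam_spec a b Hab)), E2_f_eq_0 by trivial; ring. }
  assert (B2 : forall u v, U u v -> b2 u v = 0).
  { intros a b Hab.
    destruct (pd_biconservative P a b Hab) as (_ & E).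
    rewrite E2_f_eq_0, Rmult_0_r in E by trivial.
    pose proof (pd_f P a b Hab).
    pose proof (pd_al P a b Hab).
    apply (Rmult_eq_reg_l (f a b * al a b)); [lra|].
    apply Rmult_integral_contrapositive; split; assumption. }
  intros Huv.
  destruct (pd_structure P u v Huv) as (_ & C2 & _ & C4 & C5 & _).
  rewrite A1, B2 in C2, C4, C5 by trivial.
  assert (Ef := E2_f_eq_0 u v Huv).
  assert (Ek1 : E2 k1 u v = 0) by lra.
  assert (Ek2 : E2 k2 u v = 0).
  { rewrite (dir_ext U HU y1 y2 k2 (fun u v => 2 * f u v - k1 u v)); trivial.
    - dirs; trivial; lra.
    - intros a b Hab; pose proof (pd_mean P a b Hab); lra. }
  assert (Eb : E2 b1 u v = 0).
  { rewrite (dir_ext U HU x1 x2 b2 (fun _ _ => 0)), dir_const in C5 by auto; lra. }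
  assert (Ep : E2 (E1 f) u v = 0).
  { rewrite <- second_derivative_f by trivial.
    rewrite (dir_ext U HU x1 x2 (E2 f) (fun _ _ => 0)); trivial; [apply dir_const|].
    exact E2_f_eq_0. }
  assert (El : E2 lam u v = 0).
  { pose proof (lam_df u v Huv) as L; rewrite Ef in L.
    apply (Rmult_eq_reg_l (E1 f u v)); [lra | apply E1_f_neq_0, Huv]. }
  repeat split; auto; try lra.
  rewrite (dir_ext U HU y1 y2 a2 (fun u v => - (lam u v * E1 f u v))); trivial.
  - dirs; trivial; rewrite El, Ep; ring.
  - intros a b Hab; apply lam_spec, Hab.
Qed.
End Rigidity.
Arguments principal_rigidity {eps U x1 x2 y1 y2 f k1 k2 al a1 a2 b1 b2}.

(** * Coordinates adapted to a closed form *)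

Definition box (u0 v0 r : R) (u v : R) : Prop := Rabs (u - u0) < r /\ Rabs (v - v0) < r.

Lemma box_open u0 v0 r : open2 (box u0 v0 r).
Proof.
  intros u v [Hu Hv].
  assert (Hd : 0 < Rmin (r - Rabs (u - u0)) (r - Rabs (v - v0))) by (apply Rmin_pos; lra).
  exists (mkposreal _ Hd); simpl; intros a b Ha Hb.
  pose proof (Rmin_l (r - Rabs (u - u0)) (r - Rabs (v - v0))).
  pose proof (Rmin_r (r - Rabs (u - u0)) (r - Rabs (v - v0))).
  split.
  - replace (a - u0) with ((a - u) + (u - u0)) by ring.
    apply (Rle_lt_trans _ _ _ (Rabs_triang _ _)); lra.
  - replace (b - v0) with ((b - v) + (v - v0)) by ring.
    apply (Rle_lt_trans _ _ _ (Rabs_triang _ _)); lra.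
Qed.

Lemma box_center u0 v0 r : 0 < r -> box u0 v0 r u0 v0.
Proof. intros Hr; unfold box; rewrite 2!Rminus_diag, Rabs_R0; split; trivial. Qed.

Lemma box_segment u0 v0 r u v z : box u0 v0 r u v -> Rmin u0 u <= z <= Rmax u0 u ->
  box u0 v0 r z v.
Proof.
  intros [Hu Hv] Hz; split; trivial; revert Hu Hz.
  unfold Rmin, Rmax, Rabs; destruct (Rle_dec u0 u);
    destruct (Rcase_abs (u - u0)), (Rcase_abs (z - u0)); lra.
Qed.

Lemma differentiable_fst u v : differentiable_pt_lim (fun a _ => a) u v 1 0.
Proof. apply (differentiable_pt_lim_proj1_0 (fun a => a)), derivable_pt_lim_id. Qed.

Lemma differentiable_snd u v : differentiable_pt_lim (fun _ b => b) u v 0 1.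
Proof.
  intros e; apply locally_2d_forall; intros a b.
  replace (b - v - _) with 0 by ring; rewrite Rabs_R0.
  apply Rmult_le_pos; [left; apply cond_pos|].
  apply (Rle_trans _ (Rabs (a - u))); [apply Rabs_pos | apply Rmax_l].
Qed.

Lemma smooth_fst U : open2 U -> smooth_on U (fun u _ => u).
Proof.
  intros HU; apply smooth_Cn; intros [|n].
  - intros u v _; split; trivial; apply continuity_2d_pt_id1.
  - apply (Cn_step U n _ (fun _ _ => 1) (fun _ _ => 0)); trivial; try (apply Cn_const; trivial).
    intros; apply differentiable_fst.
Qed.

Lemma smooth_snd U : open2 U -> smooth_on U (fun _ v => v).
Proof.
  intros HU; apply smooth_Cn; intros [|n].
  - intros u v _; split; trivial; apply continuity_2d_pt_id2.
  - apply (Cn_step U n _ (fun _ _ => 0) (fun _ _ => 1)); trivial; try (apply Cn_const; trivial).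
    intros; apply differentiable_snd.
Qed.

Lemma open_preimage U V x y : open2 U -> open2 V -> smooth_on U x -> smooth_on U y ->
  open2 (fun u v => U u v /\ V (x u v) (y u v)).
Proof.
  intros HU HV Hx Hy u v [Huv HVxy].
  destruct (HV _ _ HVxy) as [d Hd].
  pose proof (smooth_continuous U x u v Hx Huv d) as Cx.
  pose proof (smooth_continuous U y u v Hy Huv d) as Cy.
  generalize (locally_2d_and _ _ _ _ (HU u v Huv) (locally_2d_and _ _ _ _ Cx Cy)).
  apply locally_2d_impl, locally_2d_forall; intros a b (H1 & H2 & H3); split; auto.
Qed.

Lemma smooth_slice1 U g u v : smooth_on U g -> U u v -> continuous (fun z => g z v) u.
Proof.
  intros Hg Huv; apply (ex_derive_continuous (fun z => g z v) u), (smooth_derive1 U); trivial.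
Qed.

Lemma smooth_slice2 U g u v : smooth_on U g -> U u v -> continuous (fun z => g u z) v.
Proof.
  intros Hg Huv; apply (ex_derive_continuous (fun z => g u z) v), (smooth_derive2 U); trivial.
Qed.

(** Poincare's lemma on a box, by integration along two sides of a rectangle. *)
Lemma closed_form_primitive u0 v0 r w1 w2 :
  smooth_on (box u0 v0 r) w1 -> smooth_on (box u0 v0 r) w2 ->
  (forall u v, box u0 v0 r u v -> d2 w1 u v = d1 w2 u v) ->
  exists S : R -> R -> R, S u0 v0 = 0 /\
    forall u v, box u0 v0 r u v -> differentiable_pt_lim S u v (w1 u v) (w2 u v).
Proof.
  intros S1 S2 Hc.
  set (B := box u0 v0 r) in *.
  assert (HB : open2 B) by apply box_open.
  set (S := fun u v => RInt (fun z => w1 z v) u0 u + RInt (fun z => w2 u0 z) v0 v).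
  exists S; split; [unfold S; rewrite 2!RInt_point; apply Rplus_0_l|].
  intros u v Huv.
  assert (Seg : forall u v z, B u v -> Rmin u0 u <= z <= Rmax u0 u -> B z v)
    by (intros a b z; apply box_segment).
  assert (Seg2 : forall z, Rmin v0 v <= z <= Rmax v0 v -> B u0 z).
  { intros z Hz; destruct Huv as [Hu Hv].
    assert (Hb : box v0 u0 r v u0).
    { split; trivial; rewrite Rminus_diag, Rabs_R0.
      apply (Rle_lt_trans _ _ _ (Rabs_pos _) Hv). }
    destruct (box_segment v0 u0 r v u0 z Hb Hz); split; trivial. }
  assert (I1 : forall u v, B u v -> ex_RInt (fun z => w1 z v) u0 u).
  { intros a b Hab; apply @ex_RInt_continuous; intros z Hz.
    apply (smooth_slice1 B); trivial; apply (Seg a); trivial. }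
  assert (E1 : forall u v, B u v -> is_derive (fun a => RInt (fun z => w1 z v) u0 a) u (w1 u v)).
  { intros a b Hab; apply (is_derive_RInt (fun z => w1 z b) _ u0).
    - generalize (open_near1 B a b HB Hab); apply filter_imp; intros c Hc'.
      apply @RInt_correct, I1, Hc'.
    - apply (smooth_slice1 B); trivial. }
  assert (E2 : is_derive (fun b => RInt (fun z => w1 z b) u0 u) v (w2 u v - w2 u0 v)).
  { replace (w2 u v - w2 u0 v) with (RInt (fun z => d2 w1 z v) u0 u).
    - apply (is_derive_RInt_param (fun b z => w1 z b) u0 u v).
      + generalize (open_near2 B u v HB Huv); apply filter_imp; intros b Hb z Hz.
        apply (smooth_derive2 B); trivial; apply (Seg u); trivial.
      + intros z Hz.
        assert (C : continuity_2d_pt (d2 w1) z v).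
        { apply (smooth_continuous B); [apply smooth_d2; trivial | apply (Seg u); trivial]. }
        intros e; destruct (C e) as [d Hd]; exists d; intros a b Ha Hb; apply (Hd b a); trivial.
      + generalize (open_near2 B u v HB Huv); apply filter_imp; intros b Hb; apply I1, Hb.
    - apply is_RInt_unique.
      apply (is_RInt_ext (fun z => d1 w2 z v)).
      { intros z Hz; symmetry; apply Hc, (Seg u); trivial; lra. }
      apply (is_RInt_derive (fun z => w2 z v)).
      + intros z Hz; apply Derive_correct, (smooth_derive1 B); trivial; apply (Seg u); trivial.
      + intros z Hz; apply (smooth_slice1 B (d1 w2)); [apply smooth_d1; trivial|].
        apply (Seg u); trivial. }
  assert (E3 : is_derive (fun b => RInt (fun z => w2 u0 z) v0 b) v (w2 u0 v)).
  { apply (is_derive_RInt (fun z => w2 u0 z) _ v0).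
    - assert (HB' : B u0 v) by (apply (Seg u); trivial; split; [apply Rmin_l | apply Rmax_l]).
      generalize (open_near2 B u0 v HB HB'); apply filter_imp; intros c Hc'.
      apply @RInt_correct, @ex_RInt_continuous; intros z Hz.
      apply (smooth_slice2 B); trivial.
      destruct Hc' as [H1 H2].
      destruct (box_segment v0 u0 r c u0 z (conj H2 H1) Hz); split; trivial.
    - apply (smooth_slice2 B); trivial; apply (Seg u); trivial; split; [apply Rmin_l | apply Rmax_l]. }
  apply filterdiff_differentiable_pt_lim.
  apply (is_derive_filterdiff S u v w1 (w2 u v)).
  - apply (locally_2d_locally (fun a b => is_derive (fun z => S z b) a (w1 a b))).
    apply (open_nbhd B); trivial; intros a b Hab.
    replace (w1 a b) with (w1 a b + 0) by ring.
    apply @is_derive_plus; [apply E1, Hab | apply @is_derive_const].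
  - replace (w2 u v) with ((w2 u v - w2 u0 v) + w2 u0 v) by ring.
    apply @is_derive_plus; trivial.
  - apply continuity_2d_pt_filterlim, (smooth_continuous B); trivial.
Qed.

Lemma smooth_of_differentiable U g g1 g2 : open2 U ->
  (forall u v, U u v -> differentiable_pt_lim g u v (g1 u v) (g2 u v)) ->
  smooth_on U g1 -> smooth_on U g2 -> smooth_on U g.
Proof.
  intros HU Hd H1 H2; apply smooth_Cn; intros n; apply (Cn_le U (S n)); [auto with arith|].
  apply (Cn_step U n g g1 g2); trivial; apply smooth_Cn; trivial.
Qed.

(** The expansion of [S] to first order can be solved for the increment of [sig],
    because continuity first bounds that increment by a multiple of the
    increments of [s] and [t]. *)
Lemma implicit_differentiable S sig s1 t1 A B :
  differentiable_pt_lim S (sig s1 t1) t1 A B -> A <> 0 ->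
  continuity_2d_pt sig s1 t1 ->
  locally_2d (fun s t => S (sig s t) t = s) s1 t1 ->
  differentiable_pt_lim sig s1 t1 (/ A) (- (B / A)).
Proof.
  intros HS HA Hsig Hinv e.
  assert (hA : 0 < Rabs A) by (apply Rabs_pos_lt, HA).
  pose proof (Rabs_pos B) as hB; pose proof (cond_pos e) as he.
  set (C := 2 * (1 + Rabs A + Rabs B) / Rabs A).
  assert (hC : 0 < C) by (apply Rdiv_lt_0_compat; lra).
  assert (hd : 0 < Rmin (Rabs A / 2) (e * Rabs A / (C + 1))).
  { apply Rmin_pos; [lra|]; apply Rdiv_lt_0_compat; nra. }
  destruct (HS (mkposreal _ hd)) as [d Hd]; simpl in Hd.
  assert (Hd2 : locally_2d (fun _ t => Rabs (t - t1) < d) s1 t1)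
    by (exists d; trivial).
  generalize (locally_2d_and _ _ _ _ Hinv (locally_2d_and _ _ _ _ (Hsig d) Hd2)).
  apply locally_2d_impl, locally_2d_forall; intros s t (E & Hs & Ht).
  specialize (Hd _ _ Hs Ht).
  assert (E1 : S (sig s1 t1) t1 = s1) by (apply (locally_2d_singleton _ _ _ Hinv)).
  rewrite E, E1 in Hd.
  set (D := sig s t - sig s1 t1) in *; set (h := s - s1) in *; set (k := t - t1) in *.
  set (eta := Rmin _ _) in *.
  assert (H1 : eta <= Rabs A / 2) by apply Rmin_l.
  assert (H2 : eta <= e * Rabs A / (C + 1)) by apply Rmin_r.
  set (M := Rmax (Rabs h) (Rabs k)).
  assert (Mh : Rabs h <= M) by apply Rmax_l.
  assert (Mk : Rabs k <= M) by apply Rmax_r.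
  pose proof (Rabs_pos D) as pD; pose proof (Rabs_pos h) as ph; pose proof (Rabs_pos k) as pk.
  assert (Hmax : Rmax (Rabs D) (Rabs k) <= Rabs D + Rabs k) by (apply Rmax_lub; lra).
  (* A crude bound on the increment, then the estimate itself. *)
  assert (HD : Rabs D <= C * M).
  { assert (Q : Rabs A * Rabs D <= Rabs h + Rabs B * Rabs k + eta * (Rabs D + Rabs k)).
    { rewrite <- !Rabs_mult.
      replace (A * D) with (h - B * k - (h - (A * D + B * k))) by ring.
      apply (Rle_trans _ _ _ (Rabs_triang _ _)); rewrite Rabs_Ropp.
      apply Rplus_le_compat.
      - apply (Rle_trans _ _ _ (Rabs_triang _ _)); rewrite Rabs_Ropp; lra.
      - apply (Rle_trans _ _ _ Hd), Rmult_le_compat_l; lra. }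
    assert (Q2 : eta * (Rabs D + Rabs k) <= Rabs A / 2 * (Rabs D + Rabs k))
      by (apply Rmult_le_compat_r; lra).
    assert (Q3 : Rabs B * Rabs k <= Rabs B * M) by (apply Rmult_le_compat_l; lra).
    assert (Q4 : Rabs A * Rabs k <= Rabs A * M) by (apply Rmult_le_compat_l; lra).
    apply (Rmult_le_reg_l (Rabs A)); trivial.
    replace (Rabs A * (C * M)) with (2 * (1 + Rabs A + Rabs B) * M)
      by (unfold C; field; lra).
    assert (0 <= Rabs A * M) by (apply Rmult_le_pos; lra).
    lra. }
  replace (D - (/ A * h + - (B / A) * k)) with (- / A * (h - (A * D + B * k))) by (field; exact HA).
  rewrite Rabs_mult, Rabs_Ropp, Rabs_inv.
  apply (Rmult_le_reg_l (Rabs A)); trivial.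
  rewrite <- Rmult_assoc, Rinv_r, Rmult_1_l by lra.
  apply (Rle_trans _ _ _ Hd).
  assert (Hm : Rmax (Rabs D) (Rabs k) <= (C + 1) * M) by nra.
  apply (Rle_trans _ (eta * ((C + 1) * M))); [apply Rmult_le_compat_l; lra|].
  apply (Rle_trans _ (e * Rabs A / (C + 1) * ((C + 1) * M))).
  - apply Rmult_le_compat_r; [nra | trivial].
  - right; field; lra.
Qed.

Set Implicit Arguments.
(** [(X, Y)] maps [Rg] onto the part of [V] that [(S, T)] sends into [Rg].  With
    [V] larger than this image, [V] can be a box and needs no description in
    terms of [S]. *)
Record coordinate_change (Rg V : R -> R -> Prop) (X Y S T : R -> R -> R) : Prop := {
  cc_open_source : open2 Rg;
  cc_open_target : open2 V;
  cc_smooth_X : smooth_on Rg X;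
  cc_smooth_Y : smooth_on Rg Y;
  cc_smooth_S : smooth_on V S;
  cc_smooth_T : smooth_on V T;
  cc_maps : forall s t, Rg s t ->
    V (X s t) (Y s t) /\ S (X s t) (Y s t) = s /\ T (X s t) (Y s t) = t;
  cc_inverse : forall u v, V u v -> Rg (S u v) (T u v) ->
    X (S u v) (T u v) = u /\ Y (S u v) (T u v) = v
}.
Unset Implicit Arguments.

Lemma locally_2d_positive g x y : continuity_2d_pt g x y -> 0 < g x y ->
  locally_2d (fun u v => 0 < g u v) x y.
Proof.
  intros Hg H; destruct (Hg (mkposreal _ H)) as [d Hd]; simpl in Hd.
  exists d; intros a b Ha Hb; specialize (Hd a b Ha Hb).
  apply Rabs_lt_between in Hd; lra.
Qed.

(** Inversion of a primitive [S] that is strictly monotone in its first argument;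
    the sign of its derivative there is that of [W]. *)
Section Implicit.
Context (u0 v0 r W : R) (w1 w2 S : R -> R -> R) (hr : 0 < r).
Let B := box u0 v0 r.
Context (S1 : smooth_on B w1) (S2 : smooth_on B w2) (S0 : S u0 v0 = 0)
  (dS : forall u v, B u v -> differentiable_pt_lim S u v (w1 u v) (w2 u v))
  (Hw : forall u v, B u v -> 0 < w1 u v * W).

Let HB : open2 B := box_open u0 v0 r.

Let smooth_S : smooth_on B S.
Proof. apply (smooth_of_differentiable B S w1 w2); trivial. Qed.

Lemma primitive_increasing u u' v : B u v -> B u' v -> u < u' -> S u v * W < S u' v * W.
Proof.
  intros Hu Hu' Huu.
  assert (Seg : forall z, u <= z <= u' -> B z v).
  { intros z Hz; destruct Hu as [H1 H2], Hu' as [H1' _]; split; trivial.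
    apply Rabs_lt_between in H1; apply Rabs_lt_between in H1'; apply Rabs_lt_between; lra. }
  destruct (MVT_gen (fun z => S z v) u u' (fun z => w1 z v)) as (c & Hc & E);
    rewrite Rmin_left, Rmax_right in * by lra.
  - intros z Hz; apply (differentiable_partials S z v _ (w2 z v)), dS, Seg; lra.
  - intros z Hz; apply continuity_pt_filterlim, (smooth_slice1 B S); auto.
  - specialize (Hw c v (Seg c Hc)); nra.
Qed.

Lemma primitive_injective u u' v : B u v -> B u' v -> S u v = S u' v -> u = u'.
Proof.
  intros Hu Hu' E; destruct (Rtotal_order u u') as [H|[H|H]]; trivial.
  - pose proof (primitive_increasing u u' v Hu Hu' H); rewrite E in *; lra.
  - pose proof (primitive_increasing u' u v Hu' Hu H); rewrite E in *; lra.
Qed.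

Lemma slice_gap_continuous a s t : B a t -> continuity_2d_pt (fun s t => (s - S a t) * W) s t.
Proof.
  intros Ha; apply continuity_2d_pt_mult; [|apply continuity_2d_pt_const].
  apply continuity_2d_pt_minus; [apply continuity_2d_pt_id1|].
  apply (continuity_2d_comp S (fun _ _ => a) (fun _ t => t)).
  - apply (smooth_continuous B); trivial.
  - apply continuity_2d_pt_const.
  - apply continuity_2d_pt_id2.
Qed.

Lemma implicit_solution : exists (d : posreal) (sig : R -> R -> R), forall s t,
  box 0 v0 d s t -> B (sig s t) t /\ S (sig s t) t = s.
Proof.
  assert (Bv : forall a, Rabs (a - u0) < r -> B a v0).
  { intros a Ha; split; trivial; rewrite Rminus_diag, Rabs_R0; exact hr. }
  assert (Bl : B (u0 - r / 2) v0) by (apply Bv, Rabs_lt_between; lra).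
  assert (Bh : B (u0 + r / 2) v0) by (apply Bv, Rabs_lt_between; lra).
  assert (B0 : B u0 v0) by (apply box_center, hr).
  pose proof (primitive_increasing _ _ _ Bl B0 ltac:(lra)) as Ll.
  pose proof (primitive_increasing _ _ _ B0 Bh ltac:(lra)) as Lh.
  rewrite S0 in Ll, Lh.
  assert (Cl := locally_2d_positive _ 0 v0 (slice_gap_continuous _ 0 v0 Bl) ltac:(lra)).
  assert (Ch := locally_2d_positive _ 0 v0
    (continuity_2d_pt_opp _ _ _ (slice_gap_continuous _ 0 v0 Bh)) ltac:(lra)).
  destruct (locally_2d_and _ _ _ _ Cl Ch) as [d Hd].
  assert (hd : 0 < Rmin d r) by (apply Rmin_pos; [apply cond_pos | exact hr]).
  exists (mkposreal _ hd); simpl.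
  assert (Ex : forall p : R * R, exists u, box 0 v0 (Rmin d r) (fst p) (snd p) ->
    B u (snd p) /\ S u (snd p) = fst p).
  { intros [s t]; simpl.
    destruct (Rlt_dec (Rabs (s - 0)) (Rmin d r)) as [Hs|Hs];
      [|exists 0; intros [H _]; contradiction].
    destruct (Rlt_dec (Rabs (t - v0)) (Rmin d r)) as [Ht|Ht];
      [|exists 0; intros [_ H]; contradiction].
    pose proof (Rmin_l d r); pose proof (Rmin_r d r).
    destruct (Hd s t) as [Hl Hh]; [lra | lra |].
    assert (Bt : forall a, u0 - r / 2 <= a <= u0 + r / 2 -> B a t).
    { intros a Ha; split; [apply Rabs_lt_between; lra | lra]. }
    destruct (Ranalysis5.IVT_interv (fun u => (S u t - s) * W) (u0 - r / 2) (u0 + r / 2))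
      as (z & Hz & Ez); try lra.
    - intros a Ha; apply continuity_pt_mult; [|apply continuity_pt_const; intros ? ?; reflexivity].
      apply continuity_pt_minus; [|apply continuity_pt_const; intros ? ?; reflexivity].
      apply continuity_pt_filterlim, (smooth_slice1 B S); trivial; apply Bt, Ha.
    - exists z; intros _; split; [apply Bt, Hz|].
      specialize (Hw z t (Bt z Hz)).
      assert (W <> 0) by (intros E; rewrite E in Hw; lra).
      apply (Rmult_eq_reg_r W); trivial; lra. }
  destruct (functional_choice _ Ex) as [g Hg].
  exists (fun s t => g (s, t)); intros s t; apply (Hg (s, t)).
Qed.

Lemma implicit_coordinates : exists (d : posreal) (sig : R -> R -> R),
  sig 0 v0 = u0 /\
  coordinate_change (box 0 v0 d) B sig (fun _ t => t) S (fun _ v => v).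
Proof.
  destruct implicit_solution as (d & sig & H); exists d, sig.
  set (Rg := box 0 v0 d) in *.
  assert (HR : open2 Rg) by apply box_open.
  assert (B0 : B u0 v0) by (apply box_center, hr).
  assert (R0 : Rg 0 v0) by (apply box_center, cond_pos).
  assert (Inv : forall u v, B u v -> Rg (S u v) v -> sig (S u v) v = u).
  { intros u v Huv HR'; destruct (H _ _ HR') as [H1 H2].
    apply (primitive_injective _ _ v); trivial. }
  assert (Cont : forall s t, Rg s t -> continuity_2d_pt sig s t).
  { intros s t Hst e; destruct (H s t Hst) as [[H1 H1'] H2].
    assert (he : 0 < Rmin e (r - Rabs (sig s t - u0)) / 2).
    { apply Rdiv_lt_0_compat; [|lra]; apply Rmin_pos; [apply cond_pos | lra]. }
    set (eta := Rmin e (r - Rabs (sig s t - u0)) / 2) in *.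
    assert (He1 : 2 * eta <= e) by (unfold eta; pose proof (Rmin_l e (r - Rabs (sig s t - u0))); lra).
    assert (He2 : 2 * eta <= r - Rabs (sig s t - u0))
      by (unfold eta; pose proof (Rmin_r e (r - Rabs (sig s t - u0))); lra).
    assert (Bl : forall b, Rabs (b - v0) < r -> B (sig s t - eta) b).
    { intros b Hb; split; trivial.
      replace (sig s t - eta - u0) with ((sig s t - u0) + - eta) by ring.
      apply (Rle_lt_trans _ _ _ (Rabs_triang _ _)); rewrite Rabs_Ropp, (Rabs_pos_eq eta); lra. }
    assert (Bh : forall b, Rabs (b - v0) < r -> B (sig s t + eta) b).
    { intros b Hb; split; trivial.
      replace (sig s t + eta - u0) with ((sig s t - u0) + eta) by ring.
      apply (Rle_lt_trans _ _ _ (Rabs_triang _ _)); rewrite (Rabs_pos_eq eta); lra. }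
    assert (Bm : B (sig s t) t) by (split; trivial).
    pose proof (primitive_increasing _ _ t (Bl t H1') Bm ltac:(lra)) as Ll.
    pose proof (primitive_increasing _ _ t Bm (Bh t H1') ltac:(lra)) as Lh.
    rewrite H2 in Ll, Lh.
    assert (Cl := locally_2d_positive _ s t (slice_gap_continuous _ s t (Bl t H1')) ltac:(lra)).
    assert (Ch := locally_2d_positive _ s t
      (continuity_2d_pt_opp _ _ _ (slice_gap_continuous _ s t (Bh t H1'))) ltac:(lra)).
    generalize (locally_2d_and _ _ _ _ (HR s t Hst) (locally_2d_and _ _ _ _ Cl Ch)).
    apply locally_2d_impl, locally_2d_forall; intros s' t' (Hst' & Hl & Hh).
    destruct (H s' t' Hst') as [[G1 G1'] G2].
    assert (Bm' : B (sig s' t') t') by (split; trivial).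
    apply Rabs_lt_between; split.
    - apply Rnot_le_lt; intros Hle.
      pose proof (primitive_increasing _ _ t' Bm' (Bl t' G1') ltac:(lra)); rewrite G2 in *; lra.
    - apply Rnot_le_lt; intros Hle.
      pose proof (primitive_increasing _ _ t' (Bh t' G1') Bm' ltac:(lra)); rewrite G2 in *; lra. }
  assert (w0 : forall u v, B u v -> w1 u v <> 0).
  { intros u v Huv E; specialize (Hw u v Huv); rewrite E in Hw; lra. }
  assert (Diff : forall s t, Rg s t -> differentiable_pt_lim sig s t
    (/ w1 (sig s t) t) (- (w2 (sig s t) t / w1 (sig s t) t))).
  { intros s t Hst; destruct (H s t Hst) as [H1 H2].
    apply (implicit_differentiable S); auto.
    apply (open_nbhd Rg); trivial; intros a b Hab; apply H, Hab. }
  assert (Csig : forall n, Cn Rg n sig).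
  { assert (I1 : smooth_on B (fun u v => / w1 u v)) by (apply smooth_inv; trivial).
    assert (I2 : smooth_on B (fun u v => - (w2 u v / w1 u v)))
      by (apply smooth_opp, smooth_div; trivial).
    intros n; induction n as [|n IH].
    - intros s t Hst; split; trivial; apply Cont, Hst.
    - assert (Ct : Cn Rg n (fun _ t => t)) by (apply smooth_Cn, smooth_snd, HR).
      assert (HRB : forall s t, Rg s t -> B (sig s t) t) by (intros; apply H; trivial).
      apply (Cn_step Rg n sig _ _ HR Diff).
      + apply (Cn_comp Rg B n (fun u v => / w1 u v) sig (fun _ t => t)); trivial.
        apply smooth_Cn, I1.
      + apply (Cn_comp Rg B n (fun u v => - (w2 u v / w1 u v)) sig (fun _ t => t)); trivial.
        apply smooth_Cn, I2. }
  split.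
  - transitivity (sig (S u0 v0) v0); [rewrite S0; reflexivity|].
    apply Inv; trivial; rewrite S0; exact R0.
  - constructor; trivial.
    + apply smooth_Cn, Csig.
    + apply smooth_snd, HR.
    + apply smooth_snd, HB.
    + intros s t Hst; destruct (H s t Hst); split; [|split]; trivial.
    + intros u v Huv HR'; split; auto.
Qed.
End Implicit.

Lemma differentiable_swap g u v l1 l2 : differentiable_pt_lim g v u l1 l2 ->
  differentiable_pt_lim (fun a b => g b a) u v l2 l1.
Proof.
  intros Hg; pose proof (differentiable_pt_lim_comp g (fun _ b => b) (fun a _ => a) u v
    l1 l2 0 1 1 0 Hg (differentiable_snd u v) (differentiable_fst u v)) as D.
  replace (l1 * 0 + l2 * 1) with l2 in D by ring.
  replace (l1 * 1 + l2 * 0) with l1 in D by ring.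
  exact D.
Qed.

Lemma smooth_swap U g : open2 (fun u v => U v u) -> open2 U -> smooth_on U g ->
  smooth_on (fun u v => U v u) (fun u v => g v u).
Proof.
  intros H1 H2 Hg; apply (smooth_comp _ U g (fun _ v => v) (fun u _ => u)); trivial.
  - apply smooth_snd, H1.
  - apply smooth_fst, H1.
Qed.

Lemma open_swap U : open2 U -> open2 (fun u v => U v u).
Proof.
  intros HU u v Huv; destruct (HU v u Huv) as [d Hd].
  exists d; intros a b Ha Hb; apply Hd; trivial.
Qed.

Lemma closed_form_coordinates_graph U w1 w2 u0 v0 : open2 U -> smooth_on U w1 -> smooth_on U w2 ->
  (forall u v, U u v -> d2 w1 u v = d1 w2 u v) -> U u0 v0 -> w1 u0 v0 <> 0 ->
  exists (d : posreal) (t0 : R) (V : R -> R -> Prop) (X Y S T : R -> R -> R),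
    coordinate_change (box 0 t0 d) V X Y S T /\ X 0 t0 = u0 /\ Y 0 t0 = v0 /\
    forall u v, V u v -> U u v /\ differentiable_pt_lim S u v (w1 u v) (w2 u v).
Proof.
  intros HU S1 S2 Hc H0 Hn.
  assert (C1 := smooth_continuous U w1 u0 v0 S1 H0).
  assert (P : 0 < w1 u0 v0 * w1 u0 v0) by nra.
  assert (CW : continuity_2d_pt (fun u v => w1 u v * w1 u0 v0) u0 v0)
    by (apply continuity_2d_pt_mult; [exact C1 | apply continuity_2d_pt_const]).
  destruct (locally_2d_and _ _ _ _ (HU u0 v0 H0) (locally_2d_positive _ _ _ CW P)) as [r Hr].
  assert (HB : forall u v, box u0 v0 r u v -> U u v /\ 0 < w1 u v * w1 u0 v0).
  { intros u v [Hu Hv]; apply Hr; trivial. }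
  assert (S1' : smooth_on (box u0 v0 r) w1) by (apply (smooth_subset U); trivial; apply HB).
  assert (S2' : smooth_on (box u0 v0 r) w2) by (apply (smooth_subset U); trivial; apply HB).
  destruct (closed_form_primitive u0 v0 r w1 w2 S1' S2') as (S & SO & dS).
  { intros u v Huv; apply Hc, HB, Huv. }
  destruct (implicit_coordinates u0 v0 r (w1 u0 v0) w1 w2 S (cond_pos r) S1' S2' SO dS)
    as (d & sig & E & CC).
  { intros u v Huv; apply HB, Huv. }
  exists d, v0, (box u0 v0 r), sig, (fun _ t => t), S, (fun _ v => v).
  split; [exact CC|]; split; [exact E|]; split; [reflexivity|].
  intros u v Huv; split; [apply HB, Huv | apply dS, Huv].
Qed.

(** The primitive of the form has a nonzero derivative along one of the two axes,
    so that the other coordinate completes it to a coordinate system. *)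
Lemma closed_form_coordinates U w1 w2 u0 v0 : open2 U -> smooth_on U w1 -> smooth_on U w2 ->
  (forall u v, U u v -> d2 w1 u v = d1 w2 u v) -> U u0 v0 -> w1 u0 v0 <> 0 \/ w2 u0 v0 <> 0 ->
  exists (d : posreal) (t0 : R) (V : R -> R -> Prop) (X Y S T : R -> R -> R),
    coordinate_change (box 0 t0 d) V X Y S T /\ X 0 t0 = u0 /\ Y 0 t0 = v0 /\
    forall u v, V u v -> U u v /\ differentiable_pt_lim S u v (w1 u v) (w2 u v).
Proof.
  intros HU S1 S2 Hc H0 [Hn|Hn].
  - apply closed_form_coordinates_graph; trivial.
  - assert (HU' := open_swap U HU).
    destruct (closed_form_coordinates_graph (fun u v => U v u) (fun u v => w2 v u)
      (fun u v => w1 v u) v0 u0) as (d & t0 & V & X & Y & S & T & CC & EX & EY & HV); trivial.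
    + apply smooth_swap; trivial.
    + apply smooth_swap; trivial.
    + intros u v Huv; symmetry; apply (Hc v u Huv).
    + destruct CC as [c1 c2 c3 c4 c5 c6 c7 c8].
      exists d, t0, (fun u v => V v u), Y, X, (fun u v => S v u), (fun u v => T v u).
      assert (HV' := open_swap V c2).
      split; [|split; [|split]]; trivial.
      * constructor; trivial.
        -- apply smooth_swap; trivial.
        -- apply smooth_swap; trivial.
        -- intros u v Huv HR; destruct (c8 v u Huv HR); split; trivial.
      * intros u v Huv; destruct (HV v u Huv) as [H1 H2]; split; trivial.
        apply differentiable_swap, H2.
Qed.

(** ** Local coordinates on a surface *)

Lemma coordinate_change_local_coordinates (M : surface) c Rg V X Y S T :
  coordinate_change Rg V X Y S T -> (forall u v, V u v -> pdom (chart M c) u v) ->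
  local_coordinates M (Param M Rg (fun s t => chart M c (X s t) (Y s t))).
Proof.
  intros [HR HV SX SY SS ST Hm Hi] Hdom.
  assert (Inj : forall u v u' v', V u v -> V u' v' -> chart M c u v = chart M c u' v' ->
    u = u' /\ v = v') by (intros; apply (chart_param M c); auto).
  split; [split|].
  - exact HR.
  - simpl; intros s t s' t' H1 H2 E.
    destruct (Hm s t H1) as (A & B & C), (Hm s' t' H2) as (A' & B' & C').
    destruct (Inj _ _ _ _ A A' E) as [E1 E2].
    rewrite E1, E2 in B, C; split; congruence.
  - intros d; split.
    + destruct (chart_compatible M c d) as (HO & g & h & Sg & Sh & Hgh).
      assert (HE : forall s t, overlap (Param M Rg (fun s t => chart M c (X s t) (Y s t))) (chart M d) s t
        <-> Rg s t /\ overlap (chart M c) (chart M d) (X s t) (Y s t)).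
      { intros s t; unfold overlap; simpl; split.
        - intros [H1 H2]; split; trivial; split; trivial; apply Hdom, Hm, H1.
        - intros [H1 [_ H2]]; split; trivial. }
      assert (HO' := open_preimage Rg _ X Y HR HO SX SY).
      assert (HO2 : open2 (overlap (Param M Rg (fun s t => chart M c (X s t) (Y s t))) (chart M d))).
      { intros s t Hst; generalize (HO' s t (proj1 (HE s t) Hst)).
        apply locally_2d_impl, locally_2d_forall; intros; apply HE; trivial. }
      split; trivial.
      exists (fun s t => g (X s t) (Y s t)), (fun s t => h (X s t) (Y s t)).
      assert (SX' := smooth_subset Rg _ X (fun s t H => proj1 (proj1 (HE s t) H)) SX).
      assert (SY' := smooth_subset Rg _ Y (fun s t H => proj1 (proj1 (HE s t) H)) SY).
      assert (HM := fun s t H => proj2 (proj1 (HE s t) H)).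
      split; [|split].
      * exact (smooth_comp _ _ g X Y HO2 HO HM Sg SX' SY').
      * exact (smooth_comp _ _ h X Y HO2 HO HM Sh SX' SY').
      * intros s t Hst; apply (Hgh _ _ (HM s t Hst)).
    + destruct (chart_compatible M d c) as (HO & g & h & Sg & Sh & Hgh).
      set (Q := fun u v => V u v /\ Rg (S u v) (T u v)).
      assert (HQ : open2 Q) by (apply open_preimage; trivial).
      assert (HE : forall u v, overlap (chart M d) (Param M Rg (fun s t => chart M c (X s t) (Y s t))) u v
        <-> overlap (chart M d) (chart M c) u v /\ Q (g u v) (h u v)).
      { intros u v; unfold overlap at 1; simpl; split.
        - intros (H1 & s & t & H2 & E).
          destruct (Hm s t H2) as (A & B & C).
          assert (Ov : overlap (chart M d) (chart M c) u v).
          { split; trivial; exists (X s t), (Y s t); split; trivial; apply Hdom, A. }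
          split; trivial.
          destruct (Hgh u v Ov) as [G1 G2].
          destruct (chart_param M c) as [_ I].
          destruct (I (g u v) (h u v) (X s t) (Y s t) G1 (Hdom _ _ A)) as [E1 E2].
          { rewrite G2, E; reflexivity. }
          unfold Q; rewrite E1, E2, B, C; split; trivial.
        - intros (Ov & H1 & H2); split; [apply Ov|].
          exists (S (g u v) (h u v)), (T (g u v) (h u v)); split; trivial.
          destruct (Hi _ _ H1 H2) as [-> ->]; apply Hgh, Ov. }
      assert (HO' := open_preimage _ _ g h HO HQ Sg Sh).
      assert (HO2 : open2 (overlap (chart M d) (Param M Rg (fun s t => chart M c (X s t) (Y s t))))).
      { intros s t Hst; generalize (HO' s t (proj1 (HE s t) Hst)).
        apply locally_2d_impl, locally_2d_forall; intros; apply HE; trivial. }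
      split; trivial.
      exists (fun u v => S (g u v) (h u v)), (fun u v => T (g u v) (h u v)).
      assert (Sg' := smooth_subset _ _ g (fun s t H => proj1 (proj1 (HE s t) H)) Sg).
      assert (Sh' := smooth_subset _ _ h (fun s t H => proj1 (proj1 (HE s t) H)) Sh).
      assert (HM := fun s t H => proj1 (proj2 (proj1 (HE s t) H))).
      split; [|split].
      * exact (smooth_comp _ _ S g h HO2 HV HM SS Sg' Sh').
      * exact (smooth_comp _ _ T g h HO2 HV HM ST Sg' Sh').
      * intros u v Huv; simpl; destruct (proj1 (HE u v) Huv) as (Ov & H1 & H2).
        split; trivial; destruct (Hi _ _ H1 H2) as [-> ->]; apply Hgh, Ov.
Qed.

(** The derivatives of [X] and [Y] enter only through those of [S (X, Y)], which
    equals [s]. *)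
Lemma coordinate_change_derivatives Rg V X Y S T w1 w2 h e s t :
  coordinate_change Rg V X Y S T ->
  (forall u v, V u v -> differentiable_pt_lim S u v (w1 u v) (w2 u v)) ->
  (forall u v, V u v -> differentiable_pt_lim h u v (e u v * w1 u v) (e u v * w2 u v)) ->
  Rg s t ->
  is_derive (fun z => h (X z t) (Y z t)) s (e (X s t) (Y s t)) /\
  is_derive (fun z => h (X s z) (Y s z)) t 0.
Proof.
  intros [HR HV SX SY SS ST Hm Hi] dS dh Hst.
  destruct (Hm s t Hst) as (A & _).
  pose proof (smooth_differentiable Rg X s t HR SX Hst) as dX.
  pose proof (smooth_differentiable Rg Y s t HR SY Hst) as dY.
  pose proof (differentiable_pt_lim_comp _ _ _ _ _ _ _ _ _ _ _ (dS _ _ A) dX dY) as D1.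
  pose proof (differentiable_pt_lim_comp _ _ _ _ _ _ _ _ _ _ _ (dh _ _ A) dX dY) as D2.
  assert (D3 : differentiable_pt_lim (fun s t => S (X s t) (Y s t)) s t 1 0).
  { apply (differentiable_pt_lim_ext (fun s _ => s)); [|apply differentiable_fst].
    apply (open_nbhd Rg); trivial; intros a b Hab; symmetry; apply Hm, Hab. }
  destruct (differentiable_d1_d2 _ _ _ _ _ D1) as [E1 E2].
  destruct (differentiable_d1_d2 _ _ _ _ _ D3) as [F1 F2].
  rewrite E1 in F1; rewrite E2 in F2.
  set (W1 := w1 (X s t) (Y s t)) in *; set (W2 := w2 (X s t) (Y s t)) in *.
  set (E := e (X s t) (Y s t)) in *.
  replace (E * W1 * d1 X s t + E * W2 * d1 Y s t) with E in D2
    by (transitivity (E * (W1 * d1 X s t + W2 * d1 Y s t)); [rewrite F1|]; ring).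
  replace (E * W1 * d2 X s t + E * W2 * d2 Y s t) with 0 in D2
    by (transitivity (E * (W1 * d2 X s t + W2 * d2 Y s t)); [rewrite F2|]; ring).
  apply (differentiable_partials _ _ _ _ _ D2).
Qed.

(** * Biconservative surfaces *)

(** The derivatives of the pair [(f, K)] in any two directions lie in the kernel of
    [dW], which is a line. *)
Lemma weingarten_jacobian U f K W x1 x2 y1 y2 u v : open2 U ->
  smooth_on U f -> smooth_on U K -> smooth_on (fun _ _ => True) W ->
  (forall x y, d1 W x y <> 0 \/ d2 W x y <> 0) ->
  (forall u v, U u v -> W (f u v) (K u v) = 0) -> U u v ->
  dir x1 x2 f u v * dir y1 y2 K u v = dir y1 y2 f u v * dir x1 x2 K u v.
Proof.
  intros HU Sf SK SW HW H0 Huv.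
  assert (HT : open2 (fun _ _ => True)) by (intros a b _; apply locally_2d_forall; trivial).
  assert (D := differentiable_pt_lim_comp _ _ _ _ _ _ _ _ _ _ _
    (smooth_differentiable _ W (f u v) (K u v) HT SW I)
    (smooth_differentiable U f u v HU Sf Huv) (smooth_differentiable U K u v HU SK Huv)).
  assert (C : forall z1 z2, d1 W (f u v) (K u v) * dir z1 z2 f u v
    + d2 W (f u v) (K u v) * dir z1 z2 K u v = 0).
  { intros z1 z2.
    transitivity (dir z1 z2 (fun u v => W (f u v) (K u v)) u v).
    - rewrite (dir_differentiable z1 z2 _ u v _ _ D); unfold dir; ring.
    - rewrite (dir_ext U HU z1 z2 _ (fun _ _ => 0)) by trivial; apply dir_const. }
  pose proof (C x1 x2) as C1; pose proof (C y1 y2) as C2.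
  destruct (HW (f u v) (K u v)) as [N|N].
  - apply (Rmult_eq_reg_l (d1 W (f u v) (K u v))); trivial.
    assert (Z1 := f_equal (Rmult (dir y1 y2 K u v)) C1).
    assert (Z2 := f_equal (Rmult (dir x1 x2 K u v)) C2); cbv beta in Z1, Z2; lra.
  - apply (Rmult_eq_reg_l (d2 W (f u v) (K u v))); trivial.
    assert (Z1 := f_equal (Rmult (dir y1 y2 f u v)) C1).
    assert (Z2 := f_equal (Rmult (dir x1 x2 f u v)) C2); cbv beta in Z1, Z2; lra.
Qed.

(** For the form [w] dual to the first field [X] of a frame [(X, Y)],
    [dw (X, Y) = - w ([X, Y])], and the bracket is a multiple of [Y]. *)
Lemma dual_form_closed U x1 x2 y1 y2 a2 : open2 U ->
  smooth_on U x1 -> smooth_on U x2 -> smooth_on U y1 -> smooth_on U y2 ->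
  (forall u v, U u v -> x1 u v * y2 u v - x2 u v * y1 u v <> 0) ->
  (forall u v, U u v ->
    dir x1 x2 y1 u v - dir y1 y2 x1 u v = a2 u v * y1 u v /\
    dir x1 x2 y2 u v - dir y1 y2 x2 u v = a2 u v * y2 u v) ->
  exists w1 w2, smooth_on U w1 /\ smooth_on U w2 /\
    (forall u v, U u v -> d2 w1 u v = d1 w2 u v /\
      w1 u v * x1 u v + w2 u v * x2 u v = 1 /\ w1 u v * y1 u v + w2 u v * y2 u v = 0).
Proof.
  intros HU X1 X2 Y1 Y2 Hdet Hbr.
  set (D := fun u v => x1 u v * y2 u v - x2 u v * y1 u v) in *.
  assert (SD : smooth_on U D) by (apply smooth_minus; trivial; apply smooth_mult; trivial).
  set (w1 := fun u v => y2 u v / D u v); set (w2 := fun u v => - y1 u v / D u v).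
  assert (S1 : smooth_on U w1) by (apply smooth_div; trivial).
  assert (S2 : smooth_on U w2).
  { apply (smooth_div U (fun u v => - y1 u v)); trivial; apply smooth_opp; trivial. }
  assert (E1 : forall u v, U u v -> w1 u v * x1 u v + w2 u v * x2 u v = 1).
  { intros u v Huv; unfold w1, w2, D; field; apply (Hdet u v Huv). }
  assert (E2 : forall u v, U u v -> w1 u v * y1 u v + w2 u v * y2 u v = 0).
  { intros u v Huv; unfold w1, w2, D; field; apply (Hdet u v Huv). }
  exists w1, w2; split; trivial; split; trivial; intros u v Huv; split; auto.
  assert (F1 := dir_const_on U HU y1 y2 _ 1 u v E1 Huv).
  assert (F2 := dir_const_on U HU x1 x2 _ 0 u v E2 Huv).
  destruct (Hbr u v Huv) as [B1 B2].
  rewrite (dir_plus U HU), 2!(dir_mult U HU) in F1 by (trivial; apply smooth_mult; trivial).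
  rewrite (dir_plus U HU), 2!(dir_mult U HU) in F2 by (trivial; apply smooth_mult; trivial).
  apply (Rmult_eq_reg_l (D u v)); [|apply (Hdet u v Huv)].
  specialize (E2 u v Huv).
  assert (G : w1 u v * (a2 u v * y1 u v) + w2 u v * (a2 u v * y2 u v) = 0).
  { transitivity (a2 u v * (w1 u v * y1 u v + w2 u v * y2 u v)); [ring | rewrite E2; ring]. }
  rewrite <- B1, <- B2 in G.
  unfold dir at 1 3 in F1; unfold dir at 1 3 in F2; unfold D; lra.
Qed.

Arguments frame_smooth {eps M phi f E1 E2 E3 E4 k1 k2}.
Arguments frame_tangent {eps M phi f E1 E2 E3 E4 k1 k2}.
Arguments frame_orthonormal {eps M phi f E1 E2 E3 E4 k1 k2}.
Arguments frame_E3 {eps M phi f E1 E2 E3 E4 k1 k2}.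
Arguments frame_E4 {eps M phi f E1 E2 E3 E4 k1 k2}.
Arguments frame_principal {eps M phi f E1 E2 E3 E4 k1 k2}.
Arguments frame_alpha {eps M phi E1 E2 E3 E4 alpha a1 a2 b1 b2}.
Arguments frame_a {eps M phi E1 E2 E3 E4 alpha a1 a2 b1 b2}.
Arguments frame_b {eps M phi E1 E2 E3 E4 alpha a1 a2 b1 b2}.

Section Charts.
Context (eps : R) (M : surface) (phi : M -> vec)
  (f K : M -> R) (E1 E2 E3 E4 : M -> vec) (k1 k2 alpha a1 a2 b1 b2 : M -> R)
  (hphi : immersed_surface eps M phi)
  (hf : is_mean_curvature eps M phi f)
  (hE : adapted_frame eps M phi f E1 E2 E3 E4 k1 k2)
  (hfun : frame_functions eps M phi E1 E2 E3 E4 alpha a1 a2 b1 b2)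
  (hncmc : non_cmc eps M phi f)
  (hK : is_gauss_curvature eps M phi K)
  (hbic : biconservative eps M phi)
  (hW : W_surface M f K)
  (hflat : flat_normal_bundle eps M phi)
  (hfK : forall p, 3 * f p ^ 2 + K p - eps <> 0)
  (hA4 : shape_nowhere_zero eps M phi E4)
  (hE2 : nowhere_geodesic eps M phi E2).

Section OneChart.
Context (c : nat).
Let U := pdom (chart M c).
Let psi := pull phi (chart M c).
Let e1 := pull E1 (chart M c).
Let e2 := pull E2 (chart M c).
Let e3 := pull E3 (chart M c).
Let e4 := pull E4 (chart M c).
Let H := mean_curvature_vector eps psi.
Let fc := pull f (chart M c).

Let HU : open2 U := proj1 (chart_param M c).
Let Hpsi : vsmooth_on U psi := proj1 (proj2 hphi c).
Let Hsf u v (_ : U u v) : space_form eps (psi u v) := proj1 hphi (chart M c u v).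
Let T1 u v (Huv : U u v) : is_tangent psi (e1 u v) u v :=
  proj1 (frame_tangent hE c u v Huv).
Let T2 u v (Huv : U u v) : is_tangent psi (e2 u v) u v :=
  proj2 (frame_tangent hE c u v Huv).
Let ON u v : ip eps (e1 u v) (e1 u v) = 1 /\ ip eps (e2 u v) (e2 u v) = 1 /\
    ip eps (e1 u v) (e2 u v) = 0 :=
  frame_orthonormal hE (chart M c u v).
Let Hg u v (Huv : U u v) : gdet eps psi u v <> 0 :=
  gdet_neq_0 eps psi u v _ _ (T1 u v Huv) (T2 u v Huv) (proj1 (ON u v))
    (proj1 (proj2 (ON u v))) (proj2 (proj2 (ON u v))).

(** For [eps < 0] the ambient product is indefinite, and positivity holds because
    normal vectors are tangent to the space form. *)
Lemma mean_curvature_positive u v : U u v ->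
  0 < ip eps (H u v) (H u v) /\ 0 < fc u v /\ fc u v * fc u v = ip eps (H u v) (H u v).
Proof.
  intros Huv; destruct (hncmc c u v Huv) as [HH _].
  assert (P : 0 < ip eps (H u v) (H u v)).
  { apply (tangent_positive eps (psi u v)); auto.
    apply (mean_curvature_vector_is_normal U HU eps psi Hpsi Hg Hsf u v Huv). }
  assert (Ef : fc u v = sqrt (ip eps (H u v) (H u v))) by apply (hf c u v Huv).
  rewrite Ef; split; trivial; split; [apply sqrt_lt_R0, P | apply sqrt_sqrt; lra].
Qed.

Lemma mean_curvature_smooth : smooth_on U fc.
Proof.
  apply (smooth_ext U (fun u v => sqrt (ip eps (H u v) (H u v)))); trivial.
  - intros u v Huv; symmetry; apply (hf c u v Huv).
  - assert (SH := vsmooth_mean_curvature_vector U HU eps psi Hpsi Hg).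
    apply smooth_sqrt; trivial; [apply smooth_ip; trivial | apply mean_curvature_positive].
Qed.

Lemma mean_curvature_direction u v : U u v -> H u v = vscal (fc u v) (e3 u v).
Proof.
  intros Huv; destruct (mean_curvature_positive u v Huv) as (_ & P & _).
  assert (E : e3 u v = vscal (/ fc u v) (H u v)) by apply (frame_E3 hE c u v Huv).
  rewrite E; apply vec_ext; intros i; unfold vscal; field; lra.
Qed.

Lemma chart_darboux_frame : darboux_frame eps psi U e1 e2 e3 e4.
Proof.
  destruct (frame_smooth hE c) as (S1 & S2 & S4).
  assert (E : forall u v, U u v -> e3 u v = vscal (/ fc u v) (H u v))
    by (intros u v Huv; apply (frame_E3 hE c u v Huv)).
  assert (F4 : forall u v, U u v -> is_normal eps psi (e4 u v) u v /\
    ip eps (e4 u v) (e4 u v) = 1 /\ ip eps (e3 u v) (e4 u v) = 0)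
    by (intros u v Huv; apply (frame_E4 hE c u v Huv)).
  constructor; trivial; try (intros u v Huv; apply ON); try (intros u v Huv; apply F4, Huv).
  - apply (vsmooth_ext U HU (fun u v => vscal (/ fc u v) (H u v))).
    + intros; symmetry; auto.
    + apply vsmooth_scal; trivial.
      * apply smooth_inv; trivial; [apply mean_curvature_smooth|].
        intros u v Huv; destruct (mean_curvature_positive u v Huv) as (_ & P & _); lra.
      * apply vsmooth_mean_curvature_vector; trivial.
  - intros u v Huv; rewrite E by trivial; apply normal_scal.
    apply (mean_curvature_vector_is_normal U HU eps psi Hpsi Hg Hsf u v Huv).
  - intros u v Huv; rewrite E by trivial; ip_expand.
    destruct (mean_curvature_positive u v Huv) as (_ & P & <-); field; lra.
Qed.

Let F := chart_darboux_frame.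
Let N3 := df_n3 F.
Let N4 := df_n4 F.
Let I33 := df_33 F.
Let I34 := df_34 F.

Let x1 u v := comp1 eps psi (e1 u v) u v.
Let x2 u v := comp2 eps psi (e1 u v) u v.
Let y1 u v := comp1 eps psi (e2 u v) u v.
Let y2 u v := comp2 eps psi (e2 u v) u v.
Notation V1 := (vdir x1 x2).
Notation V2 := (vdir y1 y2).
Notation "h '^c'" := (pull h (chart M c)) (at level 1, format "h '^c'").

Lemma chart_connection u v : U u v ->
  ip eps (V1 e1 u v) (e2 u v) = - a1^c u v /\ ip eps (V2 e2 u v) (e1 u v) = a2^c u v /\
  ip eps (V1 e1 u v) (e3 u v) = k1^c u v /\ ip eps (V1 e2 u v) (e3 u v) = 0 /\
  ip eps (V2 e2 u v) (e3 u v) = k2^c u v /\ ip eps (V1 e1 u v) (e4 u v) = alpha^c u v /\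
  ip eps (V2 e2 u v) (e4 u v) = - alpha^c u v /\
  ip eps (V1 e3 u v) (e4 u v) = b1^c u v /\ ip eps (V2 e3 u v) (e4 u v) = b2^c u v /\
  k1^c u v + k2^c u v = 2 * fc u v.
Proof.
  intros Huv.
  assert (Tsf := tangent_is_tangent_space_form U HU eps psi Hpsi Hsf).
  destruct (ON u v) as (O11 & O22 & O12).
  destruct (frame_principal hE c u v Huv) as [P1 P2].
  pose proof (frame_alpha hfun c u v Huv) as PA; cbv zeta in PA.
  destruct (frame_a hfun c u v Huv) as [A1 A2].
  destruct (frame_b hfun c u v Huv) as [B1 B2].
  change (shape eps psi (e3 u v) (e1 u v) u v = vscal (k1^c u v) (e1 u v)) in P1.
  change (shape eps psi (e3 u v) (e2 u v) u v = vscal (k2^c u v) (e2 u v)) in P2.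
  change (alpha^c u v = ip eps (shape eps psi (e4 u v) (e1 u v) u v) (e1 u v)) in PA.
  change (nabla eps psi (e1 u v) e1 u v = vscal (- a1^c u v) (e2 u v)) in A1.
  change (nabla eps psi (e2 u v) e2 u v = vscal (a2^c u v) (e1 u v)) in A2.
  change (b1^c u v = ip eps (nabla_perp eps psi (e1 u v) e3 u v) (e4 u v)) in B1.
  change (b2^c u v = ip eps (nabla_perp eps psi (e2 u v) e3 u v) (e4 u v)) in B2.
  destruct (ip_sff_frame eps psi U e1 e2 e3 e4 F (e3 u v) u v Huv (N3 u v Huv))
    as (F11 & F12 & F21 & F22).
  destruct (ip_sff_frame eps psi U e1 e2 e3 e4 F (e4 u v) u v Huv (N4 u v Huv))
    as (G11 & G12 & G21 & G22).
  pose proof (ip_mean_curvature_vector eps psi U e1 e2 e3 e4 F (e3 u v) u v Huv (N3 u v Huv)) as M3.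
  pose proof (ip_mean_curvature_vector eps psi U e1 e2 e3 e4 F (e4 u v) u v Huv (N4 u v Huv)) as M4.
  fold H in M3, M4; rewrite mean_curvature_direction in M3, M4 by trivial.
  fold x1 x2 y1 y2 in F11, F12, F21, F22, G11, G12, G21, G22, M3, M4.
  rewrite ip_scall, I33 in M3 by trivial; rewrite ip_scall, I34 in M4 by trivial.
  assert (Sh : forall n X Z, is_tangent psi Z u v ->
    ip eps (shape eps psi n X u v) Z = ip eps (sff eps psi X Z u v) n).
  { intros n X Z HZ; apply (ip_shape U eps psi Hg); trivial. }
  assert (Nb : forall X V Z, is_tangent psi Z u v -> ip eps (nabla eps psi X V u v) Z
    = comp1 eps psi X u v * ip eps (D1 V u v) Z + comp2 eps psi X u v * ip eps (D2 V u v) Z).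
  { intros X V Z HZ; unfold nabla, nabla_bar.
    rewrite ip_tan_part, ip_proj_orthogonal by auto; ip_expand; reflexivity. }
  assert (Q1 := Sh (e3 u v) (e1 u v) (e1 u v) (T1 u v Huv)).
  assert (Q2 := Sh (e3 u v) (e1 u v) (e2 u v) (T2 u v Huv)).
  assert (Q3 := Sh (e3 u v) (e2 u v) (e2 u v) (T2 u v Huv)).
  rewrite P1, ip_scall, O11, F11 in Q1; rewrite P1, ip_scall, O12, F12 in Q2.
  rewrite P2, ip_scall, O22, F22 in Q3.
  rewrite Sh, G11 in PA by auto.
  assert (R1 := Nb (e1 u v) e1 (e2 u v) (T2 u v Huv)).
  assert (R2 := Nb (e2 u v) e2 (e1 u v) (T1 u v Huv)).
  rewrite A1, ip_scall, O22 in R1; rewrite A2, ip_scall, O11 in R2.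
  rewrite (ip_nabla_perp U) in B1, B2 by auto.
  assert (L : forall X V n, ip eps (vdir (fun u v => comp1 eps psi (X u v) u v)
    (fun u v => comp2 eps psi (X u v) u v) V u v) n
    = comp1 eps psi (X u v) u v * ip eps (D1 V u v) n
      + comp2 eps psi (X u v) u v * ip eps (D2 V u v) n).
  { intros X V n; unfold vdir; ip_expand; reflexivity. }
  pose proof (L e1 e1 (e2 u v)) as L1; pose proof (L e2 e2 (e1 u v)) as L2.
  pose proof (L e1 e3 (e4 u v)) as L3; pose proof (L e2 e3 (e4 u v)) as L4.
  fold x1 x2 in L1, L3; fold y1 y2 in L2, L4.
  repeat split; lra.
Qed.

Lemma chart_not_umbilic u v : U u v -> k1^c u v <> k2^c u v.
Proof.
  intros Huv E; destruct (hncmc c u v Huv) as (_ & _ & X & HX & HN); cbv zeta in HN.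
  apply HN; clear HN.
  destruct (chart_connection u v Huv) as (_ & _ & _ & _ & _ & _ & _ & _ & _ & Hm).
  destruct (frame_principal hE c u v Huv) as [P1 P2].
  change (shape eps psi (e3 u v) (e1 u v) u v = vscal (k1^c u v) (e1 u v)) in P1.
  change (shape eps psi (e3 u v) (e2 u v) u v = vscal (k2^c u v) (e2 u v)) in P2.
  change (shape eps psi (vscal (/ fc u v) (H u v)) X u v = vscal (fc u v) X).
  change (is_tangent psi X u v) in HX.
  assert (E3' : vscal (/ fc u v) (H u v) = e3 u v)
    by (symmetry; apply (frame_E3 hE c u v Huv)).
  rewrite E3'.
  destruct (ON u v) as (O11 & O22 & O12).
  assert (TO := tangent_orthonormal eps psi u v (e1 u v) (e2 u v) (T1 u v Huv) (T2 u v Huv)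
    O11 O22 O12).
  assert (TS : is_tangent psi (shape eps psi (e3 u v) X u v) u v) by apply tangent_sharp.
  assert (Sh : forall Y Z, is_tangent psi Z u v ->
    ip eps (shape eps psi (e3 u v) Y u v) Z = ip eps (sff eps psi Y Z u v) (e3 u v)).
  { intros Y Z HZ; apply (ip_shape U eps psi Hg); trivial. }
  assert (Ei : forall Z, is_tangent psi Z u v ->
    ip eps (shape eps psi (e3 u v) X u v) Z = ip eps (vscal (fc u v) X) Z).
  { intros Z HZ.
    transitivity (ip eps X (e1 u v) * ip eps (shape eps psi (e3 u v) (e1 u v) u v) Z
      + ip eps X (e2 u v) * ip eps (shape eps psi (e3 u v) (e2 u v) u v) Z).
    - rewrite 3!Sh by trivial; rewrite (TO X HX) at 1.
      rewrite !(ip_sff U eps psi) by auto.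
      rewrite !comp1_add, !comp2_add, !comp1_scal, !comp2_scal; ring.
    - rewrite P1, P2.
      assert (EX : ip eps X Z = ip eps X (e1 u v) * ip eps (e1 u v) Z
        + ip eps X (e2 u v) * ip eps (e2 u v) Z).
      { rewrite (TO X HX) at 1; ip_expand; reflexivity. }
      ip_expand; rewrite EX.
      replace (k1^c u v) with (fc u v) by lra; replace (k2^c u v) with (fc u v) by lra; ring. }
  rewrite (TO _ TS), 2!Ei by auto; ip_expand.
  rewrite (TO X HX) at 3; apply vec_ext; intros i; unfold vadd, vscal; ring.
Qed.

Lemma chart_shape_off_diagonal u v : U u v -> ip eps (V1 e2 u v) (e4 u v) = 0.
Proof.
  intros Huv.
  apply (flat_shape_operators_commute eps psi U e1 e2 e3 e4 F k1^c k2^c alpha^c a1^c a2^c b1^c b2^c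
    (fun u v => ip eps (V1 e2 u v) (e4 u v))); trivial;
    try (intros a b Hab; apply (chart_connection a b Hab)).
  - apply hflat.
  - apply chart_not_umbilic, Huv.
Qed.

Lemma chart_alpha_neq_0 u v : U u v -> alpha^c u v <> 0.
Proof.
  intros Huv E; destruct (hA4 c u v Huv) as (X & HX & HN); apply HN; clear HN.
  change (is_tangent psi X u v) in HX; change (shape eps psi (e4 u v) X u v = vzero).
  destruct (chart_connection u v Huv) as (_ & _ & _ & _ & _ & C1 & C2 & _).
  assert (C12 := chart_shape_off_diagonal u v Huv).
  destruct (ON u v) as (O11 & O22 & O12).
  assert (TO := tangent_orthonormal eps psi u v (e1 u v) (e2 u v) (T1 u v Huv) (T2 u v Huv)
    O11 O22 O12).
  assert (TS : is_tangent psi (shape eps psi (e4 u v) X u v) u v) by apply tangent_sharp.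
  destruct (ip_sff_frame eps psi U e1 e2 e3 e4 F (e4 u v) u v Huv (N4 u v Huv))
    as (G11 & G12 & G21 & G22).
  fold x1 x2 y1 y2 in G11, G12, G21, G22.
  assert (BN := bracket_normal eps psi U e1 e2 e3 e4 F u v (e4 u v) Huv (N4 u v Huv)).
  fold x1 x2 y1 y2 in BN; rewrite BN in G21.
  rewrite C1, E in G11; rewrite C12 in G12, G21; rewrite C2, E in G22.
  assert (Z : forall Z, is_tangent psi Z u v -> ip eps (sff eps psi X Z u v) (e4 u v)
    = ip eps X (e1 u v) * ip eps (sff eps psi (e1 u v) Z u v) (e4 u v)
      + ip eps X (e2 u v) * ip eps (sff eps psi (e2 u v) Z u v) (e4 u v)).
  { intros Z HZ; rewrite (TO X HX) at 1; rewrite !(ip_sff U eps psi) by auto.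
    rewrite !comp1_add, !comp2_add, !comp1_scal, !comp2_scal; ring. }
  rewrite (TO _ TS), 2!(ip_shape U eps psi Hg), 2!Z, G11, G12, G21, G22 by auto.
  apply vec_ext; intros i; unfold vadd, vscal, vzero; ring.
Qed.

Lemma chart_gauss u v : U u v ->
  K^c u v = eps + k1^c u v * k2^c u v - alpha^c u v * alpha^c u v.
Proof.
  intros Huv; transitivity (gauss_curvature eps psi u v); [apply (hK c u v Huv)|].
  apply (gauss_curvature_frame eps psi U e1 e2 e3 e4 F k1^c k2^c alpha^c a1^c a2^c b1^c b2^c
    (fun u v => ip eps (V1 e2 u v) (e4 u v))); trivial;
    try (intros a b Hab; apply (chart_connection a b Hab)).
  exact chart_shape_off_diagonal.
Qed.

Lemma chart_principal_data : principal_data eps U x1 x2 y1 y2 fc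
  k1^c k2^c alpha^c a1^c a2^c b1^c b2^c.
Proof.
  set (g := fun u v => ip eps (V1 e2 u v) (e4 u v)).
  assert (SM : smooth_on U a1^c /\ smooth_on U a2^c /\ smooth_on U k1^c /\ smooth_on U k2^c /\
    smooth_on U alpha^c /\ smooth_on U b1^c /\ smooth_on U b2^c).
  { apply (connection_smooth eps psi U e1 e2 e3 e4 F k1^c k2^c alpha^c a1^c a2^c b1^c b2^c g);
      trivial; try (intros a b Hab; apply (chart_connection a b Hab)). }
  constructor; trivial.
  - apply (frame_comp_smooth eps psi U e1 e2 e3 e4 F).
  - intros u v Huv; destruct (ON u v) as (O11 & O22 & O12).
    apply (comp_det_neq_0 eps psi u v); auto.
  - apply mean_curvature_smooth.
  - intros u v Huv.
    apply (bracket_coefficients eps psi U e1 e2 e3 e4 F k1^c k2^c alpha^c a1^c a2^c b1^c b2^c g);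
      trivial; try (intros a b Hab; apply (chart_connection a b Hab)).
  - intros u v Huv.
    apply (structure_equations eps psi U e1 e2 e3 e4 F k1^c k2^c alpha^c a1^c a2^c b1^c b2^c g);
      trivial; try (intros a b Hab; apply (chart_connection a b Hab)).
    exact chart_shape_off_diagonal.
  - intros u v Huv; apply (chart_connection u v Huv).
  - intros u v Huv.
    apply (biconservative_equations eps psi U e1 e2 e3 e4 F k1^c k2^c alpha^c a1^c a2^c b1^c b2^c g);
      trivial; try (intros a b Hab; apply (chart_connection a b Hab)).
    + exact chart_shape_off_diagonal.
    + apply mean_curvature_smooth.
    + exact mean_curvature_direction.
    + apply hbic, Huv.
  - intros u v Huv; destruct hW as (W & SW & GW & ZW).
    destruct SM as (Sa1 & Sa2 & Sk1 & Sk2 & Sal & Sb1 & Sb2).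
    assert (Skk : smooth_on U (fun u v => k1^c u v * k2^c u v - alpha^c u v * alpha^c u v)).
    { apply smooth_minus; trivial; apply smooth_mult; trivial. }
    assert (EK : forall z1 z2, dir z1 z2 K^c u v
      = dir z1 z2 (fun u v => k1^c u v * k2^c u v - alpha^c u v * alpha^c u v) u v).
    { intros z1 z2; rewrite (dir_ext U HU z1 z2 K^c
        (fun u v => eps + (k1^c u v * k2^c u v - alpha^c u v * alpha^c u v))); trivial.
      - rewrite (dir_plus U HU z1 z2 (fun _ _ => eps)), dir_const; trivial; [ring|].
        apply smooth_const, HU.
      - intros a b Hab; rewrite chart_gauss by trivial; ring. }
    rewrite <- 2!EK.
    apply (weingarten_jacobian U fc K^c W); trivial.
    + apply mean_curvature_smooth.
    + apply (smooth_ext U (fun u v => eps + (k1^c u v * k2^c u v - alpha^c u v * alpha^c u v)));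
        trivial.
      * intros a b Hab; rewrite chart_gauss by trivial; ring.
      * apply (smooth_plus U (fun _ _ => eps)); trivial; apply smooth_const, HU.
    + intros a b _; apply ZW.
  - intros u v Huv; destruct (mean_curvature_positive u v Huv) as (_ & P & _); lra.
  - exact chart_alpha_neq_0.
  - intros u v Huv E; apply (hE2 c u v Huv).
    destruct (frame_a hfun c u v Huv) as [_ A2].
    refine (eq_trans A2 _).
    change (vscal (a2^c u v) (e1 u v) = vzero); rewrite E.
    apply vec_ext; intros i; unfold vscal, vzero; ring.
  - intros u v Huv; destruct (hncmc c u v Huv) as (_ & HG & _).
    destruct (Req_dec (dir x1 x2 fc u v) 0) as [D1'|]; [right|left; trivial].
    intros D2'; apply HG.
    change (grad eps psi fc u v = vzero).
    destruct (ON u v) as (O11 & O22 & O12).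
    assert (TG : is_tangent psi (grad eps psi fc u v) u v) by apply tangent_sharp.
    rewrite (tangent_orthonormal eps psi u v (e1 u v) (e2 u v) (T1 u v Huv) (T2 u v Huv)
      O11 O22 O12 _ TG).
    unfold grad; rewrite 2!ip_sharp by auto.
    unfold dir, x1, x2, y1, y2 in D1', D2'; rewrite D1', D2'.
    apply vec_ext; intros i; unfold vadd, vscal, vzero; ring.
  - intros u v Huv E; apply (hfK (chart M c u v)).
    change (3 * fc u v ^ 2 + K^c u v - eps = 0); rewrite chart_gauss by trivial; lra.
Qed.
End OneChart.
End Charts.

(** The differential of [h] and the form dual to the first field of the frame both
    vanish on the second field, so that they are proportional. *)
Lemma dual_form_differential U x1 x2 y1 y2 w1 w2 h u v : open2 U -> smooth_on U h -> U u v ->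
  x1 u v * y2 u v - x2 u v * y1 u v <> 0 ->
  w1 u v * x1 u v + w2 u v * x2 u v = 1 -> w1 u v * y1 u v + w2 u v * y2 u v = 0 ->
  dir y1 y2 h u v = 0 ->
  differentiable_pt_lim h u v (dir x1 x2 h u v * w1 u v) (dir x1 x2 h u v * w2 u v).
Proof.
  intros HU Sh Huv Hd W1 W2 Hh.
  pose proof (smooth_differentiable U h u v HU Sh Huv) as D.
  assert (L : d1 h u v = dir x1 x2 h u v * w1 u v /\ d2 h u v = dir x1 x2 h u v * w2 u v).
  { unfold dir in *.
    set (p1 := x1 u v) in *; set (p2 := x2 u v) in *; set (q1 := y1 u v) in *.
    set (q2 := y2 u v) in *; set (m1 := w1 u v) in *; set (m2 := w2 u v) in *.
    set (h1 := d1 h u v) in *; set (h2 := d2 h u v) in *.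
    clearbody p1 p2 q1 q2 m1 m2 h1 h2; clear - W1 W2 Hh Hd.
    split; apply (Rmult_eq_reg_l (p1 * q2 - p2 * q1)); trivial; nsatz. }
  destruct L as [<- <-]; exact D.
Qed.

Lemma constant_along_t (d : posreal) t0 h s t :
  (forall z, box 0 t0 d s z -> is_derive (h s) z 0) -> box 0 t0 d s t -> h s t = h s t0.
Proof.
  intros Hd [Hs Ht].
  destruct (MVT_gen (h s) t0 t (fun _ => 0)) as (c & _ & E).
  - intros z Hz; apply Hd.
    destruct (box_segment t0 0 d t s z (conj Ht Hs)); [lra | split; trivial].
  - intros z Hz; apply continuity_pt_filterlim, (ex_derive_continuous (h s) z).
    exists 0; apply Hd.
    destruct (box_segment t0 0 d t s z (conj Ht Hs) Hz); split; trivial.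
  - lra.
Qed.

Theorem theorem3p9 (eps : R) (M : surface) (phi : M -> vec)
  (f K : M -> R) (E1 E2 E3 E4 : M -> vec)
  (k1 k2 alpha a1 a2 b1 b2 : M -> R)
  (hphi : immersed_surface eps M phi)
  (hf : is_mean_curvature eps M phi f)
  (hK : is_gauss_curvature eps M phi K)
  (hE : adapted_frame eps M phi f E1 E2 E3 E4 k1 k2)
  (hfun : frame_functions eps M phi E1 E2 E3 E4 alpha a1 a2 b1 b2)
  (hlab : labelling_convention eps M phi E3 b1 b2)
  (hncmc : non_cmc eps M phi f)
  (hbic : biconservative eps M phi)
  (hW : W_surface M f K)
  (hflat : flat_normal_bundle eps M phi)
  (hfK : forall p, 3 * f p ^ 2 + K p - eps <> 0)
  (hE3 : nowhere_parallel eps M phi E3)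
  (hA4 : shape_nowhere_zero eps M phi E4)
  (hE2 : nowhere_geodesic eps M phi E2) :
  forall p0 : M, exists x : param M,
    local_coordinates M x /\
    (exists s t, pdom x s t /\ x s t = p0) /\
    exists F K1 K2 Al A2 B1 G : R -> R,
      forall s t, pdom x s t ->
        f (x s t) = F s /\ k1 (x s t) = K1 s /\ k2 (x s t) = K2 s /\
        alpha (x s t) = Al s /\ a2 (x s t) = A2 s /\ b1 (x s t) = B1 s /\
        K (x s t) = G s /\
        ode_system eps A2 F Al K2 B1 s.
Proof.
  intros p0.
  assert (PD := chart_principal_data eps M phi f K E1 E2 E3 E4 k1 k2 alpha a1 a2 b1 b2
    hphi hf hE hfun hncmc hK hbic hW hflat hfK hA4 hE2).
  assert (Gs := chart_gauss eps M phi f K E1 E2 E3 E4 k1 k2 alpha a1 a2 b1 b2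
    hphi hf hE hfun hncmc hK hflat).
  assert (Hb : forall p, b1 p <> 0).
  { apply hlab; trivial; intros p; destruct (chart_cover M p) as (c & u & v & Huv & <-).
    destruct (principal_rigidity (PD c) u v Huv) as (_ & B2 & _).
    unfold pull in B2; rewrite B2; ring. }
  destruct (chart_cover M p0) as (c & u0 & v0 & H0 & <-).
  specialize (PD c); specialize (Gs c).
  set (U := pdom (chart M c)) in *.
  set (x1 := fun u v => comp1 eps (pull phi (chart M c)) (pull E1 (chart M c) u v) u v) in PD.
  set (x2 := fun u v => comp2 eps (pull phi (chart M c)) (pull E1 (chart M c) u v) u v) in PD.
  set (y1 := fun u v => comp1 eps (pull phi (chart M c)) (pull E2 (chart M c) u v) u v) in PD.
  set (y2 := fun u v => comp2 eps (pull phi (chart M c)) (pull E2 (chart M c) u v) u v) in PD.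
  set (fc := pull f (chart M c)) in *; set (k1c := pull k1 (chart M c)) in *.
  set (k2c := pull k2 (chart M c)) in *; set (alc := pull alpha (chart M c)) in *.
  set (a1c := pull a1 (chart M c)) in *; set (a2c := pull a2 (chart M c)) in *.
  set (b1c := pull b1 (chart M c)) in *; set (b2c := pull b2 (chart M c)) in *.
  clearbody x1 x2 y1 y2.
  pose proof (principal_rigidity PD) as Rg.
  destruct PD as [HU (X1 & X2 & Y1 & Y2) Hdet Sf (Sa1 & Sa2 & Sk1 & Sk2 & Sal & Sb1 & Sb2)
    Hbr Hst Hm Hbc _ Hf0 Hal0 _ _ _].
  destruct (dual_form_closed U x1 x2 y1 y2 a2c) as (w1 & w2 & S1 & S2 & Hw); trivial.
  { intros u v Huv; destruct (Hbr u v Huv) as [-> ->].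
    destruct (Rg u v Huv) as (-> & _); split; ring. }
  destruct (closed_form_coordinates U w1 w2 u0 v0) as (d & t0 & V & X & Y & S & T & CC & EX & EY & HV);
    trivial.
  { intros u v Huv; apply (Hw u v Huv). }
  { destruct (Req_dec (w1 u0 v0) 0) as [Z1|]; [right|left; trivial].
    intros Z2; destruct (Hw u0 v0 H0) as (_ & E & _); rewrite Z1, Z2 in E; lra. }
  exists (Param M (box 0 t0 d) (fun s t => chart M c (X s t) (Y s t))).
  split; [|split].
  - apply (coordinate_change_local_coordinates M c _ V X Y S T CC); intros u v Huv; apply HV, Huv.
  - exists 0, t0; simpl; split; [apply box_center, cond_pos | rewrite EX, EY; reflexivity].
  - assert (D : forall h, smooth_on U h -> (forall u v, U u v -> dir y1 y2 h u v = 0) ->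
      (forall s t, box 0 t0 d s t -> h (X s t) (Y s t) = h (X s t0) (Y s t0)) /\
      forall s, box 0 t0 d s t0 -> is_derive (fun z => h (X z t0) (Y z t0)) s
        (dir x1 x2 h (X s t0) (Y s t0))).
    { intros h Sh Zh.
      assert (C : forall s t, box 0 t0 d s t ->
        is_derive (fun z => h (X z t) (Y z t)) s (dir x1 x2 h (X s t) (Y s t)) /\
        is_derive (fun z => h (X s z) (Y s z)) t 0).
      { intros s t Hs.
        apply (coordinate_change_derivatives (box 0 t0 d) V X Y S T w1 w2); trivial.
        - intros u v Huv; apply HV, Huv.
        - intros u v Huv; destruct (HV u v Huv) as [HUuv _]; destruct (Hw u v HUuv) as (_ & W1 & W2).
          apply (dual_form_differential U x1 x2 y1 y2); auto. }
      split.
      - intros s t Hs; apply (constant_along_t d t0 (fun s t => h (X s t) (Y s t))); trivial.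
        intros z Hz; apply (C s z Hz).
      - intros s Hs; apply (C s t0 Hs). }
    destruct (D fc Sf) as [Cf Df]; [intros u v Huv; apply (Rg u v Huv)|].
    destruct (D k1c Sk1) as [Ck1 _]; [intros u v Huv; apply (Rg u v Huv)|].
    destruct (D k2c Sk2) as [Ck2 Dk2]; [intros u v Huv; apply (Rg u v Huv)|].
    destruct (D alc Sal) as [Cal Dal]; [intros u v Huv; apply (Rg u v Huv)|].
    destruct (D a2c Sa2) as [Ca2 Da2]; [intros u v Huv; apply (Rg u v Huv)|].
    destruct (D b1c Sb1) as [Cb1 _]; [intros u v Huv; apply (Rg u v Huv)|].
    exists (fun s => fc (X s t0) (Y s t0)), (fun s => k1c (X s t0) (Y s t0)),
      (fun s => k2c (X s t0) (Y s t0)), (fun s => alc (X s t0) (Y s t0)),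
      (fun s => a2c (X s t0) (Y s t0)), (fun s => b1c (X s t0) (Y s t0)),
      (fun s => pull K (chart M c) (X s t0) (Y s t0)).
    simpl; intros s t Hs.
    assert (Hs0 : box 0 t0 d s t0).
    { split; [apply Hs | rewrite Rminus_diag, Rabs_R0; apply cond_pos]. }
    assert (HUs : U (X s t) (Y s t)) by apply HV, (cc_maps CC s t Hs).
    assert (HU0 : U (X s t0) (Y s t0)) by apply HV, (cc_maps CC s t0 Hs0).
    split; [exact (Cf s t Hs)|]; split; [exact (Ck1 s t Hs)|]; split; [exact (Ck2 s t Hs)|].
    split; [exact (Cal s t Hs)|]; split; [exact (Ca2 s t Hs)|]; split; [exact (Cb1 s t Hs)|].
    split.
    { change (pull K (chart M c) (X s t) (Y s t) = pull K (chart M c) (X s t0) (Y s t0)).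
      rewrite (Gs _ _ HUs), (Gs _ _ HU0).
      fold k1c k2c alc; rewrite Ck1, Ck2, Cal by exact Hs; reflexivity. }
    specialize (Df s Hs0); specialize (Dk2 s Hs0); specialize (Dal s Hs0); specialize (Da2 s Hs0).
    assert (Hb1 : b1c (X s t0) (Y s t0) <> 0) by apply Hb.
    destruct (Rg _ _ HU0) as (A1 & B2 & _).
    destruct (Hst _ _ HU0) as (Q1 & _ & Q3 & _ & _ & Q6).
    destruct (Hbc _ _ HU0) as (Q7 & _).
    specialize (Hm _ _ HU0).
    rewrite (dir_ext U HU y1 y2 a1c (fun _ _ => 0)), dir_const, A1 in Q6
      by (trivial; intros; apply Rg; trivial).
    specialize (Hf0 _ _ HU0); specialize (Hal0 _ _ HU0).
    unfold ode_system; cbv beta.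
    set (F0 := fc (X s t0) (Y s t0)) in *; set (K20 := k2c (X s t0) (Y s t0)) in *.
    set (K10 := k1c (X s t0) (Y s t0)) in *; set (A0 := alc (X s t0) (Y s t0)) in *.
    set (A20 := a2c (X s t0) (Y s t0)) in *; set (B10 := b1c (X s t0) (Y s t0)) in *.
    assert (EK1 : K10 = 2 * F0 - K20) by lra; rewrite EK1 in *.
    assert (N : 3 * F0 - K20 <> 0).
    { intros N.
      replace (F0 + (2 * F0 - K20)) with (3 * F0 - K20) in Q7 by ring; rewrite N in Q7.
      assert (Z : F0 * A0 * B10 = 0) by lra.
      destruct (Rmult_integral _ _ Z) as [Z'|]; [destruct (Rmult_integral _ _ Z')|]; tauto. }
    split; [exact N|]; split; [|split; [|split]].
    + replace (eps + K20 * (2 * F0 - K20) - A0 ^ 2 + A20 ^ 2)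
        with (dir x1 x2 a2c (X s t0) (Y s t0)) by lra; exact Da2.
    + replace (- (F0 * A0 * B10 / (3 * F0 - K20))) with (dir x1 x2 fc (X s t0) (Y s t0)); [exact Df|].
      apply (Rmult_eq_reg_l (3 * F0 - K20)); trivial.
      transitivity (- (F0 * A0 * B10)); [rewrite <- Q7; ring | field; exact N].
    + replace (2 * A0 * A20 + K20 * B10) with (dir x1 x2 alc (X s t0) (Y s t0)) by lra; exact Dal.
    + replace (2 * A20 * (K20 - F0) - A0 * B10) with (dir x1 x2 k2c (X s t0) (Y s t0)) by lra; exact Dk2.
Qed.
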